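(* Let $S$ be a $p\times p$ symmetric rational Schur function of McMillan degree $n$, strictly contractive at infinity, and let $H$ be the matrix defined in the context from some minimal symmetric realization $(A,B,C,D)$ of $S$. Let $\kappa$ be the number of distinct roots in $\Pi^+$ of the characteristic polynomial $\chi_H$ having odd algebraic multiplicity. Then $S$ has a $2p\times2p$ symmetric inner extension of McMillan degree $n+\kappa$, and every $2p\times 2p$ symmetric inner extension of $S$ has McMillan degree at least $n+\kappa$.
   Context: $\Pi^+=\{s\in\mathbb C:\operatorname{Re}s>0\}$. A rational $p\times m$ matrix function analytic in $\Pi^+$ is a Schur function if $S(s)S(s)^*\le I_p$ on $\Pi^+$; a square rational Schur function is inner if $S(i\omega)S(i\omega)^*=I$ for all real $\omega$. A realization $(A,B,C,D)$ means $S(s)=C(sI_n-A)^{-1}B+D$; minimal if $n$ is minimal; this minimal $n$ is the McMillan degree. A realization is symmetric if $A=A^T$, $C=B^T$, $D=D^T$; every symmetric $S$ ($S=S^T$) has a minimal symmetric realization. A $2p\times 2p$ function is an extension of a $p\times p$ function $S$ if its lower-right $p\times p$ block is $S$; it is symmetric if it equals its transpose. $S$ is strictly contractive at infinity if $\|D\|<1$. Define $\hat A=A+BD^*(I_p-DD^* )^{-1}C$, $\hat B=B(I_p-D^*D)^{-1/2}$, $\hat C=(I_p-DD^* )^{-1/2}C$ and $H=\begin{pmatrix}-\hat A^*&-\hat C^*\hat C\\ \hat B\hat B^*&\hat A\end{pmatrix}$. *)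

(* Defs.v *)
(* Scalars: an arbitrary numClosedFieldType C (e.g. algC),
   i.e. an algebraically closed field with complex conjugation z^* , real part 'Re z
   and the induced order (0 <= z iff z is real and nonnegative). *)
From HB Require Import structures.
From mathcomp Require Import all_boot all_order all_algebra.
Set Implicit Arguments. Unset Strict Implicit. Unset Printing Implicit Defensive.
Import Order.TTheory GRing.Theory Num.Theory.
Local Open Scope ring_scope.

Section Defs.
Variable C : numClosedFieldType.

Definition ctmx m n (M : 'M[C]_(m, n)) : 'M[C]_(n, m) := (map_mx Num.conj M)^T.

Definition vnorm2 n (v : 'cV[C]_n) : C := (ctmx v *m v) 0 0.

Definition hermitian n (M : 'M[C]_n) : Prop := ctmx M = M.

Definition psd n (M : 'M[C]_n) : Prop :=
  forall v : 'cV[C]_n, 0 <= (ctmx v *m M *m v) 0 0.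
Definition posdef n (M : 'M[C]_n) : Prop :=
  forall v : 'cV[C]_n, v != 0 -> 0 < (ctmx v *m M *m v) 0 0.

Definition loewner_le n (L R : 'M[C]_n) : Prop := psd (R - L).

Definition is_inv_sqrt n (R M : 'M[C]_n) : Prop :=
  hermitian R /\ posdef R /\ R *m R *m M = 1%:M.

Definition strictly_contractive p m (D : 'M[C]_(p, m)) : Prop :=
  forall v : 'cV[C]_m, v != 0 -> vnorm2 (D *m v) < vnorm2 v.

End Defs.

(* A (proper) rational p x m matrix function, given through a state space
   realization S(s) = C (s I_n - A)^{-1} B + D. *)
Record realization (K : numClosedFieldType) (p m : nat) := Realization {
  rdim : nat;
  rA : 'M[K]_rdim;
  rB : 'M[K]_(rdim, m);
  rC : 'M[K]_(p, rdim);
  rD : 'M[K]_(p, m) }.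

Section Functions.
Variable K : numClosedFieldType.
Variables p m : nat.

Definition regular (R : realization K p m) (s : K) : bool :=
  ~~ root (char_poly (rA R)) s.

Definition tf (R : realization K p m) (s : K) : 'M[K]_(p, m) :=
  rC R *m invmx (s%:M - rA R) *m rB R + rD R.

(* two realizations define the same rational function (they agree on the
   common cofinite domain) *)
Definition same_fun (R1 R2 : realization K p m) : Prop :=
  forall s, regular R1 s -> regular R2 s -> tf R1 s = tf R2 s.

Definition mcmillan_degree (R : realization K p m) (k : nat) : Prop :=
  (exists R' : realization K p m, same_fun R R' /\ rdim R' = k) /\
  (forall R' : realization K p m, same_fun R R' -> (k <= rdim R')%N).

Definition minimal_real (R : realization K p m) : Prop :=
  mcmillan_degree R (rdim R).

(* Schur function: S(s) S(s)^* <= I on Pi^+ (on the domain of the formula; a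
   rational function bounded on Pi^+ minus finitely many points has no poles in Pi^+) *)
Definition schur (R : realization K p m) : Prop :=
  forall s, 0 < 'Re s -> regular R s ->
    loewner_le (tf R s *m ctmx (tf R s)) 1%:M.

End Functions.

Section Square.
Variable K : numClosedFieldType.
Variable p : nat.

Definition inner (R : realization K p p) : Prop :=
  schur R /\
  forall s, 'Re s = 0 -> regular R s -> tf R s *m ctmx (tf R s) = 1%:M.

Definition symmetric_fun (R : realization K p p) : Prop :=
  forall s, regular R s -> (tf R s)^T = tf R s.

Definition extension (E : realization K (p + p) (p + p)) (S : realization K p p) : Prop :=
  forall s, regular E s -> regular S s -> drsubmx (tf E s) = tf S s.

Definition symmetric_real (R : realization K p p) : Prop :=
  (rA R)^T = rA R /\ rC R = (rB R)^T /\ (rD R)^T = rD R.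

End Square.

(* Main.v *)
(** A symmetric inner extension [E] of [S] satisfies [f ^ 2 = +- det E * det (1 - S S~)] where
    [f] is the common determinant of the two off-diagonal blocks and [S~ (s) = S (- s^* )^*].
    For minimal realizations [det E] is, up to a constant, [chi~ / chi] with [chi] the
    characteristic polynomial of the state matrix of [E], and [det (1 - S S~)] is [chi_H] over
    [chi_S chi_S~].  Writing [chi = q chi_S], one gets [F ^ 2 = c q q~ chi_H] for a polynomial
    [F]; hence each root of odd multiplicity [z] of [chi_H] forces [q] to vanish at [z] or at
    [- z^*], so the degree of [q] is at least [kappa].

    Conversely, adjoin to [S] the unobservable and uncontrollable poles [- z^*], for [z] among
    the [kappa] points.  All eigenvalues in the right half plane of the enlarged Hamiltonian
    have even multiplicity.  It is selfadjoint for a symmetric bilinear form and anticommutes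
    with an antilinear involution [J] (swap and conjugate); a maximal isotropic subspace that
    is invariant under both is Lagrangian: at an eigenvalue off the axis, even multiplicity
    yields an isotropic eigenvector [v], which is adjoined together with [J v]; on the axis,
    [1 - S S^* >= 0] makes every eigenvector neutral.  Such a subspace is the graph of a
    hermitian solution [P] of the Riccati equation with [P^T P = 1], which is positive by
    Lyapunov's theorem, and [P^T P = 1] makes the inner extension built from [P] symmetric. *)
Require Import Defs.
From HB Require Import structures.
From mathcomp Require Import all_boot all_order all_algebra.
From mathcomp Require Import ring.
Set Implicit Arguments. Unset Strict Implicit. Unset Printing Implicit Defensive.
Import Order.TTheory GRing.Theory Num.Theory.
Local Open Scope ring_scope.

(** * Matrices and polynomials *)

(** Parity is the obstruction because at a simple eigenvalue the nondegenerate symmetric form is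
    nonzero on the eigenvector, whereas at an eigenvalue of even multiplicity an isotropic
    eigenvector always exists. Adjoining the pole [- z^*] multiplies the characteristic polynomial
    of the Hamiltonian by [X - z] and [X + z^*], which raises the multiplicity at [z] by exactly
    one. The adjoined states are decoupled from [S], yet the new inputs of the extension can reach
    them through [P].

    The scalar field carries an order but neither topology nor completeness. Limits towards the
    imaginary axis are therefore taken on polynomials in a real parameter, Lyapunov's theorem is
    proved by induction on the dimension, and inverse square roots are compared through a Sylvester
    equation.

    Rational functions are handled through realizations, whose formulas are meaningful off finitely
    many points only. Identities are proved at generic points and extended by the identity
    principle; a nonzero polynomial [w] records the exempted points. *)

Section ConjugateTranspose.
Variable K : numClosedFieldType.

Lemma ctmxE m n (M : 'M[K]_(m, n)) i j : ctmx M i j = (M j i)^*.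
Proof. by rewrite /ctmx !mxE. Qed.

Lemma ctmxK m n (M : 'M[K]_(m, n)) : ctmx (ctmx M) = M.
Proof. by apply/matrixP => i j; rewrite !ctmxE conjCK. Qed.

Lemma ctmxM m n q (M : 'M[K]_(m, n)) (N : 'M[K]_(n, q)) :
  ctmx (M *m N) = ctmx N *m ctmx M.
Proof. by rewrite /ctmx map_mxM trmx_mul. Qed.

Lemma ctmxD m n (M N : 'M[K]_(m, n)) : ctmx (M + N) = ctmx M + ctmx N.
Proof. by rewrite /ctmx map_mxD linearD. Qed.

Lemma ctmxN m n (M : 'M[K]_(m, n)) : ctmx (- M) = - ctmx M.
Proof. by rewrite /ctmx map_mxN linearN. Qed.

Lemma ctmxB m n (M N : 'M[K]_(m, n)) : ctmx (M - N) = ctmx M - ctmx N.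
Proof. by rewrite ctmxD ctmxN. Qed.

Lemma ctmxZ m n a (M : 'M[K]_(m, n)) : ctmx (a *: M) = a^* *: ctmx M.
Proof. by rewrite /ctmx map_mxZ linearZ. Qed.

Lemma ctmx0 m n : ctmx (0 : 'M[K]_(m, n)) = 0.
Proof. by rewrite /ctmx map_mx0 trmx0. Qed.

Lemma ctmx_scalar n a : ctmx (a%:M : 'M[K]_n) = (a^*)%:M.
Proof. by rewrite /ctmx map_scalar_mx tr_scalar_mx. Qed.

Lemma ctmx1 n : ctmx (1%:M : 'M[K]_n) = 1%:M.
Proof. by rewrite ctmx_scalar conjC1. Qed.

Lemma ctmx_inv n (M : 'M[K]_n) : ctmx (invmx M) = invmx (ctmx M).
Proof. by rewrite /ctmx map_invmx trmx_inv. Qed.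

Lemma ctmx_unit n (M : 'M[K]_n) : (ctmx M \in unitmx) = (M \in unitmx).
Proof. by rewrite /ctmx unitmx_tr map_unitmx. Qed.

Lemma ctmx_tr m n (M : 'M[K]_(m, n)) : ctmx M^T = (ctmx M)^T.
Proof. by rewrite /ctmx -map_trmx. Qed.

Lemma det_ctmx n (M : 'M[K]_n) : \det (ctmx M) = (\det M)^*.
Proof. by rewrite /ctmx det_tr det_map_mx. Qed.

Lemma ctmx_block m1 m2 n1 n2 (A : 'M[K]_(m1, n1)) (B : 'M[K]_(m1, n2))
    (C : 'M[K]_(m2, n1)) (D : 'M[K]_(m2, n2)) :
  ctmx (block_mx A B C D) = block_mx (ctmx A) (ctmx C) (ctmx B) (ctmx D).
Proof. by rewrite /ctmx map_block_mx tr_block_mx. Qed.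

Lemma ctmx_col m1 m2 n (A : 'M[K]_(m1, n)) (B : 'M[K]_(m2, n)) :
  ctmx (col_mx A B) = row_mx (ctmx A) (ctmx B).
Proof. by rewrite /ctmx map_col_mx tr_col_mx. Qed.

Lemma ctmx_row m n1 n2 (A : 'M[K]_(m, n1)) (B : 'M[K]_(m, n2)) :
  ctmx (row_mx A B) = col_mx (ctmx A) (ctmx B).
Proof. by rewrite /ctmx map_row_mx tr_row_mx. Qed.

Lemma vnorm2E n (v : 'cV[K]_n) : vnorm2 v = \sum_i `|v i 0| ^+ 2.
Proof.
rewrite /vnorm2 mxE; apply: eq_bigr => i _.
by rewrite ctmxE normCK mulrC.
Qed.

Lemma vnorm2_ge0 n (v : 'cV[K]_n) : 0 <= vnorm2 v.
Proof. by rewrite vnorm2E sumr_ge0 // => i _; rewrite exprn_ge0. Qed.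

Lemma vnorm2_eq0 n (v : 'cV[K]_n) : (vnorm2 v == 0) = (v == 0).
Proof.
rewrite vnorm2E; apply/idP/eqP => [|->]; last first.
  by rewrite big1 // => i _; rewrite mxE normr0 expr0n.
rewrite psumr_eq0 => [/allP h|i _]; last by rewrite exprn_ge0.
apply/colP => i; have := h i (mem_index_enum _).
by rewrite mxE sqrf_eq0 normr_eq0 => /eqP.
Qed.

Lemma ctmx_mul_eq0 m n (B : 'M[K]_(m, n)) (x : 'rV[K]_m) :
  x *m (B *m ctmx B) *m ctmx x = 0 -> x *m B = 0.
Proof.
move=> h; suff: vnorm2 (ctmx (x *m B)) == 0.
  by rewrite vnorm2_eq0 => /eqP e; rewrite -[x *m B]ctmxK e ctmx0.
by rewrite /vnorm2 ctmxK ctmxM !mulmxA -(mulmxA x) h mxE.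
Qed.

End ConjugateTranspose.

Section Polynomials.
Variable K : numClosedFieldType.

Lemma map_char_poly_mx_horner n (A : 'M[K]_n) s :
  map_mx (horner_eval s) (char_poly_mx A) = s%:M - A.
Proof.
by apply/matrixP => i j; rewrite !mxE /= /horner_eval !hornerE hornerMn hornerX.
Qed.

Lemma horner_char_poly n (A : 'M[K]_n) s : (char_poly A).[s] = \det (s%:M - A).
Proof.
by rewrite /char_poly -horner_evalE -det_map_mx map_char_poly_mx_horner.
Qed.

Lemma regular_unit n (A : 'M[K]_n) s :
  ~~ root (char_poly A) s = (s%:M - A \in unitmx).
Proof. by rewrite unitmxE unitfE -horner_char_poly. Qed.

Lemma map_mx_horner m n (M : 'M[K]_(m, n)) x :
  map_mx (horner_eval x) (map_mx polyC M) = M.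
Proof. by apply/matrixP => i j; rewrite !mxE /= /horner_eval hornerC. Qed.

(** Otherwise the points ['i * k], with [k] a natural number, give [p * w] more roots than its
    degree; the factor [w] absorbs the points about which nothing is known. *)
Lemma poly_eq0_imag (p w : {poly K}) : w != 0 ->
  (forall s, 'Re s = 0 -> w.[s] != 0 -> p.[s] = 0) -> p = 0.
Proof.
move=> w0 h; apply/eqP/negPn/negP => p0.
have pw0 : p * w != 0 by rewrite mulf_neq0.
pose rs := [seq 'i * i%:R : K | i <- iota 0 (size (p * w)%R)].
suff: (size rs < size (p * w)%R)%N by rewrite size_map size_iota ltnn.
apply: max_poly_roots => //.
  apply/allP => _ /mapP[i _ ->]; rewrite /root hornerM mulf_eq0.
  case: (eqVneq w.[_] 0) => [_|hw]; first by rewrite orbT.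
  by rewrite h ?eqxx // ReMil (Creal_ImP _ _) ?oppr0 ?realn.
rewrite map_inj_in_uniq ?iota_uniq // => i j _ _ /(mulfI (neq0Ci _)) /eqP.
by rewrite eqr_nat => /eqP.
Qed.

Lemma poly_eq0_generic (p w : {poly K}) : w != 0 ->
  (forall s, w.[s] != 0 -> p.[s] = 0) -> p = 0.
Proof. by move=> w0 h; apply: (poly_eq0_imag w0) => s _; apply: h. Qed.

Lemma poly_ext (p q : {poly K}) : (forall s, p.[s] = q.[s]) -> p = q.
Proof.
move=> h; apply/eqP; rewrite -subr_eq0; apply/eqP.
by apply: (@poly_eq0_generic _ 1) (oner_neq0 _) _ => s _; rewrite !hornerE h subrr.
Qed.

End Polynomials.

(** * Linear systems *)

Section CharPoly.
Variable K : numClosedFieldType.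

Lemma invmx_solve n m (M : 'M[K]_n) (X Y : 'M[K]_(n, m)) :
  M \in unitmx -> M *m X = Y -> invmx M *m Y = X.
Proof. by move=> uM <-; rewrite mulKmx. Qed.

Lemma char_poly_sim n (Q A A' : 'M[K]_n) :
  Q \in unitmx -> Q *m A = A' *m Q -> char_poly A = char_poly A'.
Proof.
move=> uQ e; apply: poly_ext => s; rewrite !horner_char_poly.
have dQ : \det Q != 0 by rewrite -unitfE -unitmxE.
apply: (mulfI dQ); rewrite -det_mulmx mulmxBr e mul_mx_scalar -mul_scalar_mx.
by rewrite -mulmxBl det_mulmx mulrC.
Qed.

Lemma char_poly_tr n (A : 'M[K]_n) : char_poly A^T = char_poly A.
Proof.
apply: poly_ext => s; rewrite !horner_char_poly -det_tr.
by rewrite linearB /= trmxK tr_scalar_mx.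
Qed.

Lemma char_poly_lblock n1 n2 (A : 'M[K]_n1) (C : 'M[K]_(n2, n1)) (D : 'M[K]_n2) :
  char_poly (block_mx A 0 C D) = char_poly A * char_poly D.
Proof.
apply: poly_ext => s; rewrite hornerM !horner_char_poly.
by rewrite scalar_mx_block opp_block_mx add_block_mx oppr0 addr0 det_lblock.
Qed.

(** The row space of [T] is invariant and [N] is the restriction of [A] to it. Completing [T] to the
    basis [row_ebase T] makes [A] block triangular, with one diagonal block similar to [N]. *)
Lemma char_poly_invariant r n (T : 'M[K]_(r, n)) (A : 'M[K]_n) (N : 'M[K]_r) :
  row_free T -> T *m A = N *m T -> char_poly N %| char_poly A.
Proof.
move=> fT e.
have rT : \rank T = r by apply/eqP.
have [m en] : {m | n = (r + m)%N}.
  by exists (n - r)%N; rewrite subnKC // -[X in (X <= _)%N]rT rank_leq_col.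
subst n; set Q := row_ebase T; set L := col_ebase T.
have uQ : Q \in unitmx by apply: row_ebase_unit.
have uL : L \in unitmx by apply: col_ebase_unit.
have eT : T = L *m row_mx 1%:M 0 *m Q.
  by rewrite -[LHS]mulmx_ebase rT pid_mx_row.
have [A' eQ] : exists A', Q *m A = A' *m Q.
  by exists (Q *m A *m invmx Q); rewrite mulmxKV.
have [N' eL] : exists N', L *m N' = N *m L.
  by exists (invmx L *m N *m L); rewrite !mulmxA mulmxV ?mul1mx.
rewrite (char_poly_sim uQ eQ) -(char_poly_sim uL eL).
have : row_mx 1%:M 0 *m A' = N' *m row_mx 1%:M 0.
  apply: (can_inj (mulKmx uL)); rewrite [in RHS]mulmxA eL -[RHS]mulmxA.
  apply: (can_inj (mulmxK uQ)); rewrite -!mulmxA -eQ !mulmxA -eT e.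
  by rewrite {1}eT !mulmxA.
rewrite -[A'](submxK) mul_row_block !mul1mx !mul0mx !addr0.
rewrite mul_mx_row mulmx1 mulmx0 => /eq_row_mx[-> ->].
by rewrite char_poly_lblock dvdp_mulr.
Qed.

End CharPoly.

Section Systems.
Variable K : numClosedFieldType.

(* Popov-Belevitch-Hautus form of controllability and observability. *)
Definition controllable n m (A : 'M[K]_n) (B : 'M[K]_(n, m)) : Prop :=
  forall (x : 'rV[K]_n) l, x *m A = l *: x -> x *m B = 0 -> x = 0.

Definition observable n p (A : 'M[K]_n) (C : 'M[K]_(p, n)) : Prop :=
  forall (v : 'cV[K]_n) l, A *m v = l *: v -> C *m v = 0 -> v = 0.

Lemma observable_tr n p (A : 'M[K]_n) (C : 'M[K]_(p, n)) :
  observable A C -> controllable A^T C^T.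
Proof.
move=> h x l xA xC; apply: trmx_inj; rewrite trmx0; apply: (h _ l).
  by rewrite -[A]trmxK -trmx_mul xA linearZ.
by rewrite -[C]trmxK -trmx_mul xC trmx0.
Qed.

(* By Cayley-Hamilton [x] is killed by a product of factors [A - z]; peeling them off one at
   a time leaves an eigenvector killed by [B]. *)
Lemma kalman_controllable_row n m (A : 'M[K]_n) (B : 'M[K]_(n, m)) (x : 'rV[K]_n) :
  controllable A B -> (forall i, (i < n)%N -> x *m A ^+ i *m B = 0) -> x = 0.
Proof.
case: n A B x => [|n] A B x cAB h; first by rewrite thinmx0.
have [rs ers] := closed_field_poly_normal (char_poly A).
rewrite (monicP (char_poly_monic A)) scale1r in ers.
have srs : size rs = n.+1.
  by have := size_char_poly A; rewrite ers size_prod_XsubC => -[].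
have := Cayley_Hamilton A; rewrite ers => xrs.
have {xrs} : x *m horner_mx A (\prod_(z <- rs) ('X - z%:P)) = 0 by rewrite xrs mulmx0.
have {}h i : (i < size rs)%N -> x *m A ^+ i *m B = 0 by rewrite srs; apply: h.
elim: rs x h {ers srs} => [|z rs IH] x h.
  by rewrite big_nil rmorph1 mulmx1.
rewrite big_cons rmorphM rmorphB /= horner_mx_X horner_mx_C mulmxA => xrs.
have /eqP : x *m (A - z%:M) = 0.
  apply: IH xrs => i lti; rewrite mulmxBr !mulmxBl mul_mx_scalar -!scalemxAl.
  rewrite h ?(ltn_trans lti) // scaler0 subr0 -(mulmxA x).
  have -> : A *m A ^+ i = A ^+ i.+1 by rewrite exprS.
  by rewrite h.
rewrite mulmxBr mul_mx_scalar subr_eq0 => /eqP /cAB; apply.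
by have := h 0%N isT; rewrite expr0 mulmx1.
Qed.

Lemma kalman_controllable n m q (A : 'M[K]_n) (B : 'M[K]_(n, m)) (X : 'M[K]_(q, n)) :
  controllable A B -> (forall i, (i < n)%N -> X *m A ^+ i *m B = 0) -> X = 0.
Proof.
move=> cAB h; apply/row_matrixP => j; rewrite row0.
by apply: kalman_controllable_row cAB _ => i lti; rewrite -!row_mul h // row0.
Qed.

Lemma trmxX n (A : 'M[K]_n) i : (A ^+ i)^T = A^T ^+ i.
Proof. by elim: i => [|i IH]; rewrite ?trmx1 // exprS exprSr trmx_mul IH. Qed.

Lemma kalman_observable n p q (A : 'M[K]_n) (C : 'M[K]_(p, n)) (X : 'M[K]_(n, q)) :
  observable A C -> (forall i, (i < n)%N -> C *m A ^+ i *m X = 0) -> X = 0.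
Proof.
move=> /observable_tr oAC h; apply: trmx_inj; rewrite trmx0.
apply: kalman_controllable oAC _ => i /h /(congr1 trmx).
by rewrite !trmx_mul trmx0 trmxX mulmxA.
Qed.

(** Schur complement of [A]; the complement of [D] in the next lemma evaluates the same determinant.
    Equating the two yields the zeros of a transfer function. *)
Lemma det_bordered n p (A : 'M[K]_n) (B : 'M[K]_(n, p)) C (D : 'M[K]_p) :
  A \in unitmx ->
  \det (block_mx A B (- C) D) = \det A * \det (C *m invmx A *m B + D).
Proof.
move=> uA; set T := _ + D.
have -> : block_mx A B (- C) D =
    block_mx A 0 (- C) T *m block_mx 1%:M (invmx A *m B) 0 1%:M.
  have e : - C *m (invmx A *m B) + T = D by rewrite /T mulNmx mulmxA addKr.
  by rewrite mulmx_block !mulmx1 !mul0mx !mulmx0 !addr0 e mulKVmx.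
by rewrite det_mulmx det_lblock det_ublock !det1 !mulr1.
Qed.

Lemma det_bordered_feedthrough n p (A : 'M[K]_n) (B : 'M[K]_(n, p)) C (D : 'M[K]_p) :
  D \in unitmx ->
  \det (block_mx A B (- C) D) = \det (A + B *m invmx D *m C) * \det D.
Proof.
move=> uD.
have -> : block_mx A B (- C) D =
    block_mx (A + B *m invmx D *m C) B 0 D *m block_mx 1%:M 0 (- (invmx D *m C)) 1%:M.
  rewrite mulmx_block !mulmx1 !mul0mx !mulmx0 !add0r !mulmxN !mulmxA mulmxV //.
  by rewrite mul1mx addrK.
by rewrite det_mulmx det_lblock det_ublock !det1 !mulr1.
Qed.

(** The matrix on the right is the state matrix of the inverse system, so its eigenvalues play the
    role of zeros. *)
Lemma det_tf p (R : realization K p p) s :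
  rD R \in unitmx -> regular R s ->
  \det (tf R s) * (char_poly (rA R)).[s] =
  \det (rD R) * (char_poly (rA R - rB R *m invmx (rD R) *m rC R)).[s].
Proof.
rewrite /regular => uD; rewrite regular_unit => us; rewrite !horner_char_poly.
rewrite mulrC -det_bordered // det_bordered_feedthrough // mulrC opprB.
by congr (_ * \det _); rewrite addrA (addrAC _ (- _)).
Qed.

(** Clearing the denominator: [M] is the polynomial matrix equal to [char_poly (rA R)] times the
    transfer function, and the identity principle applies to its entries. *)
Lemma tf_eq0_generic p m (R : realization K p m) w : w != 0 ->
  (forall s, 'Re s = 0 -> w.[s] != 0 -> regular R s -> tf R s = 0) ->
  forall s, regular R s -> tf R s = 0.
Proof.
move=> w0 h.
pose M := map_mx polyC (rC R) *m \adj (char_poly_mx (rA R)) *m map_mx polyC (rB R)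
  + char_poly (rA R) *: map_mx polyC (rD R).
have eM s : regular R s -> map_mx (horner_eval s) M = (char_poly (rA R)).[s] *: tf R s.
  rewrite /regular => us; rewrite /M map_mxD !map_mxM !map_mx_horner map_mxZ.
  rewrite map_mx_horner map_mx_adj.
  rewrite -[GRing.RMorphism.sort _ (char_poly _)]/((char_poly (rA R)).[s]).
  rewrite map_char_poly_mx_horner.
  have uA : s%:M - rA R \in unitmx by rewrite -regular_unit.
  rewrite /tf scalerDr; congr (_ + _); rewrite /invmx uA -!scalemxAr -!scalemxAl.
  rewrite scalerA horner_char_poly divff ?scale1r //.
  by rewrite -unitfE -unitmxE.
have c0 : char_poly (rA R) != 0 by rewrite monic_neq0 ?char_poly_monic.
have M0 : M = 0.
  apply/matrixP => i j; rewrite [RHS]mxE.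
  apply: (@poly_eq0_imag _ _ (w * char_poly (rA R))) => [|s s0].
    by rewrite mulf_neq0.
  rewrite hornerM mulf_eq0 => /norP[ws cs].
  by have /matrixP/(_ i j) := eM s cs; rewrite h // scaler0 !mxE.
move=> s rs; apply/eqP; have /esym/eqP := eM s rs.
by rewrite M0 map_mx0 scaler_eq0 [_ == 0](negbTE rs).
Qed.

(* A nonzero entry of [D] would make the corresponding scalar transfer function a quotient of
   two monic polynomials up to a nonzero factor. *)
Lemma tf_eq0_feedthrough p m (R : realization K p m) :
  (forall s, regular R s -> tf R s = 0) -> rD R = 0.
Proof.
move=> h; apply/matrixP => i j; rewrite [RHS]mxE; apply/eqP/negPn/negP => d0.
pose R1 := @Realization K 1 1 _ (rA R) (col j (rB R)) (row i (rC R)) (rD R i j)%:M.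
have u1 : rD R1 \in unitmx by rewrite unitmxE det_scalar1 unitfE.
set q := char_poly (rA R1 - rB R1 *m invmx (rD R1) *m rC R1).
have : q != 0 by rewrite monic_neq0 ?char_poly_monic.
move/eqP; apply; apply: (@poly_eq0_generic _ _ (char_poly (rA R))).
  by rewrite monic_neq0 ?char_poly_monic.
move=> s rs; have /esym := det_tf u1 (rs : regular R1 s).
have -> : tf R1 s = 0.
  have e : tf R s i j = 0 by rewrite h // mxE.
  apply/matrixP => a b; rewrite !ord1 [RHS]mxE -e /tf /=.
  rewrite colE -row_mul mulmxA -row_mul -colE.
  by rewrite !mxE mulr1n.
rewrite det0 mul0r => /eqP; rewrite mulf_eq0 => /orP[|/eqP //].
by rewrite /= det_scalar1 (negbTE d0).
Qed.

Lemma resolvent_shift n (A : 'M[K]_n) s : s%:M - A \in unitmx ->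
  A *m invmx (s%:M - A) = s *: invmx (s%:M - A) - 1%:M.
Proof.
by move=> us; have := mulmxV us; rewrite mulmxBl mul_scalar_mx => <-; rewrite subKr.
Qed.

(** In place of an expansion at infinity: by [resolvent_shift], [C A (s - A)^-1 B + C B] equals
    [s C (s - A)^-1 B], which is zero. Its feedthrough [C B] then vanishes, and the argument is
    repeated with [C A] for [C]. *)
Lemma tf_eq0_markov p m (R : realization K p m) :
  (forall s, regular R s -> tf R s = 0) ->
  forall i, rC R *m rA R ^+ i *m rB R = 0.
Proof.
move=> h i; suff [//] : rC R *m rA R ^+ i *m rB R = 0 /\
  forall s, regular R s -> rC R *m rA R ^+ i *m invmx (s%:M - rA R) *m rB R = 0.
have step C : (forall s, regular R s -> C *m invmx (s%:M - rA R) *m rB R = 0) ->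
  C *m rB R = 0 /\
  forall s, regular R s -> C *m rA R *m invmx (s%:M - rA R) *m rB R = 0.
  move=> hC.
  have e s : regular R s -> C *m rA R *m invmx (s%:M - rA R) *m rB R + C *m rB R = 0.
    move=> rs; rewrite -(mulmxA C) resolvent_shift -?regular_unit // mulmxBr mulmxBl.
    by rewrite mulmx1 subrK -scalemxAr -scalemxAl hC // scaler0.
  have C0 : C *m rB R = 0.
    exact: (@tf_eq0_feedthrough _ _ (Realization (rA R) (rB R) (C *m rA R) (C *m rB R))).
  by split=> // s rs; have := e s rs; rewrite C0 addr0.
have D0 := tf_eq0_feedthrough h.
elim: i => [|i [_ IH]].
  have h0 s : regular R s -> rC R *m invmx (s%:M - rA R) *m rB R = 0.
    by move=> rs; have := h s rs; rewrite /tf D0 addr0.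
  by rewrite expr0 mulmx1; split=> //; case: (step _ _ h0).
rewrite exprSr [_ *m (_ * _)]mulmxA.
by have [_ h1] := step _ _ IH; split=> //; case: (step _ _ h1).
Qed.

End Systems.

(** * Operations on realizations, reduction and minimality *)

Section Realizations.
Variable K : numClosedFieldType.

Lemma invmx_lblock n1 n2 (X : 'M[K]_n1) (Z : 'M[K]_(n2, n1)) (Y : 'M[K]_n2) :
  X \in unitmx -> Y \in unitmx ->
  invmx (block_mx X 0 Z Y) =
  block_mx (invmx X) 0 (- (invmx Y *m Z *m invmx X)) (invmx Y).
Proof.
move=> uX uY; rewrite -[LHS]mulmx1; apply: invmx_solve.
  by rewrite unitmxE det_lblock unitrM -!unitmxE uX.
rewrite mulmx_block !mulmx0 !mul0mx !addr0 add0r mulmxN !mulmxA !mulmxV //.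
by rewrite mul1mx subrr -scalar_mx_block.
Qed.

Lemma invmxN n (M : 'M[K]_n) : invmx (- M) = - invmx M.
Proof.
have [uM|nM] := boolP (M \in unitmx).
  by rewrite -scaleN1r invmxZ ?unitmxZ ?unitrN1 // invrN1 scaleN1r.
by rewrite /invmx (negbTE nM) -scaleN1r unitmxZ ?unitrN1 // (negbTE nM).
Qed.

Lemma regular_generic p m (R : realization K p m) : char_poly (rA R) != 0.
Proof. by rewrite monic_neq0 ?char_poly_monic. Qed.

Definition diff_real p m (R1 R2 : realization K p m) :=
  Realization (block_mx (rA R1) 0 0 (rA R2)) (col_mx (rB R1) (rB R2))
    (row_mx (rC R1) (- rC R2)) (rD R1 - rD R2).

Lemma regular_diff p m (R1 R2 : realization K p m) s :
  regular (diff_real R1 R2) s = regular R1 s && regular R2 s.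
Proof. by rewrite /regular /= char_poly_lblock rootM negb_or. Qed.

Lemma tf_diff p m (R1 R2 : realization K p m) s :
  regular R1 s -> regular R2 s -> tf (diff_real R1 R2) s = tf R1 s - tf R2 s.
Proof.
rewrite /regular !regular_unit => u1 u2; rewrite /tf /=.
rewrite scalar_mx_block opp_block_mx add_block_mx !oppr0 !addr0.
rewrite invmx_lblock // mulmx0 mul0mx oppr0 mul_row_block !mulmx0 addr0 add0r.
by rewrite mul_row_col !mulNmx opprD addrACA.
Qed.

Lemma same_fun_imag p m (R1 R2 : realization K p m) w : w != 0 ->
  (forall s, 'Re s = 0 -> w.[s] != 0 -> regular R1 s -> regular R2 s ->
     tf R1 s = tf R2 s) -> same_fun R1 R2.
Proof.
move=> w0 h s r1 r2; apply/eqP; rewrite -subr_eq0 -tf_diff //.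
rewrite (tf_eq0_generic w0) ?regular_diff ?r1 // => t t0 wt.
by rewrite regular_diff => /andP[t1 t2]; rewrite tf_diff // h // subrr.
Qed.

Lemma same_fun_generic p m (R1 R2 : realization K p m) w : w != 0 ->
  (forall s, w.[s] != 0 -> regular R1 s -> regular R2 s -> tf R1 s = tf R2 s) ->
  same_fun R1 R2.
Proof. by move=> w0 h; apply: (same_fun_imag w0) => s _; apply: h. Qed.

Lemma same_fun_sym p m (R1 R2 : realization K p m) : same_fun R1 R2 -> same_fun R2 R1.
Proof. by move=> h s r1 r2; rewrite h. Qed.

(** At a pole of the middle realization the two hypotheses say nothing; agreement at all other
    points suffices by the identity principle. *)
Lemma same_fun_trans p m (R2 R1 R3 : realization K p m) :
  same_fun R1 R2 -> same_fun R2 R3 -> same_fun R1 R3.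
Proof.
move=> h12 h23; apply: (same_fun_generic (regular_generic R2)) => s r2 r1 r3.
by rewrite h12 // h23.
Qed.

Lemma block_diag_expr n1 n2 (X : 'M[K]_n1) (Y : 'M[K]_n2) i :
  block_mx X 0 0 Y ^+ i = block_mx (X ^+ i) 0 0 (Y ^+ i).
Proof.
elim: i => [|i IH]; first by rewrite !expr0 -scalar_mx_block.
rewrite !exprS IH; apply: etrans (mulmx_block _ _ _ _ _ _ _ _) _.
by rewrite !mulmx0 !mul0mx !addr0 add0r.
Qed.

Lemma same_fun_markov p m (R1 R2 : realization K p m) : same_fun R1 R2 ->
  rD R1 = rD R2 /\
  forall i, rC R1 *m rA R1 ^+ i *m rB R1 = rC R2 *m rA R2 ^+ i *m rB R2.
Proof.
move=> h.
have z s : regular (diff_real R1 R2) s -> tf (diff_real R1 R2) s = 0.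
  by rewrite regular_diff => /andP[r1 r2]; rewrite tf_diff // h // subrr.
split=> [|i]; first by apply/eqP; rewrite -subr_eq0; apply/eqP/(tf_eq0_feedthrough z).
have /eqP := tf_eq0_markov z i; rewrite /= block_diag_expr mul_row_block !mulmx0.
by rewrite addr0 add0r mul_row_col !mulNmx subr_eq0 => /eqP.
Qed.

Definition tr_real p m (R : realization K p m) : realization K m p :=
  Realization (rA R)^T (rC R)^T (rB R)^T (rD R)^T.

Lemma regular_tr p m (R : realization K p m) s : regular (tr_real R) s = regular R s.
Proof. by rewrite /regular char_poly_tr. Qed.

Lemma tf_tr p m (R : realization K p m) s : tf (tr_real R) s = (tf R s)^T.
Proof.
rewrite /tf linearD /= !trmx_mul trmx_inv linearB /= tr_scalar_mx mulmxA.
by [].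
Qed.

Definition series_real p m q (R1 : realization K p m) (R2 : realization K m q) :=
  Realization (block_mx (rA R2) 0 (rB R1 *m rC R2) (rA R1))
    (col_mx (rB R2) (rB R1 *m rD R2)) (row_mx (rD R1 *m rC R2) (rC R1))
    (rD R1 *m rD R2).

Lemma regular_series p m q (R1 : realization K p m) (R2 : realization K m q) s :
  regular (series_real R1 R2) s = regular R1 s && regular R2 s.
Proof. by rewrite /regular /= char_poly_lblock rootM negb_or andbC. Qed.

Lemma tf_series p m q (R1 : realization K p m) (R2 : realization K m q) s :
  regular R1 s -> regular R2 s -> tf (series_real R1 R2) s = tf R1 s *m tf R2 s.
Proof.
rewrite /regular !regular_unit => u1 u2; rewrite /tf /=.
rewrite scalar_mx_block opp_block_mx add_block_mx !oppr0 !add0r.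
rewrite invmx_lblock // mulmxN mulNmx opprK mul_row_block mulmx0 add0r.
rewrite mul_row_col mulmxDl mulmxDr !mulmxDl !mulmxA.
by rewrite [X in X + _ + _ = _]addrC -!addrA.
Qed.

(** Realizes [S~], which agrees with the adjoint of [S] on the imaginary axis. *)
Definition paraconj p m (R : realization K p m) : realization K m p :=
  Realization (- ctmx (rA R)) (ctmx (rC R)) (- ctmx (rB R)) (ctmx (rD R)).

Lemma paraconj_pencil n (A : 'M[K]_n) s :
  s%:M - - ctmx A = - ctmx ((- s^*)%:M - A).
Proof. by rewrite ctmxB ctmx_scalar rmorphN /= conjCK opprB opprK raddfN /= opprK addrC. Qed.

Lemma regular_paraconj p m (R : realization K p m) s :
  regular (paraconj R) s = regular R (- s^*).
Proof.
rewrite /regular !regular_unit paraconj_pencil -scaleN1r unitmxZ ?unitrN1 //.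
by rewrite ctmx_unit.
Qed.

Lemma tf_paraconj p m (R : realization K p m) s :
  tf (paraconj R) s = ctmx (tf R (- s^*)).
Proof.
rewrite /tf /= paraconj_pencil invmxN mulNmx mulmxN opprK.
by rewrite [in RHS]ctmxD !ctmxM ctmx_inv mulmxA.
Qed.

Definition ptilde (q : {poly K}) : {poly K} := map_poly Num.conj q \Po - 'X.

Lemma horner_ptilde q s : (ptilde q).[s] = (q.[- s^*])^*.
Proof.
rewrite /ptilde horner_comp !hornerE -{1}[- s]conjCK horner_map /=.
by rewrite rmorphN.
Qed.

Lemma ptildeM q1 q2 : ptilde (q1 * q2) = ptilde q1 * ptilde q2.
Proof. by rewrite /ptilde rmorphM /= rmorphM. Qed.

Lemma char_poly_paraconj n (A : 'M[K]_n) :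
  char_poly (- ctmx A) = (- 1) ^+ n *: ptilde (char_poly A).
Proof.
apply: poly_ext => s; rewrite hornerZ horner_ptilde !horner_char_poly.
by rewrite paraconj_pencil -scaleN1r detZ det_ctmx.
Qed.

Definition const_real p m (D : 'M[K]_(p, m)) : realization K p m :=
  @Realization K p m 0 0 0 0 D.

Lemma tf_const p m (D : 'M[K]_(p, m)) s : tf (const_real D) s = D.
Proof. by rewrite /tf /= mulmx0 add0r. Qed.

Lemma regular_const p m (D : 'M[K]_(p, m)) s : regular (const_real D) s.
Proof. by rewrite /regular regular_unit unitmxE det_mx00 unitr1. Qed.

(** Deflation: up to the scalar [c], the eigenvector is the first row of the new basis [Q]. It
    serves both to remove uncontrollable modes and to run the induction in [lyapunov_psd]. *)
Lemma left_eigen_block n (A : 'M[K]_(1 + n)) (x : 'rV[K]_(1 + n)) l : x != 0 ->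
  x *m A = l *: x ->
  exists (Q A' : 'M[K]_(1 + n)) c, [/\ Q \in unitmx, Q *m A = A' *m Q,
    A' = block_mx l%:M 0 (dlsubmx A') (drsubmx A'), c != 0
    & x = c *: (row_mx 1%:M 0 *m Q)].
Proof.
move=> x0 xA.
have rx : \rank x = 1%N by rewrite rank_rV x0.
pose Q : 'M[K]_(1 + n) := row_ebase x.
have uQ : Q \in unitmx by apply: row_ebase_unit.
have [c ec] : exists c, col_ebase x = c%:M :> 'M_1.
  by exists (col_ebase x 0 0); rewrite -mx11_scalar.
have c0 : c != 0.
  by have := col_ebase_unit x; rewrite ec unitmxE det_scalar1 unitfE.
have ex : x = c *: (row_mx 1%:M 0 *m Q).
  rewrite -[LHS]mulmx_ebase rx (@pid_mx_row _ n 1) ec -scalemx1 -!scalemxAl.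
  by rewrite mul1mx.
have [A' eA] : exists A', Q *m A = A' *m Q.
  by exists (Q *m A *m invmx Q); rewrite mulmxKV.
exists Q, A', c; split=> //.
have e1 : row_mx 1%:M 0 *m A' = l *: row_mx 1%:M 0.
  apply: (can_inj (mulmxK uQ)); apply: (scalerI c0).
  by rewrite -mulmxA -eA mulmxA scalemxAl -ex xA ex -scalemxAl !scalerA mulrC.
rewrite -[A']submxK mul_row_block !mul1mx !mul0mx !addr0 scale_row_mx scaler0 in e1.
have [e1l e1r] := eq_row_mx e1.
by rewrite -{1}[A']submxK e1l e1r scalemx1.
Qed.

Lemma controllable_invmx_step n m (A : 'M[K]_n.+1) (B : 'M[K]_(n.+1, m)) p
    (C : 'M[K]_(p, n.+1)) (x : 'rV[K]_n.+1) l : x != 0 ->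
  x *m A = l *: x -> x *m B = 0 ->
  exists A' : 'M[K]_n, exists B' C', char_poly A = ('X - l%:P) * char_poly A' /\
    forall s, s%:M - A \in unitmx ->
      C *m invmx (s%:M - A) *m B = C' *m invmx (s%:M - A') *m B'.
Proof.
move=> x0 xA xB.
have [Q [A' [c [uQ eA eA' c0 ex]]]] := @left_eigen_block n A x l x0 xA.
have uB : usubmx (Q *m B) = 0.
  apply: (scalerI c0); rewrite scaler0 -[RHS]xB ex -scalemxAl; congr (_ *: _).
  by rewrite -mulmxA -[Q *m B]vsubmxK mul_row_col mul1mx mul0mx addr0 col_mxKu.
exists (drsubmx A'), (dsubmx (Q *m B)), (rsubmx (C *m invmx Q)); split.
  rewrite (char_poly_sim uQ eA) eA' char_poly_lblock block_mxKdr; congr (_ * _).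
  by rewrite /char_poly det_mx11 !mxE /= !mulr1n.
move=> s us.
have us' : s%:M - A' \in unitmx.
  by rewrite -regular_unit -(char_poly_sim uQ eA) regular_unit.
have us2 : s%:M - drsubmx A' \in unitmx.
  move: us'; rewrite {1}eA' scalar_mx_block opp_block_mx add_block_mx.
  by rewrite oppr0 addr0 unitmxE det_lblock unitrM -!unitmxE => /andP[].
rewrite -[LHS]mulmxA; have -> : invmx (s%:M - A) *m B =
    invmx Q *m col_mx 0 (invmx (s%:M - drsubmx A') *m dsubmx (Q *m B)).
  apply: invmx_solve => //; apply: (can_inj (mulKmx uQ)).
  rewrite !mulmxA mulmxBr mul_mx_scalar -mul_scalar_mx eA -mulmxBl mulmxK //.
  rewrite {1}eA' scalar_mx_block opp_block_mx add_block_mx.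
  rewrite oppr0 addr0 mul_block_col !mulmx0 mul0mx !add0r mulKVmx //.
  by rewrite -uB vsubmxK.
by rewrite mulmxA -{1}[C *m invmx Q]hsubmxK mul_row_col mulmx0 add0r mulmxA.
Qed.

Lemma reduce_uncontrollable p m (R : realization K p m) (x : 'rV_(rdim R)) l : x != 0 ->
  x *m rA R = l *: x -> x *m rB R = 0 ->
  exists R' : realization K p m, [/\ rdim R = (rdim R').+1, same_fun R R'
    & char_poly (rA R) = ('X - l%:P) * char_poly (rA R')].
Proof.
case: R x => [[|n] A B C D] /= x x0; first by rewrite thinmx0 eqxx in x0.
move=> xA xB; have [A' [B' [C' [eA h]]]] := controllable_invmx_step C x0 xA xB.
exists (Realization A' B' C' D); split=> // s.
by rewrite /regular regular_unit /tf /= => us _; rewrite -mulmxA mulmxA h.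
Qed.

Lemma reduce_unobservable p m (R : realization K p m) (v : 'cV_(rdim R)) l : v != 0 ->
  rA R *m v = l *: v -> rC R *m v = 0 ->
  exists R' : realization K p m, [/\ rdim R = (rdim R').+1, same_fun R R'
    & char_poly (rA R) = ('X - l%:P) * char_poly (rA R')].
Proof.
move=> v0 vA vC.
have [||| R' [eR h eA]] := @reduce_uncontrollable _ _ (tr_real R) v^T l.
- by rewrite -trmx0 (inj_eq trmx_inj).
- by rewrite -trmx_mul vA linearZ.
- by rewrite -trmx_mul vC trmx0.
exists (tr_real R'); split=> //; last by rewrite /= char_poly_tr -eA char_poly_tr.
move=> s; rewrite regular_tr => r1 r2; rewrite tf_tr -h ?tf_tr ?trmxK //.
by rewrite regular_tr.
Qed.

Definition pbh_minimal p m (R : realization K p m) :=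
  controllable (rA R) (rB R) /\ observable (rA R) (rC R).

Lemma minimal_pbh p m (R : realization K p m) : minimal_real R -> pbh_minimal R.
Proof.
case=> _ h; split=> x l xA xB; apply/eqP/negPn/negP => x0.
  have [R' [eR /h hR _]] := reduce_uncontrollable x0 xA xB.
  by rewrite eR ltnn in hR.
have [R' [eR /h hR _]] := reduce_unobservable x0 xA xB.
by rewrite eR ltnn in hR.
Qed.

(** [T] sends each reachable vector [A2^i B2 u] to [A1^i B1 u]. It exists because equal Markov
    parameters give equal Hankel matrices and the first system is observable; controllability of the
    first system makes it of full row rank, controllability of the second makes it commute with the
    state matrices. *)
Lemma intertwine p m (R1 R2 : realization K p m) :
  pbh_minimal R1 -> controllable (rA R2) (rB R2) -> same_fun R1 R2 ->
  exists2 T : 'M[K]_(rdim R1, rdim R2), row_free T & T *m rA R2 = rA R1 *m T.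
Proof.
move=> [c1 o1] c2 /same_fun_markov[_ hM].
(* Large enough for the Kalman test on either system, with the power [i.+1] used for the commutation
   still in range. *)
pose k := (rdim R1 + rdim R2).+1.
pose X1 := \mxrow_(i < k) (rA R1 ^+ i *m rB R1).
pose X2 := \mxrow_(i < k) (rA R2 ^+ i *m rB R2).
have /submxP[T eT] : (X1 <= X2)%MS.
  rewrite submxE; apply/eqP; apply: kalman_observable o1 _ => j _.
  rewrite mulmxA.
  have -> : rC R1 *m rA R1 ^+ j *m X1 = rC R2 *m rA R2 ^+ j *m X2.
    rewrite !mul_mxrow; apply: eq_mxrow => i.
    rewrite !mulmxA -(mulmxA (rC R1)) -(mulmxA (rC R2)).
    by rewrite -[rA R1 ^+ j *m _]exprD -[rA R2 ^+ j *m _]exprD hM.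
  by rewrite -mulmxA mulmx_coker mulmx0.
have hT i : (i < k)%N -> T *m (rA R2 ^+ i *m rB R2) = rA R1 ^+ i *m rB R1.
  move=> lti; move: eT; rewrite /X1 /X2 mul_mxrow => /eq_mxrowP/(_ (Ordinal lti)).
  by move=> /= ->.
exists T.
  apply: inj_row_free => y yT; apply: kalman_controllable_row c1 _ => i lti.
  rewrite -mulmxA -hT ?mulmxA ?yT ?mul0mx //.
  by rewrite ltnS (leq_trans (ltnW lti)) ?leq_addr.
apply/eqP; rewrite -subr_eq0; apply/eqP; apply: kalman_controllable c2 _ => i lti.
rewrite !mulmxBl -!mulmxA hT; last first.
  by rewrite ltnS (leq_trans (ltnW lti)) ?leq_addl.
have -> : rA R2 *m (rA R2 ^+ i *m rB R2) = rA R2 ^+ i.+1 *m rB R2.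
  by rewrite mulmxA exprS.
rewrite hT; last by rewrite ltnS (leq_trans lti) ?leq_addl.
by rewrite exprS mulmxA subrr.
Qed.

(** [intertwine] asks the second system to be controllable; this is reached by induction on its
    dimension, since each uncontrollable mode removed only splits a linear factor off its
    characteristic polynomial. *)
Lemma minimal_char_poly_dvd p m (R1 R2 : realization K p m) :
  pbh_minimal R1 -> same_fun R1 R2 -> char_poly (rA R1) %| char_poly (rA R2).
Proof.
move=> h1; move: {2}(rdim R2) (leqnn (rdim R2)) => d.
elim: d R2 => [|d IH] R2 led h; apply/negPn/negP => ndvd; apply: (negP ndvd).
  have [|T fT eT] := intertwine h1 _ h; last exact: char_poly_invariant fT eT.
  move=> x l _ _; move: led; rewrite leqn0 => /eqP e; move: x; rewrite e => x.
  exact: thinmx0.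
have [|T fT eT] := intertwine h1 _ h; last exact: char_poly_invariant fT eT.
move=> x l xA xB; apply/eqP/negPn/negP => x0; apply: (negP ndvd).
have [R' [eR hR ->]] := reduce_uncontrollable x0 xA xB.
apply: dvdp_mull; apply: IH (same_fun_trans h hR).
by rewrite -ltnS -eR.
Qed.

Lemma minimal_char_poly_eq p m (R1 R2 : realization K p m) :
  pbh_minimal R1 -> pbh_minimal R2 -> same_fun R1 R2 ->
  char_poly (rA R1) = char_poly (rA R2).
Proof.
move=> h1 h2 h; apply/eqP; rewrite -eqp_monic ?char_poly_monic // /eqp.
by rewrite !minimal_char_poly_dvd //; apply: same_fun_sym.
Qed.

End Realizations.

(** * Degree of symmetric inner extensions *)

Section InnerFunctions.
Variable K : numClosedFieldType.

Definition inv_real p (R : realization K p p) : realization K p p :=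
  Realization (rA R - rB R *m invmx (rD R) *m rC R) (rB R *m invmx (rD R))
    (- (invmx (rD R) *m rC R)) (invmx (rD R)).

Lemma tf_inv p (R : realization K p p) s : rD R \in unitmx ->
  regular R s -> regular (inv_real R) s -> tf R s *m tf (inv_real R) s = 1%:M.
Proof.
rewrite /regular !regular_unit /tf /= => uD.
set A := rA R; set B := rB R; set C := rC R; set D := rD R in uD *.
set X := s%:M - A; set X' := s%:M - (A - _) => uX uX'.
have eX : X' - X = B *m invmx D *m C by rewrite /X' /X !opprB !addrA subrK addrAC subrr add0r.
have e : invmx X *m (B *m invmx D *m C) *m invmx X' = invmx X - invmx X'.
  by rewrite -eX mulmxBr mulVmx // mulmxBl mul1mx mulmxK.
rewrite mulmxDl !mulmxDr mulmxV // !mulNmx !mulmxN !mulmxA mulmxV // mul1mx.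
have -> : C *m invmx X *m B *m invmx D *m C *m invmx X' *m B *m invmx D =
    C *m (invmx X - invmx X') *m B *m invmx D by rewrite -e !mulmxA.
rewrite mulmxBr !mulmxBl opprB subrK addrA; set t := C *m _ *m _ *m _.
by rewrite addrN add0r.
Qed.

Lemma inv_real_minimal p (R : realization K p p) : rD R \in unitmx ->
  pbh_minimal R -> pbh_minimal (inv_real R).
Proof.
move=> uD [cR oR]; split=> /= x l.
  move=> xA xBD; have xB : x *m rB R = 0.
    by rewrite -[LHS](mulmxK (_ : invmx (rD R) \in unitmx)) ?unitmx_inv // -(mulmxA x) xBD mul0mx.
  by apply: (cR x l) (xB); rewrite -xA mulmxBr !mulmxA xB !mul0mx subr0.
move=> xA /eqP; rewrite mulNmx oppr_eq0 => /eqP xDC.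
have xC : rC R *m x = 0.
  by rewrite -[LHS](mulKmx (_ : invmx (rD R) \in unitmx)) ?unitmx_inv // (mulmxA (invmx (rD R))) xDC mulmx0.
by apply: (oR x l) (xC); rewrite -xA mulmxBl -!mulmxA xC !mulmx0 subr0.
Qed.

Lemma paraconj_minimal p m (R : realization K p m) :
  pbh_minimal R -> pbh_minimal (paraconj R).
Proof.
move=> [cR oR]; split=> /= x l.
  move=> /(congr1 (@ctmx K _ _)); rewrite mulmxN ctmxN ctmxM ctmxK ctmxZ => xA.
  move=> /(congr1 (@ctmx K _ _)); rewrite ctmxM ctmxK ctmx0 => xC.
  rewrite -[x]ctmxK (oR _ (- l^*) _ xC) ?ctmx0 //.
  by rewrite scaleNr -xA opprK.
move=> /(congr1 (@ctmx K _ _)); rewrite mulNmx ctmxN ctmxM ctmxK ctmxZ => xA.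
move=> /(congr1 (@ctmx K _ _)); rewrite mulNmx ctmxN ctmxM ctmxK ctmx0.
move=> /eqP; rewrite oppr_eq0 => /eqP xB.
rewrite -[x]ctmxK (cR _ (- l^*) _ xB) ?ctmx0 //.
by rewrite scaleNr -xA opprK.
Qed.

Lemma regular_conj_generic p m (R : realization K p m) :
  char_poly (rA (paraconj R)) != 0.
Proof. exact: regular_generic. Qed.

(** On the imaginary axis [- s^* = s], so the product is the transfer function times its adjoint
    there; the identity principle carries the equation off the axis. *)
Lemma inner_paraconj p (R : realization K p p) w : w != 0 ->
  (forall s, w.[s] != 0 -> regular R s -> 'Re s = 0 ->
     tf R s *m ctmx (tf R s) = 1%:M) ->
  forall s, regular R s -> regular (paraconj R) s ->
    tf R s *m tf (paraconj R) s = 1%:M.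
Proof.
move=> w0 h s r1 r2; rewrite -tf_series //.
suff sf : same_fun (series_real R (paraconj R)) (const_real 1%:M).
  by rewrite sf ?tf_const ?regular_series ?r1 ?regular_const.
apply: (same_fun_imag w0) => t t0 wt; rewrite regular_series => /andP[t1 t2] _.
rewrite tf_series // tf_const tf_paraconj.
suff -> : - t^* = t by apply: h.
by move: t0; rewrite ReE => /eqP; rewrite mulf_eq0 invr_eq0 pnatr_eq0 orbF addr_eq0 => /eqP.
Qed.

(* [E^-1 = E~], and both have minimal realizations built from that of [E]. *)
Lemma inner_char_poly p (R : realization K p p) w : w != 0 -> pbh_minimal R ->
  (forall s, w.[s] != 0 -> regular R s -> 'Re s = 0 ->
     tf R s *m ctmx (tf R s) = 1%:M) ->
  rD R \in unitmx /\
  char_poly (rA R - rB R *m invmx (rD R) *m rC R) = char_poly (- ctmx (rA R)).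
Proof.
move=> w0 mR h; have hp := inner_paraconj w0 h.
have uD : rD R \in unitmx.
  have [] // := @same_fun_markov _ _ _ (series_real R (paraconj R)) (const_real 1%:M).
    move=> s; rewrite regular_series => /andP[r1 r2] _.
    by rewrite tf_series // hp // tf_const.
  by move=> /mulmx1_unit[].
split=> //; apply: (@minimal_char_poly_eq _ _ _ (inv_real R) (paraconj R)).
- exact: inv_real_minimal.
- exact: paraconj_minimal.
apply: (same_fun_generic (regular_generic R)) => s r r1 r2.
have /mulmx1_unit[u _] := hp s r r2.
by apply: (can_inj (mulKmx u)); rewrite tf_inv // hp.
Qed.

(* The sign [\det (block_mx 0 1 1 0)] is left unevaluated. *)
Lemma symmetric_inverse_det p (T U : 'M[K]_(p + p)) :
  T *m U = 1%:M -> T^T = T ->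
  \det (dlsubmx T) ^+ 2 =
  \det (block_mx 0 1%:M 1%:M 0 : 'M[K]_(p + p)) * \det T *
  \det (1%:M - drsubmx T *m drsubmx U).
Proof.
move=> TU sT; have [uT uU] := mulmx1_unit TU.
have sU : U^T = U.
  by apply: (can_inj (mulKmx uT)); rewrite -{1}sT -trmx_mul TU (mulmx1C TU) trmx1.
have TUb : block_mx (ulsubmx T) (ursubmx T) (dlsubmx T) (drsubmx T) *m
   block_mx (ulsubmx U) (ursubmx U) (dlsubmx U) (drsubmx U) = 1%:M.
  by rewrite !submxK.
rewrite mulmx_block scalar_mx_block in TUb.
have [e1 _ e3 e4] := eq_block_mx TUb.
set J := block_mx 0 _ _ _.
(* Jacobi's relation between complementary minors of a matrix and its inverse. By symmetry the other
   factor of [1 - T22 U22 = T21 U12] is the transpose of [U21], so the square appears. *)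
have d1 : \det T * (\det J * \det (dlsubmx U)) = \det (dlsubmx T).
  have -> : \det J * \det (dlsubmx U) = \det (block_mx (ulsubmx U) 1%:M (dlsubmx U) 0).
    have -> : \det (dlsubmx U) = \det (block_mx 1%:M (ulsubmx U) 0 (dlsubmx U)).
      by rewrite det_ublock det1 mul1r.
    rewrite mulrC -det_mulmx mulmx_block.
    by rewrite !(mulmx0, mulmx1, mul0mx, mul1mx, add0r, addr0).
  rewrite -det_mulmx -[T in T *m _]submxK mulmx_block !mulmx0 !mulmx1 !addr0 e1 e3.
  by rewrite det_ublock det1 mul1r.
have -> : 1%:M - drsubmx T *m drsubmx U = dlsubmx T *m ursubmx U.
  by rewrite -e4 addrK.
have -> : ursubmx U = (dlsubmx U)^T by rewrite trmx_dlsub sU.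
rewrite det_mulmx det_tr expr2 -{1}d1; ring.
Qed.

Definition dr_real p m q r (R : realization K (p + q) (m + r)) : realization K q r :=
  Realization (rA R) (rsubmx (rB R)) (dsubmx (rC R)) (drsubmx (rD R)).

Lemma tf_dr p m q r (R : realization K (p + q) (m + r)) s :
  tf (dr_real R) s = drsubmx (tf R s).
Proof.
by rewrite /tf /drsubmx !linearD /= -mul_dsub_mx -mulmx_rsub -!mul_dsub_mx.
Qed.

Definition dl_real p m q r (R : realization K (p + q) (m + r)) : realization K q m :=
  Realization (rA R) (lsubmx (rB R)) (dsubmx (rC R)) (dlsubmx (rD R)).

Lemma tf_dl p m q r (R : realization K (p + q) (m + r)) s :
  tf (dl_real R) s = dlsubmx (tf R s).
Proof.
by rewrite /tf /dlsubmx !linearD /= -mul_dsub_mx -mulmx_lsub -!mul_dsub_mx.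
Qed.

(** The numerator is the bordered determinant over polynomials. It is meant for the off-diagonal
    block of an extension, whose feedthrough is not known to be invertible at that point. *)
Lemma det_tf_numerator p (R : realization K p p) :
  exists F : {poly K}, forall s, regular R s ->
    \det (tf R s) * (char_poly (rA R)).[s] = F.[s].
Proof.
pose M := block_mx (char_poly_mx (rA R)) (map_mx polyC (rB R))
  (- map_mx polyC (rC R)) (map_mx polyC (rD R)).
exists (\det M) => s; rewrite /regular regular_unit => us.
rewrite -[RHS]/(horner_eval s _) -det_map_mx map_block_mx map_mxN !map_mx_horner.
by rewrite map_char_poly_mx_horner det_bordered // horner_char_poly mulrC.
Qed.

(** The exempted zeros of [w] let the property pass to another realization of the same function, at
    points where the original one may be singular. *)
Definition sym_inner_ext_on w p (E : realization K (p + p) (p + p))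
    (S : realization K p p) : Prop :=
  forall s, w.[s] != 0 -> regular E s ->
  [/\ regular S s -> drsubmx (tf E s) = tf S s, (tf E s)^T = tf E s
    & 'Re s = 0 -> tf E s *m ctmx (tf E s) = 1%:M].

Lemma mup_parity (F q chi : {poly K}) (c z : K) :
  c != 0 -> chi != 0 -> q != 0 -> F ^+ 2 = c *: (q * chi) ->
  odd (mup z chi) -> root q z.
Proof.
move=> c0 chi0 q0 eF ochi; apply/negPn/negP => nq.
have F0 : F != 0 by have := expf_eq0 F 2; rewrite /= => <-; rewrite eF scaler_eq0 negb_or c0 mulf_neq0.
have /(congr1 (fun r => odd (mup z r))) := eF.
rewrite expr2 mupM // -mul_polyC mupMr ?rootC // mupMr // ochi.
by rewrite oddD addbb.
Qed.

Lemma symmetric_inner_numerator p (S : realization K p p) (chi : {poly K}) c w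
    (E : realization K (p + p) (p + p)) :
  pbh_minimal S -> pbh_minimal E -> c != 0 ->
  (forall s, regular S s -> regular (paraconj S) s ->
    \det (1%:M - tf S s *m tf (paraconj S) s) *
      ((char_poly (rA S)).[s] * (char_poly (- ctmx (rA S))).[s]) = c * chi.[s]) ->
  w != 0 -> sym_inner_ext_on w E S ->
  exists F q c', [/\ c' != 0, char_poly (rA E) = q * char_poly (rA S)
    & F ^+ 2 = c' *: (q * ptilde q * chi)].
Proof.
move=> mS mE c0 hdet w0 hE.
have hin s : w.[s] != 0 -> regular E s -> 'Re s = 0 -> tf E s *m ctmx (tf E s) = 1%:M.
  by move=> ws rs; have [] := hE s ws rs.
have [uD eE] := inner_char_poly w0 mE hin.
have hp := inner_paraconj w0 hin.
have hdr : same_fun (dr_real E) S.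
  apply: (same_fun_generic w0) => s ws r1 r2; rewrite tf_dr.
  by have [->] := hE s ws r1.
have hsym : same_fun (tr_real E) E.
  apply: (same_fun_generic w0) => s ws r1 r2; rewrite tf_tr.
  by have [] := hE s ws r2.
have /dvdpP[q eq] := minimal_char_poly_dvd mS (same_fun_sym hdr).
have [F hF] := det_tf_numerator (dl_real E).
set J := \det (block_mx 0 1%:M 1%:M 0 : 'M[K]_(p + p)).
have J0 : J != 0.
  suff: J * J != 0 by rewrite mulf_eq0 orbb.
  rewrite -det_mulmx mulmx_block !mulmx0 !mul0mx !mulmx1 !add0r !addr0.
  by rewrite -scalar_mx_block det1 oner_neq0.
have dD0 : \det (rD E) != 0 by rewrite -unitfE -unitmxE.
pose c1 := J * \det (rD E) * c.
have key : F ^+ 2 * (char_poly (rA S) * char_poly (- ctmx (rA S))) =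
    c1 *: (char_poly (rA E) * char_poly (- ctmx (rA E)) * chi).
  apply/eqP; rewrite -subr_eq0; apply/eqP.
  apply: (@poly_eq0_generic _ _ (char_poly (rA E) * char_poly (rA (paraconj E))
     * (char_poly (rA S) * char_poly (rA (paraconj S))))).
    by rewrite !mulf_neq0 ?regular_generic ?regular_conj_generic.
  move=> s; rewrite !hornerM !mulf_eq0 !negb_or => /andP[/andP[rE rE'] /andP[rS rS']].
  have e1 := hF s rE; rewrite tf_dl /= in e1.
  have e2 := @symmetric_inverse_det _ (tf E s) (tf (paraconj E) s) (hp s rE rE').
  rewrite -tf_tr hsym ?regular_tr // in e2; have {}e2 := e2 erefl.
  have e3 : drsubmx (tf E s) = tf S s by rewrite -tf_dr hdr.
  have e4 : drsubmx (tf (paraconj E) s) = tf (paraconj S) s.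
    rewrite !tf_paraconj /ctmx -trmx_drsub -map_drsubmx -tf_dr hdr //.
      by have : regular E (- s^*) by rewrite -regular_paraconj.
    by rewrite -regular_paraconj.
  rewrite e3 e4 -/J in e2.
  have e5 := det_tf uD rE; rewrite eE in e5.
  have e6 := hdet s rS rS'.
  rewrite !(hornerE, hornerM, hornerZ) /= -e1 exprMn e2.
  apply/eqP; rewrite subr_eq0; apply/eqP.
  rewrite /c1 expr2; set a := (char_poly (rA E)).[s] in e5 *.
  transitivity (J * (\det (tf E s) * a) * a *
    (\det (1%:M - tf S s *m tf (paraconj S) s) *
      ((char_poly (rA S)).[s] * (char_poly (- ctmx (rA S))).[s]))); first ring.
  by rewrite e5 e6; ring.
have c10 : c1 != 0 by rewrite !mulf_neq0.
(* The powers of [-1] come from [char_poly_paraconj], applied to [E] and to [S]. *)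
clearbody c1; exists F, q, (c1 * ((- 1) ^+ rdim E * ((- 1) ^+ rdim S)^-1)); split=> //.
  by rewrite !mulf_neq0 ?invr_eq0 ?signr_eq0 //.
have S0 : char_poly (rA S) * char_poly (- ctmx (rA S)) != 0.
  by rewrite mulf_neq0 // monic_neq0 ?char_poly_monic.
apply: (mulIf S0); rewrite key eq.
rewrite [char_poly (- ctmx (rA E))]char_poly_paraconj eq ptildeM.
rewrite char_poly_paraconj -!mul_polyC !polyCM.
have sg : ((-1) ^+ rdim S)^-1%:P * ((-1) ^+ rdim S)%:P = 1 :> {poly K}.
  by rewrite -polyCM mulVf ?signr_eq0.
transitivity (((-1) ^+ rdim S)^-1%:P * ((-1) ^+ rdim S)%:P * (c1%:P * (q * char_poly (rA S) *
   (((-1) ^+ rdim E)%:P * (ptilde q * ptilde (char_poly (rA S)))) * chi))).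
  by rewrite sg mul1r.
ring.
Qed.

(** The numerator identity requires [E] to be minimal. A realization that fails the PBH test loses
    one state, at the price of adding the poles of the old one to [w]. *)
Lemma degree_lower_bound p (S : realization K p p) (chi : {poly K}) c w
    (E : realization K (p + p) (p + p)) (rs : seq K) :
  pbh_minimal S -> c != 0 -> chi != 0 ->
  (forall s, regular S s -> regular (paraconj S) s ->
    \det (1%:M - tf S s *m tf (paraconj S) s) *
      ((char_poly (rA S)).[s] * (char_poly (- ctmx (rA S))).[s]) = c * chi.[s]) ->
  w != 0 -> sym_inner_ext_on w E S ->
  uniq rs -> (forall z, z \in rs -> (0 < 'Re z) && odd (mup z chi)) ->
  (rdim S + size rs <= rdim E)%N.
Proof.
move=> mS c0 chi0 hdet w0 hE uz hz.
move: {2}(rdim E).+1 (ltnSn (rdim E)) => d.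
elim: d E w w0 hE => // d IH E w w0 hE led; apply/negPn/negP => nle.
have red E' : rdim E = (rdim E').+1 -> same_fun E E' -> False.
  move=> eR h; apply: (negP nle); apply: leq_trans (_ : (rdim E' <= _)%N); last by rewrite eR.
  apply: (IH E' (w * char_poly (rA E))); last by rewrite -ltnS -eR.
    by rewrite mulf_neq0 ?regular_generic.
  move=> s; rewrite hornerM mulf_eq0 negb_or => /andP[ws rE] rE'.
  by have := hE s ws rE; rewrite (h s rE rE').
have mE : pbh_minimal E.
  split=> x l xA xB; apply/eqP/negPn/negP => x0.
    by have [R' [eR h _]] := reduce_uncontrollable x0 xA xB; apply: (red R').
  by have [R' [eR h _]] := reduce_unobservable x0 xA xB; apply: (red R').
have [F [q [c' [c'0 eq eF]]]] := symmetric_inner_numerator mS mE c0 hdet w0 hE.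
have q0 : q != 0.
  by apply: contraNneq (regular_generic E) => q0; rewrite eq q0 mul0r.
have pq0 : ptilde q != 0.
  apply: contraNneq q0 => pq0; apply/eqP/poly_ext => s; rewrite horner0.
  apply: (inv_inj (@conjCK K)); rewrite rmorph0.
  by have := horner_ptilde q (- s^*); rewrite pq0 horner0 rmorphN /= conjCK opprK.
(* The chosen roots are distinct: [z] lies in the open right half plane, [- z^*] in the left one,
   and each of the two choices is injective. *)
pose r z := if root q z then z else - z^*.
have hr z : z \in rs -> root q (r z).
  move=> /hz /andP[_ oz]; rewrite /r; case: ifPn => // nq.
  have := mup_parity c'0 chi0 (mulf_neq0 q0 pq0) eF oz.
  rewrite rootM (negbTE nq) /= /root horner_ptilde.
  by rewrite -[X in _ == X](rmorph0 (@Num.conj K)) (inj_eq (inv_inj (@conjCK K))).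
have Re_r z : 'Re (r z) = if root q z then 'Re z else - 'Re z.
  by rewrite /r; case: ifP => // _; rewrite raddfN /= Re_conj.
have : (size (map r rs) < size q)%N.
  apply: max_poly_roots => //; first by apply/allP => _ /mapP[z zr ->]; apply: hr.
  rewrite map_inj_in_uniq // => x y /hz/andP[x0 _] /hz/andP[y0 _] e.
  have := Re_r x; rewrite e Re_r.
  move: e; rewrite /r; case: ifP => _; case: ifP => _ //.
  - move=> _ e; have : 0 < - 'Re y by rewrite e.
    by rewrite oppr_gt0 => /lt_trans/(_ y0); rewrite ltxx.
  - move=> _ e; have : 0 < - 'Re x by rewrite -e.
    by rewrite oppr_gt0 => /lt_trans/(_ x0); rewrite ltxx.
  - by move=> /oppr_inj/(inv_inj (@conjCK K)).
rewrite size_map => lt; apply: (negP nle).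
have := size_char_poly (rA E); rewrite eq size_mul ?regular_generic // size_char_poly.
rewrite addnS /= => e; rewrite -ltnS -e addnC ltn_add2r //.
Qed.

End InnerFunctions.

(** * The Hamiltonian matrix *)

Section InverseSquareRoots.
Variable K : numClosedFieldType.

Lemma posdef_psd n (M : 'M[K]_n) : posdef M -> psd M.
Proof.
move=> h v; have [->|/h/ltW //] := eqVneq v 0.
by rewrite mulmx0 mxE.
Qed.

Lemma quad_diag m n (M : 'M[K]_m) (Y : 'M[K]_(m, n)) j :
  (ctmx Y *m M *m Y) j j = (ctmx (col j Y) *m M *m col j Y) 0 0.
Proof.
rewrite !mxE; apply: eq_bigr => k _; rewrite !mxE; congr (_ * _).
by apply: eq_bigr => l _; rewrite !ctmxE !mxE.
Qed.

(* Multiplying by [ctmx Y] and taking the trace leaves a sum of two nonnegative terms. *)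
Lemma sylvester_posdef m n (R1 : 'M[K]_m) (R2 : 'M[K]_n) (Y : 'M[K]_(m, n)) :
  posdef R1 -> posdef R2 -> R1 *m Y + Y *m R2 = 0 -> Y = 0.
Proof.
move=> p1 p2 e.
have t1 : 0 <= \tr (ctmx Y *m R1 *m Y).
  by rewrite sumr_ge0 // => j _; rewrite quad_diag; apply: posdef_psd.
have t2 : 0 <= \tr (Y *m R2 *m ctmx Y).
  rewrite sumr_ge0 // => j _; rewrite -{1}[Y]ctmxK quad_diag.
  exact: posdef_psd.
have : \tr (ctmx Y *m R1 *m Y) + \tr (Y *m R2 *m ctmx Y) = 0.
  by rewrite [in X in _ + X]mxtrace_mulC -linearD /= -mulmxA -mulmxDr e mulmx0 linear0.
move=> /eqP; rewrite paddr_eq0 // => /andP[/eqP z _].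
apply/matrixP => i j; rewrite [RHS]mxE; have [z0|z0] := eqVneq (col j Y) 0.
  by move/matrixP/(_ i 0): z0; rewrite !mxE.
have := p1 _ z0; rewrite -quad_diag; move/eqP: z; rewrite psumr_eq0.
  by move=> /allP/(_ j (mem_index_enum _))/eqP ->; rewrite ltxx.
by move=> k _; rewrite quad_diag; apply: posdef_psd.
Qed.

Lemma inv_sqrt_unit n (R M : 'M[K]_n) : is_inv_sqrt R M ->
  [/\ R \in unitmx, M \in unitmx, invmx M = R *m R & R *m M *m R = 1%:M].
Proof.
move=> [_ [_ e]]; have [uRR uM] := mulmx1_unit e.
have [uR _] : R \in unitmx /\ R \in unitmx.
  by move: uRR; rewrite !unitmxE det_mulmx unitrM => /andP[].
split=> //; first by rewrite -[RHS](mulmxK uM) e mul1mx.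
by apply: mulmx1C; rewrite mulmxA.
Qed.

(** The defect [Y = R1 X - X R2] satisfies [R1 Y + Y R2 = R1^2 X - X R2^2 = 0], so
    [sylvester_posdef] kills it. The case [X = 1] is uniqueness of the inverse square root, the case
    [X = D] the exchange rule of [defect_swap]. *)
Lemma inv_sqrt_intertwine m n (R1 M1 : 'M[K]_m) (R2 M2 : 'M[K]_n) (X : 'M[K]_(m, n)) :
  is_inv_sqrt R1 M1 -> is_inv_sqrt R2 M2 -> M1 *m X = X *m M2 -> R1 *m X = X *m R2.
Proof.
move=> h1 h2 e; have [_ u1 i1 _] := inv_sqrt_unit h1; have [_ u2 i2 _] := inv_sqrt_unit h2.
have e' : R1 *m R1 *m X = X *m (R2 *m R2).
  rewrite -i1 -i2; apply: (can_inj (mulKmx u1)); apply: (can_inj (mulmxK u2)).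
  by rewrite mulKVmx // mulmxA mulmxKV.
apply/eqP; rewrite -subr_eq0; apply/eqP; apply: (@sylvester_posdef _ _ R1 R2).
- by case: h1 => _ [].
- by case: h2 => _ [].
rewrite mulmxBr mulmxBl !mulmxA e' !mulmxA subrKA //.
by rewrite subrr.
Qed.

Lemma inv_sqrt_unique n (R1 R2 M : 'M[K]_n) :
  is_inv_sqrt R1 M -> is_inv_sqrt R2 M -> R1 = R2.
Proof.
move=> h1 h2; have := @inv_sqrt_intertwine _ _ R1 M R2 M 1%:M h1 h2.
by rewrite !mulmx1 !mul1mx; apply.
Qed.

Lemma conj_mxK m n (M : 'M[K]_(m, n)) : map_mx Num.conj (map_mx Num.conj M) = M.
Proof. by apply/matrixP => i j; rewrite !mxE conjCK. Qed.

Lemma conj_mxN m n (M : 'M[K]_(m, n)) : map_mx Num.conj (- M) = - map_mx Num.conj M.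
Proof. exact: map_mxN. Qed.

Lemma conj_mxD m n (M N : 'M[K]_(m, n)) :
  map_mx Num.conj (M + N) = map_mx Num.conj M + map_mx Num.conj N.
Proof. exact: map_mxD. Qed.

Lemma conj_mxM m n q (M : 'M[K]_(m, n)) (N : 'M[K]_(n, q)) :
  map_mx Num.conj (M *m N) = map_mx Num.conj M *m map_mx Num.conj N.
Proof. exact: map_mxM. Qed.

Lemma conj_mx1 n : map_mx Num.conj (1%:M : 'M[K]_n) = 1%:M.
Proof. exact: map_mx1. Qed.

Lemma conj_mx_tr m n (M : 'M[K]_(m, n)) : (map_mx Num.conj M)^T = map_mx Num.conj M^T.
Proof. exact: map_trmx. Qed.

Lemma inv_sqrt_tr n (R M : 'M[K]_n) : is_inv_sqrt R M -> is_inv_sqrt R^T M^T.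
Proof.
move=> [hR [pR e]]; split; first by rewrite /Defs.hermitian ctmx_tr hR.
split; last first.
  by apply: trmx_inj; rewrite !trmx_mul !trmxK trmx1; apply: mulmx1C.
move=> v v0.
have v0' : map_mx Num.conj v != 0.
  by apply: contra_neq v0 => /(congr1 (map_mx Num.conj)); rewrite conj_mxK map_mx0.
have -> : ctmx v *m R^T *m v = (ctmx (map_mx Num.conj v) *m R *m map_mx Num.conj v)^T.
  by rewrite !trmx_mul mulmxA /ctmx trmxK conj_mxK.
by rewrite mxE; apply: pR.
Qed.

End InverseSquareRoots.

Section Hamiltonian.
Variable K : numClosedFieldType.

Definition hamiltonian n p (a : 'M[K]_n) (b : 'M[K]_(n, p)) (c : 'M[K]_(p, n)) :=
  block_mx (- ctmx a) (- (ctmx c *m c)) (b *m ctmx b) a.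

Lemma defect_swap p (D Rb Rc : 'M[K]_p) :
  is_inv_sqrt Rb (1%:M - ctmx D *m D) -> is_inv_sqrt Rc (1%:M - D *m ctmx D) ->
  Rc *m D = D *m Rb /\ Rb *m ctmx D = ctmx D *m Rc.
Proof.
move=> hb hc; split; [apply: inv_sqrt_intertwine hc hb _|apply: inv_sqrt_intertwine hb hc _].
  by rewrite mulmxBl mulmxBr mul1mx mulmx1 mulmxA.
by rewrite mulmxBl mulmxBr mul1mx mulmx1 mulmxA.
Qed.

Lemma inv_sqrt_square p (D Rb Rc : 'M[K]_p) :
  is_inv_sqrt Rb (1%:M - ctmx D *m D) -> is_inv_sqrt Rc (1%:M - D *m ctmx D) ->
  Rb *m Rb = 1%:M + ctmx D *m (Rc *m Rc) *m D.
Proof.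
move=> hb hc; have [_ _ _ e] := inv_sqrt_unit hb; have [ecD _] := defect_swap hb hc.
have [uRb _ _ _] := inv_sqrt_unit hb.
rewrite -!mulmxA ecD [Rc *m (D *m _)]mulmxA ecD !mulmxA.
have e' : (1%:M - ctmx D *m D) *m (Rb *m Rb) = 1%:M.
  by case: hb => _ [_ hb]; apply: mulmx1C.
by rewrite -{1}[1%:M]e' mulmxBl mul1mx !mulmxA subrK.
Qed.

(** [R] realizes [1 - S S~], and the state matrix of its inverse is the Hamiltonian up to the sign
    change [Q] of half of the coordinates; [det_tf] then gives the formula. *)
Lemma det_defect p (S : realization K p p) (Rb Rc : 'M[K]_p) s :
  let D := rD S in
  is_inv_sqrt Rb (1%:M - ctmx D *m D) -> is_inv_sqrt Rc (1%:M - D *m ctmx D) ->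
  regular S s -> regular (paraconj S) s ->
  \det (1%:M - tf S s *m tf (paraconj S) s) *
    ((char_poly (rA S)).[s] * (char_poly (- ctmx (rA S))).[s]) =
  \det (1%:M - D *m ctmx D) *
  (char_poly (hamiltonian
     (rA S + rB S *m ctmx D *m invmx (1%:M - D *m ctmx D) *m rC S)
     (rB S *m Rb) (Rc *m rC S))).[s].
Proof.
move=> D hb hc r1 r2; have [_ uM iM _] := inv_sqrt_unit hc.
pose Z := series_real S (paraconj S).
pose R := Realization (rA Z) (rB Z) (- rC Z) (1%:M - rD Z).
have rZ : regular R s by have := regular_series S (paraconj S) s; rewrite r1 r2.
have := @det_tf _ _ R s uM rZ.
have -> : tf R s = 1%:M - tf S s *m tf (paraconj S) s.
  by rewrite -tf_series // /tf /= !mulNmx opprD addrCA.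
have -> : (char_poly (rA R)).[s] = (char_poly (rA S)).[s] * (char_poly (- ctmx (rA S))).[s].
  by rewrite /= char_poly_lblock hornerM mulrC.
move=> ->; congr (_ * _.[s]).
pose Q : 'M[K]_(rdim S + rdim S) := block_mx 1%:M 0 0 (- 1%:M).
have uQ : Q \in unitmx by rewrite unitmxE det_ublock det1 mul1r -scaleN1r detZ det1 mulr1 unitrX ?unitrN1.
symmetry; apply: (char_poly_sim uQ).
have hRR : ctmx (Rc *m Rc) = Rc *m Rc by case: hc => hR _; rewrite ctmxM hR.
have hRb : ctmx Rb = Rb by case: hb.
have hRc : ctmx Rc = Rc by case: hc.
rewrite /= -/D iM /hamiltonian ctmxD !ctmxM hRb hRc ctmxK.
rewrite !mulmxN opprK [col_mx _ _ *m (Rc *m Rc)]mul_col_mx mul_col_row add_block_mx !mulmx_block.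
rewrite !(mulmx0, mul0mx, mulmx1, mul1mx, addr0, add0r, mulNmx, mulmxN, opprK).
have eB : Rb *m Rb = _ := inv_sqrt_square hb hc.
congr block_mx.
  by rewrite opprD !mulmxA.
  by rewrite !mulmxA.
by rewrite mulmxA -[_ *m Rb *m Rb]mulmxA eB mulmxDr mulmx1 mulmxDl opprD !mulmxA.
Qed.

End Hamiltonian.

(** * Lagrangian subspaces *)

Section Lagrangian.
Variable K : numClosedFieldType.

Lemma exists_row_base m d e (X : 'M[K]_(m, d)) : \rank X = e ->
  exists2 M : 'M[K]_(e, d), row_free M & (M :=: X)%MS.
Proof. by move=> <-; exists (row_base X); [apply: row_base_free | apply: eq_row_base]. Qed.

Lemma trmx11 (M : 'M[K]_1) : M^T = M.
Proof. by apply/matrixP => i j; rewrite mxE !ord1. Qed.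

(* If an eigenvector [x] is not isotropic, its orthogonal complement is invariant, and by
   parity [l] is still an eigenvalue there; combine the two eigenvectors. *)
Lemma isotropic_eigenvector e (h F : 'M[K]_e) l : F^T = F -> (h *m F)^T = h *m F ->
  root (char_poly h) l -> ~~ odd (mup l (char_poly h)) ->
  exists x : 'rV[K]_e, [/\ x != 0, x *m h = l *: x & x *m F *m x^T = 0].
Proof.
case: e h F => [|e] h F sF sh rl ev.
  by move: rl; rewrite /root /char_poly det_mx00 hornerC oner_eq0.
have /eigenvalueP[x xh x0] : eigenvalue h l by rewrite eigenvalue_root_char.
have [xx|xx] := eqVneq (x *m F *m x^T) 0; first by exists x.
have symF (u v : 'rV[K]_e.+1) : u *m F *m v^T = v *m F *m u^T.
  by rewrite -[LHS]trmx11 !trmx_mul trmxK sF mulmxA.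
have symh : h *m F = F *m h^T by rewrite -sh trmx_mul sF.
have rk : \rank (kermx (F *m x^T)) = e.
  rewrite mxrank_ker.
  have -> : \rank (F *m x^T) = 1%N; last by rewrite subn1.
  apply/eqP; rewrite -mxrank_tr; apply/eqP; rewrite rank_rV.
  case: eqP => // z; case/eqP: xx; apply: trmx_inj.
  by rewrite -mulmxA trmx_mul z mul0mx trmx0.
have [N fN eN] := exists_row_base rk.
have NF : N *m F *m x^T = 0 by rewrite -mulmxA; apply/sub_kermxP; rewrite eN.
have /submxP[h' eh] : (N *m h <= N)%MS.
  rewrite eN; apply/sub_kermxP; rewrite mulmxA -(mulmxA N) symh !mulmxA.
  by rewrite -(mulmxA _ h^T) -trmx_mul xh linearZ /= -scalemxAr NF scaler0.
pose Q : 'M[K]_(1 + e) := col_mx x N.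
have uQ : Q \in unitmx.
  rewrite -row_free_unit; apply: inj_row_free => v.
  rewrite -[v]hsubmxK mul_row_col => z.
  have v0 : lsubmx v = 0.
    have := congr1 (fun u => u *m (F *m x^T)) z.
    rewrite mul0mx mulmxDl -(mulmxA (rsubmx v)) (mulmxA N) NF mulmx0 addr0 -mulmxA.
    rewrite (mulmxA x) [lsubmx v]mx11_scalar mul_scalar_mx => /eqP.
    by rewrite scaler_eq0 (negbTE xx) orbF => /eqP ->; rewrite raddf0.
  move: z; rewrite v0 mul0mx add0r => /eqP; rewrite mulmx_free_eq0 // => /eqP ->.
  by rewrite row_mx0.
have eQ : Q *m h = block_mx l%:M 0 0 h' *m Q.
  by rewrite mul_col_mx mul_block_col !mul0mx addr0 add0r mul_scalar_mx xh eh.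
have ech : char_poly h = ('X - l%:P) * char_poly h'.
  rewrite (char_poly_sim uQ eQ) char_poly_lblock; congr (_ * _).
  by rewrite /char_poly det_mx11 !mxE /= !mulr1n.
have rl' : root (char_poly h') l.
  apply/negPn/negP => nr; case/negP: ev.
  rewrite ech mupMl // -['X - _]expr1 mup_XsubCX eqxx //.
have /eigenvalueP[y yh y0] : eigenvalue h' l by rewrite eigenvalue_root_char.
pose t := y *m N.
have th : t *m h = l *: t by rewrite /t -mulmxA eh mulmxA yh scalemxAl.
have t0 : t != 0 by rewrite mulmx_free_eq0.
have tx : t *m F *m x^T = 0 by rewrite /t -!mulmxA (mulmxA N) NF mulmx0.
have [tt|tt] := eqVneq (t *m F *m t^T) 0; first by exists t.
pose a := (x *m F *m x^T) 0 0; pose b := (t *m F *m t^T) 0 0.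
have b0 : b != 0.
  by apply: contraNneq tt => b0; rewrite [_ *m _]mx11_scalar -/b b0 raddf0.
pose c := sqrtC (- a / b); exists (x + c *: t); split.
- apply: contraNneq xx => z; have := congr1 (fun u => u *m F *m x^T) z.
  by rewrite !mulmxDl -!scalemxAl tx scaler0 addr0 !mul0mx => ->.
- by rewrite mulmxDl -scalemxAl xh th scalerDr !scalerA mulrC.
have xt : x *m F *m t^T = 0 by rewrite symF.
rewrite linearD linearZ /= !mulmxDl !mulmxDr -!scalemxAl -!scalemxAr xt tx !scaler0.
rewrite addr0 add0r scalerA -expr2 sqrtCK [x *m _ *m _]mx11_scalar [t *m _ *m _]mx11_scalar.
by rewrite -/a -/b scale_scalar_mx divfK // -raddfD /= subrr raddf0.
Qed.

(** Passage to the orthogonal complement of [L] modulo [L]: [M] spans a complement of [L] there, and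
    [h2], [F2] are the induced operator and form. The form identifies the remaining quotient with
    the dual of [L], on which [h] acts as the transpose of [h1]; hence the square, and the parities
    of multiplicities of [h] are those of [h2]. *)
Lemma isotropic_reduction r e (h F : 'M[K]_(r + (e + r))) (L : 'M[K]_(r, r + (e + r))) h1 :
  F^T = F -> F \in unitmx -> (h *m F)^T = h *m F ->
  row_free L -> L *m h = h1 *m L -> L *m F *m L^T = 0 ->
  exists (M : 'M[K]_(e, r + (e + r))) (h2 F2 : 'M[K]_e),
    [/\ M *m F *m L^T = 0, (exists Y, M *m h = h2 *m M + Y *m L),
        M *m F *m M^T = F2 & [/\ F2^T = F2, (h2 *m F2)^T = h2 *m F2,
        char_poly h = char_poly h1 ^+ 2 * char_poly h2,
        (forall (x : 'rV_e) z, x *m M = z *m L -> x = 0) &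
        (forall v : 'rV_(r + (e + r)), v *m F *m L^T = 0 -> exists x z, v = x *m M + z *m L)]].
Proof.
move=> sF uF sh fL Lh LFL.
pose Lp := kermx (F *m L^T).
have rL : \rank L = r by apply/eqP.
have rLp : \rank Lp = (e + r)%N.
  rewrite mxrank_ker -mxrank_tr trmx_mul trmxK sF.
  by rewrite mxrankMfree ?row_free_unit // rL addKn.
have LLp : (L <= Lp)%MS by apply/sub_kermxP; rewrite mulmxA.
have rM : \rank (Lp :\: L)%MS = e.
  have := mxrank_cap_compl Lp L; rewrite (capmx_idPr LLp) rL rLp => e1.
  by apply: (@addnI r); rewrite e1 addnC.
have [M fM eM] := exists_row_base rM.
have Lp_sum : (Lp :=: M + L)%MS.
  apply: eqmx_trans (eqmx_sym (addsmx_diff_cap_eq Lp L)) _.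
  exact: adds_eqmx (eqmx_sym eM) (capmx_idPr LLp).
have MFL : M *m F *m L^T = 0.
  by rewrite -mulmxA; apply/sub_kermxP; rewrite eM diffmxSl.
have spanLp (v : 'rV_(r + (e + r))) : v *m F *m L^T = 0 -> exists x z, v = x *m M + z *m L.
  move=> vF; have : (v <= M + L)%MS by rewrite -Lp_sum; apply/sub_kermxP; rewrite mulmxA.
  by move=> /sub_addsmxP[[x z] /= ->]; exists x, z.
have symh : h *m F = F *m h^T by rewrite -sh trmx_mul sF.
have : (M *m h <= M + L)%MS.
  rewrite -Lp_sum; apply/sub_kermxP; rewrite mulmxA -[M *m h *m F]mulmxA symh.
  by rewrite !mulmxA -(mulmxA _ h^T) -trmx_mul Lh trmx_mul mulmxA MFL mul0mx.
case/sub_addsmxP => -[h2 Y] /= Mh.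
have indep (x : 'rV_e) z : x *m M = z *m L -> x = 0.
  move=> e1; have : (x *m M <= (Lp :\: L) :&: L)%MS.
    by rewrite sub_capmx -eM submxMl e1 submxMl.
  by rewrite capmx_diff submx0 mulmx_free_eq0 // => /eqP.
have rW : \rank (Lp^C)%MS = r by rewrite mxrank_compl rLp addnK.
have [W fW eW] := exists_row_base rW.
(* A basis adapted to the flag formed by [L], its orthogonal complement and the whole space; [h] is
   block triangular in it. *)
pose Q := col_mx L (col_mx M W).
have uQ : Q \in unitmx.
  rewrite -row_full_unit -sub1mx.
  have : (1%:M <= Lp + Lp^C)%MS by rewrite sub1mx addsmx_compl_full.
  move=> /submx_trans; apply; rewrite addsmx_sub Lp_sum addsmx_sub -eW /Q.
  rewrite -!addsmxE; apply/andP; split; [apply/andP; split|].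
  - by rewrite (submx_trans _ (addsmxSr _ _)) // -addsmxE addsmxSl.
  - by rewrite addsmxSl.
  - by rewrite (submx_trans _ (addsmxSr _ _)) // -addsmxE addsmxSr.
have LFM : L *m F *m M^T = 0.
  by apply: trmx_inj; rewrite !trmx_mul trmxK sF mulmxA MFL trmx0.
(* The pairing of [L] with [W], invertible since the form is nondegenerate; it conjugates [h1] to
   the transpose of the action [h3] on the last quotient. *)
pose G := L *m F *m W^T.
have uG : G \in unitmx.
  rewrite -row_free_unit; apply: inj_row_free => x xG.
  apply/eqP; rewrite -(mulmx_free_eq0 _ fL); apply/eqP.
  apply: (can_inj (mulmxK uF)); rewrite mul0mx.
  have uQt : Q^T \in unitmx by rewrite unitmx_tr.
  apply: (can_inj (mulmxK uQt)); rewrite mul0mx /Q !tr_col_mx !mul_mx_row.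
  by rewrite -!mulmxA !(mulmxA L) LFL LFM -/G xG !mulmx0 !row_mx0.
have [w ew] : exists w, W *m h = w *m Q by exists (W *m h *m invmx Q); rewrite mulmxKV.
pose w1 := lsubmx w; pose w2 := lsubmx (rsubmx w); pose h3 := rsubmx (rsubmx w).
have Wh : W *m h = w1 *m L + (w2 *m M + h3 *m W).
  by rewrite ew /Q -[w]hsubmxK -[rsubmx w]hsubmxK !mul_row_col.
have GG : h1 *m G = G *m h3^T.
  rewrite /G !mulmxA -Lh -(mulmxA L) symh !mulmxA -(mulmxA _ h^T) -trmx_mul Wh.
  by rewrite !linearD /= !trmx_mul !mulmxA LFL LFM !mul0mx !add0r.
have ch3 : char_poly h3 = char_poly h1.
  by rewrite -char_poly_tr; apply: (char_poly_sim uG); rewrite GG.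
exists M, h2, (M *m F *m M^T); split=> //; first by exists Y.
have eF2 : (M *m F *m M^T)^T = M *m F *m M^T by rewrite !trmx_mul trmxK sF mulmxA.
split=> //.
  have -> : h2 *m (M *m F *m M^T) = M *m (h *m F) *m M^T.
    by rewrite !mulmxA Mh !mulmxDl -!(mulmxA Y) LFM mulmx0 addr0.
  by rewrite !trmx_mul trmxK -trmx_mul sh mulmxA.
have eQ : Q *m h = block_mx h1 0 (col_mx Y w1) (block_mx h2 0 w2 h3) *m Q.
  rewrite /Q mul_block_col mul0mx addr0 mul_block_col mul0mx addr0.
  rewrite [col_mx Y w1 *m L]mul_col_mx [LHS]mul_col_mx [col_mx M W *m h]mul_col_mx Lh.
  by rewrite add_col_mx Mh Wh; congr col_mx; congr col_mx; rewrite addrC.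
by rewrite (char_poly_sim uQ eQ) !char_poly_lblock ch3 expr2 -mulrA [_ * char_poly h1]mulrC.
Qed.

End Lagrangian.

(** * Growing an isotropic invariant subspace up to half the dimension *)

Section LagrangianExistence.
Variable K : numClosedFieldType.
Local Notation conjm := (map_mx (@Num.conj K)).

(* [u *m F *m v^T] is a symmetric bilinear form for which [h] is selfadjoint, and
   [u |-> conjm u *m Sg] is an antilinear involution anticommuting with [h] and
   turning the form into the opposite of its conjugate. *)
Definition krein_system d (h F Sg : 'M[K]_d) : Prop :=
  [/\ F^T = F, F \in unitmx & (h *m F)^T = h *m F] /\
  [/\ conjm Sg *m Sg = 1%:M, conjm h *m Sg = - (Sg *m h)
    & Sg *m F *m Sg^T = - conjm F].

Definition isotropic_invariant d (h F Sg : 'M[K]_d) m (L : 'M[K]_(m, d)) : Prop :=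
  [/\ (L *m h <= L)%MS, (conjm L *m Sg <= L)%MS & L *m F *m L^T = 0].

(** Neutrality is demanded for eigenvectors modulo every admissible [L], because each extension step
    works in a quotient, which is no longer given as a Hamiltonian. *)
Definition imaginary_neutral d (h F Sg : 'M[K]_d) : Prop :=
  forall m (L : 'M[K]_(m, d)) (v : 'rV[K]_d) l,
  isotropic_invariant h F Sg L -> v *m F *m L^T = 0 ->
  (v *m h - l *: v <= L)%MS -> 'Re l = 0 ->
  conjm v *m Sg *m F *m v^T = 0.

Section Step.
Variables (d : nat) (h F Sg : 'M[K]_d).
Hypothesis kr : krein_system h F Sg.

Lemma krein_involutive m (u : 'M[K]_(m, d)) : conjm (conjm u *m Sg) *m Sg = u.
Proof. by case: kr => _ [e _ _]; rewrite map_mxM conj_mxK -mulmxA e mulmx1. Qed.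

Lemma krein_symmetric m n (u : 'M[K]_(m, d)) (v : 'M[K]_(n, d)) :
  (u *m F *m v^T)^T = v *m F *m u^T.
Proof. by case: kr => [[sF _ _] _]; rewrite !trmx_mul trmxK sF mulmxA. Qed.

Lemma krein_conj m n (u : 'M[K]_(m, d)) (v : 'M[K]_(n, d)) :
  conjm u *m Sg *m F *m (conjm v *m Sg)^T = - conjm (u *m F *m v^T).
Proof.
case: kr => _ [_ _ e]; rewrite trmx_mul -!mulmxA.
by rewrite !(mulmxA Sg) (mulmxA (Sg *m F)) e mulNmx mulmxN !map_mxM -map_trmx mulmxA.
Qed.

Lemma krein_selfadjoint m n (u : 'M[K]_(m, d)) (v : 'M[K]_(n, d)) :
  u *m h *m F *m v^T = u *m F *m (v *m h)^T.
Proof.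
case: kr => [[sF _ sh] _]; rewrite -(mulmxA u) -sh !trmx_mul sF.
by rewrite !mulmxA.
Qed.

Lemma isotropic_extend m k (L : 'M[K]_(m, d)) (N : 'M[K]_(k, d)) :
  isotropic_invariant h F Sg L -> (N *m h <= col_mx N L)%MS ->
  (conjm N *m Sg <= col_mx N L)%MS -> N *m F *m N^T = 0 -> N *m F *m L^T = 0 ->
  isotropic_invariant h F Sg (col_mx N L).
Proof.
move=> [Lh LS LF] Nh NS NN NL.
have LcN : (L <= col_mx N L)%MS by rewrite -addsmxE addsmxSr.
split.
- by rewrite mul_col_mx col_mx_sub Nh (submx_trans Lh).
- by rewrite map_col_mx mul_col_mx col_mx_sub NS (submx_trans LS).
have LN : L *m F *m N^T = 0 by apply: trmx_inj; rewrite krein_symmetric NL trmx0.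
by rewrite mul_col_mx tr_col_mx mul_col_row NN NL LN LF -block_mx0.
Qed.

Variables (m : nat) (L : 'M[K]_(m, d)).
Hypothesis isoL : isotropic_invariant h F Sg L.

(** [u] represents an eigenvector, possibly zero, of the operator induced on the orthogonal
    complement of [L] modulo [L]. *)
Let quotient_eigen (u : 'rV[K]_d) l := u *m F *m L^T = 0 /\ (u *m h - l *: u <= L)%MS.

Lemma conj_sub m' (y : 'M[K]_(m', d)) : (y <= L)%MS -> (conjm y *m Sg <= L)%MS.
Proof.
move=> /submxP[z ->]; rewrite map_mxM -mulmxA; case: isoL => _ LS _.
exact: submx_trans (submxMl _ _) LS.
Qed.

Lemma conj_orth m' (u : 'M[K]_(m', d)) : u *m F *m L^T = 0 ->
  conjm u *m Sg *m F *m L^T = 0.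
Proof.
move=> uL; case: isoL => _ /submxP[Z eZ] _.
have eL : L = conjm Z *m (conjm L *m Sg).
  by rewrite -{1}(krein_involutive L) {1}eZ map_mxM mulmxA.
by rewrite eL trmx_mul mulmxA krein_conj uL map_mx0 oppr0 mul0mx.
Qed.

Lemma quotient_eigen_conj u l : quotient_eigen u l ->
  quotient_eigen (conjm u *m Sg) (- l^*).
Proof.
move=> [uL uh]; split; first exact: conj_orth.
have := conj_sub uh; rewrite map_mxB map_mxM map_mxZ mulmxBl -(mulmxA _ _ Sg).
case: kr => _ [_ -> _]; rewrite mulmxN mulmxA -scalemxAl -opprD => s.
by rewrite scaleNr opprK -eqmx_opp.
Qed.

Lemma quotient_eigenD u v l : quotient_eigen u l -> quotient_eigen v l ->
  quotient_eigen (u + v) l.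
Proof.
move=> [uL uh] [vL vh]; split; first by rewrite !mulmxDl uL vL addr0.
by rewrite mulmxDl scalerDr opprD addrACA addmx_sub.
Qed.

Lemma quotient_eigenZ u l a : quotient_eigen u l -> quotient_eigen (a *: u) l.
Proof.
move=> [uL uh]; split; first by rewrite -!scalemxAl uL scaler0.
by rewrite -scalemxAl scalerA mulrC -scalerA -scalerBr scalemx_sub.
Qed.

Lemma quotient_eigen_orth u v a b : quotient_eigen u a -> quotient_eigen v b ->
  a != b -> u *m F *m v^T = 0.
Proof.
move=> [uL /submxP[y ey]] [vL /submxP[z ez]] ab.
have uh : u *m h = a *: u + y *m L by rewrite -ey addrCA subrr addr0.
have vh : v *m h = b *: v + z *m L by rewrite -ez addrCA subrr addr0.
have Lv : L *m F *m v^T = 0 by apply: trmx_inj; rewrite krein_symmetric vL trmx0.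
have := krein_selfadjoint u v; rewrite uh vh !mulmxDl linearD /= mulmxDr.
rewrite -!(mulmxA y) Lv mulmx0 addr0 trmx_mul mulmxA uL mul0mx addr0.
rewrite linearZ /= -!scalemxAl -scalemxAr => /eqP.
by rewrite -subr_eq0 -scalerBl scaler_eq0 subr_eq0 (negbTE ab) => /eqP.
Qed.

(** On the axis [J] preserves the eigenvalue, so [u + J u] or ['i *: (u - J u)] is a fixed
    eigenvector outside [L]. On a fixed vector the sesquilinear and the bilinear form coincide, so
    neutrality is isotropy and one vector can be adjoined alone. *)
Lemma extend_imaginary u l : imaginary_neutral h F Sg -> quotient_eigen u l ->
  'Re l = 0 -> ~~ (u <= L)%MS ->
  exists k (L' : 'M[K]_(k, d)), isotropic_invariant h F Sg L' /\ (L < L')%MS.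
Proof.
move=> neu qu l0 uL.
have el : - l^* = l.
  by move: l0; rewrite ReE => /eqP; rewrite mulf_eq0 invr_eq0 pnatr_eq0 orbF addr_eq0 => /eqP.
pose Ju := conjm u *m Sg.
have qJ : quotient_eigen Ju l by rewrite -[X in quotient_eigen _ X]el; apply: quotient_eigen_conj.
suff [w [qw wL Jw]] : exists w, [/\ quotient_eigen w l, ~~ (w <= L)%MS & conjm w *m Sg = w].
  exists (1 + m)%N, (col_mx w L); split; last first.
    by rewrite ltmxE -addsmxE addsmxSr /= col_mx_sub (negbTE wL).
  have [wo wh] := qw.
  have wc : (w <= col_mx w L)%MS by rewrite -addsmxE addsmxSl.
  apply: isotropic_extend => //; last by rewrite -{1}Jw; apply: neu isoL wo wh l0.
    rewrite -[w *m h](subrK (l *: w)) addmx_sub ?scalemx_sub //.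
    by apply: submx_trans wh _; rewrite -addsmxE addsmxSr.
  by rewrite Jw.
have [s1|s1] := boolP ((u + Ju)%R <= L)%MS; last first.
  exists (u + Ju); split; [exact: quotient_eigenD | exact: s1 |].
  by rewrite map_mxD mulmxDl krein_involutive addrC.
exists ('i *: (u - Ju)); split.
- by apply/quotient_eigenZ/quotient_eigenD => //; rewrite -scaleN1r; apply: quotient_eigenZ.
- apply: contra uL => s2.
  have -> : u = 2^-1 *: ((u + Ju) - 'i *: ('i *: (u - Ju))).
    rewrite scalerA -expr2 sqrCi scaleN1r opprK addrACA subrr addr0 -mulr2n -scaler_nat.
    by rewrite scalerA mulVf ?scale1r // pnatr_eq0.
  by rewrite scalemx_sub // addmx_sub // -scaleNr scalemx_sub.
by rewrite map_mxZ map_mxB /= conjCi -scalemxAl mulmxBl krein_involutive scaleNr -scalerN opprB.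
Qed.

(** Off the axis [l] and [- l^*] differ, so selfadjointness makes [u] and [J u] orthogonal; [J u] is
    isotropic because [J] conjugates the form up to sign. *)
Lemma extend_pair u l : quotient_eigen u l -> 'Re l != 0 -> ~~ (u <= L)%MS ->
  u *m F *m u^T = 0 ->
  exists k (L' : 'M[K]_(k, d)), isotropic_invariant h F Sg L' /\ (L < L')%MS.
Proof.
move=> qu l0 uL uu; pose Ju := conjm u *m Sg.
have qJ : quotient_eigen Ju (- l^*) by apply: quotient_eigen_conj.
have uJ : u *m F *m Ju^T = 0.
  apply: quotient_eigen_orth qu qJ _; apply: contraNneq l0 => e.
  by rewrite ReE {1}e addNr mul0r.
have Ju_u : Ju *m F *m u^T = 0 by apply: trmx_inj; rewrite krein_symmetric uJ trmx0.
have JJ : Ju *m F *m Ju^T = 0 by rewrite krein_conj uu map_mx0 oppr0.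
pose N := col_mx u Ju; exists ((1 + 1) + m)%N, (col_mx N L).
have LN : (L <= col_mx N L)%MS by rewrite -addsmxE addsmxSr.
have uN : (u <= col_mx N L)%MS.
  by rewrite -addsmxE (submx_trans _ (addsmxSl _ _)) // -addsmxE addsmxSl.
have JN : (Ju <= col_mx N L)%MS.
  by rewrite -addsmxE (submx_trans _ (addsmxSl _ _)) // -addsmxE addsmxSr.
split; last first.
  by rewrite ltmxE LN; apply: contra uL; apply: submx_trans.
have qN v a : quotient_eigen v a -> (v <= col_mx N L)%MS -> (v *m h <= col_mx N L)%MS.
  move=> [_ vh] vN; rewrite -[v *m h](subrK (a *: v)) addmx_sub ?scalemx_sub //.
  exact: submx_trans vh LN.
apply: isotropic_extend => //.
- by rewrite mul_col_mx col_mx_sub (qN _ _ qu) // (qN _ _ qJ).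
- by rewrite map_col_mx mul_col_mx col_mx_sub krein_involutive uN JN.
- by rewrite mul_col_mx tr_col_mx mul_col_row uu uJ Ju_u JJ -block_mx0.
- by case: qu qJ => [uo _] [Jo _]; rewrite !mul_col_mx uo Jo col_mx0.
Qed.

End Step.

Lemma isotropic_step r e (h F Sg : 'M[K]_(r + (e.+1 + r))) (L : 'M[K]_(r, r + (e.+1 + r))) :
  krein_system h F Sg -> imaginary_neutral h F Sg ->
  (forall z, 0 < 'Re z -> ~~ odd (mup z (char_poly h))) ->
  row_free L -> isotropic_invariant h F Sg L ->
  exists k (L' : 'M[K]_(k, r + (e.+1 + r))), isotropic_invariant h F Sg L' /\ (L < L')%MS.
Proof.
move=> kr neu ev fL isoL; have [[sF uF sh] _] := kr; have [/submxP[h1 Lh] _ LF] := isoL.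
have [M [h2 [F2 [MF [Y Mh] eF2 [sF2 sh2 ech indep spanL]]]]] :=
  isotropic_reduction sF uF sh fL Lh LF.
have notL (x : 'rV_e.+1) : x != 0 -> ~~ (x *m M <= L)%MS.
  by move=> x0; apply/negP => /submxP[z /indep xz]; rewrite xz eqxx in x0.
have qM (x : 'rV_e.+1) l : x *m h2 = l *: x ->
    x *m M *m F *m L^T = 0 /\ (x *m M *m h - l *: (x *m M) <= L)%MS.
  move=> xh; split; first by rewrite -!mulmxA (mulmxA M) MF mulmx0.
  by rewrite -mulmxA Mh mulmxDr !mulmxA xh -scalemxAl addrAC subrr add0r submxMl.
have [l /eigenvalueP[x xh x0]] : exists l, eigenvalue h2 l.
  have /closed_rootP[l rl] : size (char_poly h2) != 1%N by rewrite size_char_poly.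
  by exists l; rewrite eigenvalue_root_char.
have [l0|l0] := eqVneq ('Re l) 0.
  exact: (extend_imaginary kr isoL neu (qM x l xh) l0 (notL _ x0)).
(* Evenness is assumed in the right half plane only; [J] carries an eigenvector from the left half
   plane over to it. *)
have [z [z0 rz]] : exists z, 0 < 'Re z /\ root (char_poly h2) z.
  have /orP[lt|lt] : (0 < 'Re l) || ('Re l < 0).
  - have := real_leNgt (real0 K) (Creal_Re l); rewrite le_eqVlt eq_sym (negbTE l0) /=.
    by move=> ->; rewrite orNb.
  - by exists l; rewrite -eigenvalue_root_char; split=> //; apply/eigenvalueP; exists x.
  exists (- l^*); split; first by rewrite raddfN /= Re_conj oppr_gt0.
  have qJ := quotient_eigen_conj kr isoL (qM x l xh).
  have [y [t eJ]] := spanL _ qJ.1.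
  have y0 : y != 0.
    apply: contraNneq (notL _ x0) => y0.
    rewrite -(krein_involutive kr (x *m M)) eJ y0 mul0mx add0r.
    by apply: (conj_sub isoL); rewrite submxMl.
  rewrite -eigenvalue_root_char; apply/eigenvalueP; exists y => //.
  case: qJ => _ /submxP[t2]; rewrite eJ mulmxDl -!mulmxA Mh Lh mulmxDr scalerDr !mulmxA.
  rewrite !scalemxAl => e1; apply/eqP; rewrite -subr_eq0; apply/eqP.
  apply: (indep _ (t2 - t *m h1 - y *m Y - l^* *: t)).
  rewrite !mulmxBl -e1 !scaleNr !mulNmx opprD !opprK.
  move: (y *m h2 *m M) (y *m Y *m L) (t *m h1 *m L) (_ *: y *m M) (_ *: t *m L).
  by move=> a b c f g; apply/rowP => k; rewrite !mxE; ring.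
have [y [y0 yh yy]] : exists y : 'rV_e.+1, [/\ y != 0, y *m h2 = z *: y & y *m F2 *m y^T = 0].
  apply: isotropic_eigenvector => //; have := ev z z0.
  by rewrite ech expr2 !mupM ?mulf_neq0 ?monic_neq0 ?char_poly_monic // !oddD addbb.
apply: (extend_pair kr isoL (qM y z yh) _ (notL _ y0)); first by rewrite gt_eqF.
by rewrite trmx_mul !mulmxA -(mulmxA y M) -(mulmxA y) eF2.
Qed.

Lemma isotropic_rank d (h F Sg : 'M[K]_d) m (L : 'M[K]_(m, d)) :
  krein_system h F Sg -> isotropic_invariant h F Sg L -> (\rank L + \rank L <= d)%N.
Proof.
move=> [[sF uF _] _] [_ _ LF].
have LL : (L <= kermx (F *m L^T))%MS by apply/sub_kermxP; rewrite mulmxA.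
have := mxrankS LL; rewrite mxrank_ker.
have -> : \rank (F *m L^T) = \rank L.
  by rewrite -mxrank_tr trmx_mul trmxK sF mxrankMfree ?row_free_unit.
by rewrite leq_subRL ?rank_leq_col.
Qed.

Lemma isotropic_step_rank d (h F Sg : 'M[K]_d) m (L : 'M[K]_(m, d)) :
  krein_system h F Sg -> imaginary_neutral h F Sg ->
  (forall z, 0 < 'Re z -> ~~ odd (mup z (char_poly h))) ->
  isotropic_invariant h F Sg L -> (\rank L + \rank L < d)%N ->
  exists k (L' : 'M[K]_(k, d)), isotropic_invariant h F Sg L' /\ (L < L')%MS.
Proof.
move=> kr neu ev [Lh LS LF] lt.
have [L1 fL1 eL1] := exists_row_base (erefl (\rank L)).
suff : exists k (L' : 'M[K]_(k, d)), isotropic_invariant h F Sg L' /\ (L1 < L')%MS.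
  by move=> [k [L' [iL lL]]]; exists k, L'; split=> //; move: lL; rewrite !ltmxE !eL1.
have /submxP[Z eZ] : (L1 <= L)%MS by rewrite eL1.
have iL1 : isotropic_invariant h F Sg L1.
  split; rewrite ?eL1 /=.
  - by rewrite eZ -mulmxA (submx_trans (submxMl _ _)).
  - by rewrite eZ map_mxM -mulmxA (submx_trans (submxMl _ _)).
  - by rewrite eZ trmx_mul -!mulmxA (mulmxA F) (mulmxA L) (mulmxA L) LF mul0mx mulmx0.
move: (\rank L) L1 lt fL1 iL1 {eL1 Z eZ} => r L1 lt fL1 iL1 {Lh LS LF L m}.
have [e ed] : {e | d = (r + (e.+1 + r))%N}.
  exists (d - (r + r)).-1; rewrite prednK ?subn_gt0 //.
  by rewrite addnCA subnK // ltnW.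
by subst d; apply: isotropic_step.
Qed.

Lemma lagrangian_exists d (h F Sg : 'M[K]_d) :
  krein_system h F Sg -> imaginary_neutral h F Sg ->
  (forall z, 0 < 'Re z -> ~~ odd (mup z (char_poly h))) ->
  exists m (L : 'M[K]_(m, d)), isotropic_invariant h F Sg L /\ (\rank L + \rank L = d)%N.
Proof.
move=> kr neu ev.
suff H n m (L : 'M[K]_(m, d)) : isotropic_invariant h F Sg L -> (d - \rank L <= n)%N ->
    exists m (L : 'M[K]_(m, d)), isotropic_invariant h F Sg L /\ (\rank L + \rank L = d)%N.
  apply: (H d 0%N 0); last by rewrite leq_subr.
  by split; rewrite ?mul0mx ?map_mx0 ?mul0mx ?sub0mx.
elim: n m L => [|n IH] m L iL le.
all: have := isotropic_rank kr iL; rewrite leq_eqVlt => /orP[/eqP e|lt]; first by exists m, L.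
  move: le; rewrite leqn0 subn_eq0 => le.
  have := leq_trans lt le; rewrite ltnNge leq_addr //.
have [k [L' [iL' /rank_ltmx lL]]] := isotropic_step_rank kr neu ev iL lt.
apply: (IH k L' iL'); rewrite -ltnS; apply: leq_trans le.
apply: ltn_sub2l lL; apply: leq_ltn_trans lt; exact: leq_addr.
Qed.

End LagrangianExistence.

(** * From Lagrangian subspaces to Riccati solutions *)

Section SymmetricRiccati.
Variable K : numClosedFieldType.
Local Notation conjm := (map_mx (@Num.conj K)).

Lemma stable_eigenvector m n (X : 'M[K]_(m, n)) (Z : 'M[K]_n) :
  X != 0 -> (X *m Z <= X)%MS ->
  exists (x : 'rV[K]_n) l, [/\ x != 0, (x <= X)%MS & x *m Z = l *: x].
Proof.
move=> X0 XZ; have [Y fY eY] := exists_row_base (erefl (\rank X)).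
have /submxP[N eN] : (Y *m Z <= Y)%MS.
  have /submxP[T eT] : (Y <= X)%MS by rewrite eY.
  by rewrite [X in (X *m _ <= _)%MS]eT -mulmxA; apply: submx_trans (submxMl _ _) _; rewrite eY.
have /closed_rootP[l rl] : size (char_poly N) != 1%N.
  by rewrite size_char_poly eqSS mxrank_eq0.
have /eigenvalueP[y yN y0] : eigenvalue N l by rewrite eigenvalue_root_char.
exists (y *m Y), l; split.
- by rewrite mulmx_free_eq0.
- by rewrite -eY submxMl.
- by rewrite -mulmxA eN mulmxA yN scalemxAl.
Qed.

(** The graph [row_mx 1%:M Q] is isotropic for this form exactly when [Q Q^T = 1], and stable under
    conjugation followed by [krein_swap] exactly when [conj Q] is the inverse of [Q]. *)
Definition krein_form n : 'M[K]_(n + n) := block_mx (- 1%:M) 0 0 1%:M.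
Definition krein_swap n : 'M[K]_(n + n) := block_mx 0 1%:M 1%:M 0.

Lemma gram_conj n p (b : 'M[K]_(n, p)) (be : 'M[K]_n) : b *m ctmx b = be ->
  [/\ b *m ctmx b = be, ctmx b^T *m b^T = conjm be, be^T = conjm be
    & (conjm be)^T = be].
Proof.
move=> <-; have cb : ctmx b^T *m b^T = conjm (b *m ctmx b).
  by rewrite conj_mxM /ctmx !conj_mx_tr trmxK conj_mxK.
have tb : (b *m ctmx b)^T = conjm (b *m ctmx b) by rewrite -cb trmx_mul ctmx_tr.
by split; rewrite // -tb trmxK.
Qed.

Lemma hamiltonian_krein n p (a : 'M[K]_n) (b : 'M[K]_(n, p)) : a^T = a ->
  krein_system (hamiltonian a b b^T)^T (krein_form n) (krein_swap n).
Proof.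
move=> sa; have ca : ctmx a = conjm a by rewrite /ctmx conj_mx_tr sa.
have [be [ebe cb tb tcb]] : exists be : 'M[K]_n, [/\ b *m ctmx b = be,
    ctmx b^T *m b^T = conjm be, be^T = conjm be & (conjm be)^T = be].
  by exists (b *m ctmx b); apply: (@gram_conj _ _ b).
rewrite /hamiltonian ca cb ebe.
rewrite /krein_form /krein_swap; split; split.
- by rewrite tr_block_mx !trmx0 linearN /= trmx1.
- rewrite unitmxE det_ublock det1 mulr1 -scaleN1r detZ det1 mulr1.
  by rewrite unitrX ?unitrN1.
- rewrite tr_block_mx mulmx_block !mulmx0 !mulmx1 !addr0 !add0r !mulmxN !mulmx1.
  by rewrite tr_block_mx !linearN /= !opprK !trmxK tcb tb conj_mx_tr sa.
- by rewrite map_block_mx !map_mx0 conj_mx1 mulmx_block !(mulmx0, mul0mx, mulmx1, addr0, add0r) -scalar_mx_block.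
- rewrite tr_block_mx map_block_mx !mulmx_block !(mulmx0, mul0mx, mulmx1, mul1mx, addr0, add0r).
  by rewrite opp_block_mx !linearN /= !conj_mxN !opprK -!conj_mx_tr !conj_mxK sa tb tcb conj_mx_tr sa.
- rewrite tr_block_mx !trmx0 trmx1 !mulmx_block.
  rewrite !(mulmx0, mul0mx, mulmx1, mul1mx, addr0, add0r).
  by rewrite map_block_mx opp_block_mx conj_mxN conj_mx1 !map_mx0 oppr0 opprK.
Qed.

(** If the Lagrangian subspace were not a graph, the kernel of [L1] would be a nonzero invariant
    space and yield a nonzero isotropic left eigenvector of [a] killed by [b], which the last
    hypothesis excludes. Isotropy and stability under [J] give [Q] two inverses, [Q^T] and [conj Q];
    their equality makes [P] hermitian. *)
Lemma symmetric_riccati n p (a : 'M[K]_n) (b : 'M[K]_(n, p)) : a^T = a ->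
  imaginary_neutral (hamiltonian a b b^T)^T (krein_form n) (krein_swap n) ->
  (forall z, 0 < 'Re z -> ~~ odd (mup z (char_poly (hamiltonian a b b^T)))) ->
  (forall (y : 'rV[K]_n) l, y *m a = l *: y -> y *m b = 0 -> y *m y^T = 0 -> y = 0) ->
  exists P : 'M[K]_n, [/\ ctmx P = P, conjm P *m P = 1%:M &
    a *m P + P *m ctmx a + P *m (conjm (b *m ctmx b)) *m P + b *m ctmx b = 0].
Proof.
move=> sa neu ev unob; have kr := hamiltonian_krein b sa.
set h := (_)^T in neu kr; set F := krein_form n in neu kr; set Sg := krein_swap n in neu kr.
have ca : ctmx a = conjm a by rewrite /ctmx conj_mx_tr sa.
have eh : h = block_mx (- conjm a) (conjm (b *m ctmx b)) (- (b *m ctmx b)) a.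
  have [_ cb tb tcb] := gram_conj (erefl (b *m ctmx b)).
  by rewrite /h /hamiltonian tr_block_mx !linearN /= sa ca conj_mx_tr sa cb tcb tb.
have [m [L [iL rL]]] : exists m (L : 'M[K]_(m, n + n)),
    isotropic_invariant h F Sg L /\ (\rank L + \rank L = n + n)%N.
  by apply: lagrangian_exists => // z z0; rewrite char_poly_tr ev.
have {}rL : \rank L = n by apply: double_inj; rewrite -!addnn.
have [L0 fL0 eL0] := exists_row_base rL.
have {iL} [/submxP[Z eZ] LS LF] : isotropic_invariant h F Sg L0.
  have [Lh LS LF] := iL; have /submxP[T eT] : (L0 <= L)%MS by rewrite eL0.
  split; rewrite ?eL0.
  - by rewrite eT -mulmxA (submx_trans (submxMl _ _)).
  - by rewrite eT conj_mxM -mulmxA (submx_trans (submxMl _ _)).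
  - by rewrite eT trmx_mul -!mulmxA (mulmxA F) (mulmxA L) (mulmxA L) LF mul0mx mulmx0.
pose L1 := lsubmx L0; pose L2 := rsubmx L0.
have eL : L0 = row_mx L1 L2 by rewrite hsubmxK.
have h0 (x : 'rV[K]_n) : x *m L1 = 0 ->
  let y := x *m L2 in [/\ y *m b = 0, x *m Z *m L1 = 0, x *m Z *m L2 = y *m a & y *m y^T = 0].
  move=> x1 y; have ex : x *m L0 = row_mx 0 y by rewrite eL mul_mx_row x1.
  have exZ : row_mx (x *m Z *m L1) (x *m Z *m L2) = row_mx (- (y *m (b *m ctmx b))) (y *m a).
    rewrite -mul_mx_row -eL -mulmxA -eZ mulmxA ex eh mul_row_block !mul0mx !add0r.
    by rewrite mulmxN.
  have [e1 e2] := eq_row_mx exZ.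
  (* The image of [x *m L0] under [J] and its image under [h] both lie in the isotropic subspace;
     their pairing is [y b b^* y^*] up to transposition. *)
  have yb : y *m b = 0.
    apply: ctmx_mul_eq0.
    have [t et] := submxP LS.
    have : conjm (x *m L0) *m Sg *m F *m (x *m Z *m L0)^T = 0.
      rewrite conj_mxM -(mulmxA (conjm x)) et [_^T]trmx_mul -!mulmxA (mulmxA F) (mulmxA L0) (mulmxA L0) LF.
      by rewrite mul0mx !mulmx0.
    rewrite ex eL mul_mx_row exZ map_row_mx map_mx0 /Sg /F mul_row_block mul_row_block.
    rewrite !(mulmx0, mul0mx, mulmx1, addr0, add0r) tr_row_mx mul_row_col mul0mx addr0.
    rewrite mulmxN mulmx1 linearN /= mulmxN mulNmx opprK => /(congr1 trmx).
    by rewrite trmx_mul trmxK trmx0.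
  split=> //; first by rewrite e1 mulmxA yb mul0mx oppr0.
  have := LF; move=> /(congr1 (fun u => x *m u *m x^T)); rewrite mulmx0 mul0mx !mulmxA.
  rewrite -(mulmxA _ L0^T) -trmx_mul ex /F mul_row_block !(mulmx0, mul0mx, mulmx1, addr0, add0r).
  by rewrite tr_row_mx mul_row_col mul0mx add0r.
have u1 : L1 \in unitmx.
  rewrite -row_free_unit -kermx_eq0; apply/negPn/negP => k0.
  have [|x [l [x0 xk xZ]]] := @stable_eigenvector _ _ (kermx L1) Z k0.
    apply/row_subP => i; rewrite row_mul; apply/sub_kermxP.
    by have [] // := h0 (row i (kermx L1)); rewrite -row_mul mulmx_ker row0.
  have x1 : x *m L1 = 0 by apply/sub_kermxP.
  have [yb _ ya yy] := h0 x x1.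
  have y0 : x *m L2 = 0.
    by apply: (unob _ l) yb yy; rewrite -ya xZ -scalemxAl.
  have /eqP : x *m L0 = 0 by rewrite eL mul_mx_row x1 y0 row_mx0.
  by rewrite mulmx_free_eq0 // (negbTE x0).
pose Q := invmx L1 *m L2.
have eG : row_mx 1%:M Q = invmx L1 *m L0 by rewrite eL mul_mx_row mulVmx.
have eG' : L0 = L1 *m row_mx 1%:M Q by rewrite eG mulKVmx.
have [T2 eT2] : exists T, row_mx 1%:M Q *m h = T *m row_mx 1%:M Q.
  by exists (invmx L1 *m Z *m L1); rewrite -[RHS]mulmxA -eG' -mulmxA -eZ eG mulmxA.
have [T3 eT3] : exists T, conjm (row_mx 1%:M Q) *m Sg = T *m row_mx 1%:M Q.
  have [t et] := submxP LS.
  by exists (conjm (invmx L1) *m t *m L1); rewrite -[RHS]mulmxA -eG' -mulmxA -et eG conj_mxM mulmxA.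
have QQt : Q *m Q^T = 1%:M.
  have : row_mx 1%:M Q *m F *m (row_mx 1%:M Q)^T = 0.
    by rewrite eG trmx_mul -!mulmxA (mulmxA F) (mulmxA L0) (mulmxA L0) LF mul0mx mulmx0.
  rewrite /F mul_row_block !(mulmx0, mulmx1, addr0, add0r) tr_row_mx mul_row_col trmx1.
  by rewrite mul1mx mulmx1 addrC => /eqP; rewrite subr_eq0 => /eqP.
have cQQ : conjm Q *m Q = 1%:M.
  move: eT3; rewrite map_row_mx conj_mx1 /Sg mul_row_block !(mulmx0, mulmx1, addr0, add0r).
  by rewrite mul_mx_row mulmx1 => /eq_row_mx[-> <-].
have cQ : conjm Q = Q^T.
  by rewrite -[LHS]mulmx1 -QQt mulmxA cQQ mul1mx.
exists (conjm Q); split.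
- by rewrite /ctmx conj_mxK -cQ.
- by rewrite conj_mxK; apply: mulmx1C.
move: eT2; rewrite eh mul_row_block !mul1mx mul_mx_row mulmx1 => /eq_row_mx[<-].
move=> /(congr1 conjm); rewrite mulmxN mulmxDl !mulNmx.
rewrite conj_mxD [conjm (Q *m a)]conj_mxM conj_mxD !conj_mxN !conj_mxM !conj_mxK ca => e.
by rewrite addrC -[X in _ + X]addrA [X in _ + X]addrCA addrA e -opprD addNr.
Qed.

End SymmetricRiccati.

(** * Stability and frequency domain inequalities *)

Section Lyapunov.
Variable K : numClosedFieldType.

Lemma psd_congr m n (X : 'M[K]_(m, n)) (M : 'M[K]_n) : psd M -> psd (X *m M *m ctmx X).
Proof.
move=> h v; have := h (ctmx X *m v).
by rewrite ctmxM ctmxK !mulmxA.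
Qed.

Lemma psd_congr_unit n (X M : 'M[K]_n) : X \in unitmx -> psd (X *m M *m ctmx X) -> psd M.
Proof.
move=> uX /(psd_congr (invmx X)).
rewrite !mulmxA mulVmx // mul1mx -mulmxA -ctmxM mulVmx // ctmx1 mulmx1.
by [].
Qed.

Lemma psd_block_diag n1 n2 (M1 : 'M[K]_n1) (M2 : 'M[K]_n2) :
  psd M1 -> psd M2 -> psd (block_mx M1 0 0 M2).
Proof.
move=> h1 h2 v; rewrite -[v]vsubmxK ctmx_col mul_row_block !mulmx0 addr0 add0r.
by rewrite mul_row_col mxE addr_ge0.
Qed.

Lemma psd_ulsub n1 n2 (M : 'M[K]_(n1 + n2)) : psd M -> psd (ulsubmx M).
Proof.
move=> h v; have := h (col_mx v 0); rewrite -{1}[M]submxK ctmx_col ctmx0.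
by rewrite mul_row_block !mul0mx !addr0 mul_row_col mulmx0 addr0.
Qed.

Lemma psd_drsub n1 n2 (M : 'M[K]_(n1 + n2)) : psd M -> psd (drsubmx M).
Proof.
move=> h v; have := h (col_mx 0 v); rewrite -{1}[M]submxK ctmx_col ctmx0.
by rewrite mul_row_block !mul0mx !add0r mul_row_col mulmx0 add0r.
Qed.

Lemma quad_scalar (a c : 'M[K]_1) : (ctmx a *m c *m a) 0 0 = `|a 0 0| ^+ 2 * c 0 0.
Proof.
rewrite [a]mx11_scalar [c]mx11_scalar ctmx_scalar -!scalar_mxM !mxE /= !mulr1n normCK.
ring.
Qed.

Lemma psd_scalar (c : 'M[K]_1) : psd c <-> 0 <= c 0 0.
Proof.
split=> [/(_ 1%:M)|h v]; first by rewrite ctmx1 mul1mx mulmx1.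
by rewrite quad_scalar mulr_ge0 ?exprn_ge0.
Qed.

Lemma psd_diag0 n (s : 'cV[K]_n) (M : 'M[K]_n) :
  psd (block_mx (0 : 'M_1) (ctmx s) s M) -> s = 0.
Proof.
move=> h; apply/eqP/negPn/negP => s0.
have s_gt0 : 0 < vnorm2 s by rewrite lt_def vnorm2_ge0 vnorm2_eq0 s0.
pose q := (ctmx s *m M *m s) 0 0.
have q0 : 0 <= q.
  have := h (col_mx 0 s); rewrite ctmx_col ctmx0 mul_row_block !mul0mx !add0r.
  by rewrite mul_row_col mulmx0 add0r.
(* Chosen so that the form takes the value [-1] at the vector with entries [- c] and [s]. *)
pose c := (q + 1) / (2 * vnorm2 s).
have c0 : 0 <= c by rewrite divr_ge0 ?addr_ge0 ?mulr_ge0 ?vnorm2_ge0.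
have cc : c^* = c by rewrite conj_Creal // ger0_real.
have cN : (- c)^* = - c by rewrite conj_Creal // rpredN ger0_real.
have := h (col_mx (- c)%:M s); rewrite ctmx_col mul_row_block mulmx0 add0r.
rewrite mul_row_col mulmxDl ctmx_scalar cN !mul_scalar_mx mul_mx_scalar.
rewrite -scalemxAl.
have eT : (ctmx s *m s) 0 0 = vnorm2 s by [].
have eU : (ctmx s *m M *m s) 0 0 = q by [].
move: (ctmx s *m s) (ctmx s *m M *m s) eT eU => T U eT eU; rewrite !mxE eT eU.
have -> : - c * vnorm2 s + (- c * vnorm2 s + q) = - 1.
  by rewrite /c; field; rewrite gt_eqF.
by rewrite oppr_ge0 ler10.
Qed.

(** Induction on the dimension in place of an integral of matrix exponentials: a left eigenvector
    makes [A] block triangular, and once [P] is block diagonal each block satisfies its own Lyapunov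
    inequality. *)
Lemma lyapunov_psd n (A P : 'M[K]_n) :
  (forall l, root (char_poly A) l -> 'Re l < 0) -> ctmx P = P ->
  psd (- (A *m P + P *m ctmx A)) -> psd P.
Proof.
elim: n A P => [|n IH] A P st hP hN.
  by move=> v; rewrite [v]flatmx0 mulmx0 mxE.
have [l rl] : exists l, root (char_poly A) l.
  by apply/closed_rootP; rewrite size_char_poly.
have /eigenvalueP[x xA x0] : eigenvalue A l by rewrite eigenvalue_root_char.
have l0 := st l rl.
have [Q [A' [_ [uQ eA eA' _ _]]]] := @left_eigen_block _ n A x l x0 xA.
have := psd_congr Q hN.
pose P' := Q *m P *m ctmx Q.
have -> : Q *m - (A *m P + P *m ctmx A) *m ctmx Q = - (A' *m P' + P' *m ctmx A').
  rewrite mulmxN mulNmx mulmxDr mulmxDl !mulmxA eA -(mulmxA _ (ctmx A)) -ctmxM eA.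
  by rewrite ctmxM !mulmxA.
have hP' : ctmx P' = P' by rewrite /P' !ctmxM ctmxK hP mulmxA.
move=> {}hN; apply: (psd_congr_unit uQ); rewrite -/P'.
have chA : char_poly A = char_poly A' := char_poly_sim uQ eA.
move: P' hP' hN => {P hP}P hP hN.
(* Once [P] is block diagonal, both blocks solve a smaller equation. *)
have diag (B : 'M[K]_(1 + n)) (R : 'M[K]_(1 + n)) al be p M :
    B = block_mx l%:M 0 al (drsubmx A') -> ctmx R = R -> R = block_mx p 0 be M -> be = 0 ->
    psd (- (B *m R + R *m ctmx B)) -> psd R.
  move=> eB hR eR be0 h; rewrite eR be0 in hR *; rewrite ctmx_block in hR.
  have [hp _ _ hM] := eq_block_mx hR.
  have e : - (B *m R + R *m ctmx B) =
    block_mx (- (l + l^*) *: p) (- (p *m ctmx al)) (- (al *m p))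
      (- (drsubmx A' *m M + M *m ctmx (drsubmx A'))).
    rewrite eB eR be0 ctmx_block !mulmx_block !(mulmx0, mul0mx, addr0, add0r, ctmx0).
    rewrite add_block_mx opp_block_mx ctmx_scalar mul_scalar_mx mul_mx_scalar.
    by rewrite addr0 add0r -scalerDl scaleNr.
  rewrite e in h; apply: psd_block_diag.
    have := psd_ulsub h; rewrite block_mxKul => /psd_scalar; rewrite mxE.
    have lr : 0 < - (l + l^*).
      have := l0; rewrite ReE -oppr_gt0 -mulNr pmulr_lgt0 // invr_gt0 ltr0n //.
    by rewrite pmulr_rge0 // => /psd_scalar.
  apply: (IH (drsubmx A')) => //.
    by move=> z rz; apply: st; rewrite chA eA' char_poly_lblock rootM rz orbT.
  by have := psd_drsub h; rewrite block_mxKdr.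
have eP : P = block_mx (ulsubmx P) (ctmx (dlsubmx P)) (dlsubmx P) (drsubmx P).
  rewrite -{1}[P]submxK; congr block_mx.
  by move: hP; rewrite -{1 2}[P]submxK ctmx_block => /eq_block_mx[].
(* A zero corner of [P] is a zero corner of the positive semidefinite matrix, so the column [s]
   below it vanishes; a nonzero [dlsubmx P] would then be an eigenvector of the lower block for
   [- l^*], contradicting stability. *)
have [p0|p0] := eqVneq (ulsubmx P) 0.
  have r0 : dlsubmx P = 0.
    have h := hN; rewrite eA' eP p0 ctmx_block !mulmx_block in h.
    rewrite !(mulmx0, mul0mx, addr0, add0r, ctmx0) add_block_mx opp_block_mx in h.
    rewrite addr0 oppr0 ctmx_scalar mul_scalar_mx mul_mx_scalar in h.
    pose s := - (drsubmx A' *m dlsubmx P + l^* *: dlsubmx P).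
    have s0 : s = 0.
      have es : ctmx s = - (l *: ctmx (dlsubmx P) + ctmx (dlsubmx P) *m ctmx (drsubmx A')).
        by rewrite /s ctmxN ctmxD ctmxM ctmxZ conjCK addrC.
      by apply: psd_diag0; rewrite es; apply: h.
    apply/eqP/negPn/negP => r0.
    have : 'Re (- l^*) < 0.
      apply: st; rewrite chA eA' char_poly_lblock rootM; apply/orP; right.
      rewrite -char_poly_tr -eigenvalue_root_char; apply/eigenvalueP.
      exists (dlsubmx P)^T; last by rewrite -trmx0 (inj_eq trmx_inj).
      move/eqP: s0; rewrite /s oppr_eq0 addr_eq0 => /eqP s0.
      by rewrite -trmx_mul s0 -scaleNr linearZ.
    by rewrite raddfN /= Re_conj oppr_lt0 => /lt_trans/(_ l0); rewrite ltxx.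
  apply: (diag A' P (dlsubmx A') 0 0 (drsubmx P)) => //.
  by rewrite {1}eP p0 r0 ctmx0.
(* A nonzero corner serves as pivot: the congruence by [X] clears the off-diagonal blocks of [P] and
   keeps the state matrix block triangular with the same diagonal blocks. *)
pose X : 'M[K]_(1 + n) := block_mx 1%:M 0 (- (dlsubmx P *m invmx (ulsubmx P))) 1%:M.
have uX : X \in unitmx by rewrite unitmxE det_lblock !det1 mulr1 unitr1.
have up : ulsubmx P \in unitmx.
  rewrite unitmxE [ulsubmx P]mx11_scalar det_scalar1 unitfE.
  by apply: contraNneq p0 => z; rewrite [ulsubmx P]mx11_scalar z raddf0.
have hp : ctmx (ulsubmx P) = ulsubmx P.
  by move: hP; rewrite -{1 2}[P]submxK ctmx_block => /eq_block_mx[].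
apply: (psd_congr_unit uX); set R := X *m P *m ctmx X.
have hR : ctmx R = R by rewrite /R !ctmxM ctmxK hP mulmxA.
have [B eB] : exists B, X *m A' = B *m X by exists (X *m A' *m invmx X); rewrite mulmxKV.
have eB' : B = block_mx l%:M 0 (dlsubmx B) (drsubmx A').
  have := eB; rewrite {1}eA' -{1}[B]submxK /X !mulmx_block.
  rewrite !(mulmx0, mul0mx, mulmx1, mul1mx, addr0, add0r) => /eq_block_mx[e1 e2 e3 e4].
  rewrite -{1}[B]submxK -e2 -e4; congr block_mx.
  by move: e1; rewrite -e2 mul0mx addr0.
apply: (diag B R (dlsubmx B) (dlsubmx R) (ulsubmx R) (drsubmx R)) => //.
- rewrite -{1}[R]submxK; congr block_mx.
  rewrite /R [Y in X *m Y *m _]eP /X ctmx_block !mulmx_block !(mulmx0, mul0mx, mulmx1, mul1mx, addr0, add0r, ctmx0, ctmx1).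
  rewrite block_mxKur ctmxN ctmxM ctmx_inv hp mulmxN mulKVmx // addNr.
  by [].
- rewrite /R [Y in X *m Y *m _]eP /X ctmx_block !mulmx_block !(mulmx0, mul0mx, mulmx1, mul1mx, addr0, add0r, ctmx0, ctmx1).
  by rewrite block_mxKdl mulNmx mulmxKV // addNr.
have := psd_congr X hN.
rewrite mulmxN mulNmx mulmxDr mulmxDl !mulmxA eB -(mulmxA _ (ctmx A')) -ctmxM eB.
by rewrite ctmxM !mulmxA.
Qed.

End Lyapunov.

(** * Limits replaced by polynomials in a real parameter *)

Section RealPolynomialFunctions.
Variable K : numClosedFieldType.

(* Restricting to real arguments makes this class closed under conjugation. *)
Definition poly_fun (f : K -> K) : Prop :=
  exists q : {poly K}, forall e, e \is Num.real -> f e = q.[e].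

Lemma poly_fun_const c : poly_fun (fun=> c).
Proof. by exists c%:P => e _; rewrite hornerC. Qed.

Lemma poly_fun_id : poly_fun id.
Proof. by exists 'X => e _; rewrite hornerX. Qed.

Lemma poly_funD f g : poly_fun f -> poly_fun g -> poly_fun (fun e => f e + g e).
Proof. by move=> [q hq] [r hr]; exists (q + r) => e he; rewrite hornerD hq ?hr. Qed.

Lemma poly_funM f g : poly_fun f -> poly_fun g -> poly_fun (fun e => f e * g e).
Proof. by move=> [q hq] [r hr]; exists (q * r) => e he; rewrite hornerM hq ?hr. Qed.

Lemma poly_fun_conj f : poly_fun f -> poly_fun (fun e => (f e)^*).
Proof.
move=> [q hq]; exists (map_poly Num.conj q) => e he.
by rewrite hq // -{2}(conj_Creal he) horner_map.
Qed.

Lemma poly_funN f : poly_fun f -> poly_fun (fun e => - f e).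
Proof.
by move=> [q hq]; exists (- q) => e he; rewrite hornerN hq.
Qed.

Lemma poly_fun_sum (I : Type) (r : seq I) (P : pred I) (f : I -> K -> K) :
  (forall i, poly_fun (f i)) -> poly_fun (fun e => \sum_(i <- r | P i) f i e).
Proof.
move=> hf; elim: r => [|i r [q hq]]; first by exists 0 => e _; rewrite big_nil horner0.
have [t ht] := hf i; exists (if P i then t + q else q) => e he; rewrite big_cons.
by case: (P i); rewrite ?hornerD hq ?ht.
Qed.

Lemma poly_fun_prod (I : Type) (r : seq I) (P : pred I) (f : I -> K -> K) :
  (forall i, poly_fun (f i)) -> poly_fun (fun e => \prod_(i <- r | P i) f i e).
Proof.
move=> hf; elim: r => [|i r [q hq]]; first by exists 1 => e _; rewrite big_nil hornerC.
have [t ht] := hf i; exists (if P i then t * q else q) => e he; rewrite big_cons.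
by case: (P i); rewrite ?hornerM hq ?ht.
Qed.

Lemma poly_fun_ext f g : (forall e, f e = g e) -> poly_fun f -> poly_fun g.
Proof. by move=> e [q hq]; exists q => t ht; rewrite -e hq. Qed.

Definition poly_mx m n (F : K -> 'M[K]_(m, n)) : Prop :=
  forall i j, poly_fun (fun e => F e i j).

Lemma poly_mx_const m n (M : 'M[K]_(m, n)) : poly_mx (fun=> M).
Proof. by move=> i j; apply: poly_fun_const. Qed.

Lemma poly_mxM m n q (F : K -> 'M[K]_(m, n)) (G : K -> 'M[K]_(n, q)) :
  poly_mx F -> poly_mx G -> poly_mx (fun e => F e *m G e).
Proof.
move=> hF hG i j; apply: (poly_fun_ext (f := fun e => \sum_k F e i k * G e k j)).
  by move=> e; rewrite mxE.
by apply: poly_fun_sum => k; apply: poly_funM.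
Qed.

Lemma poly_mxD m n (F G : K -> 'M[K]_(m, n)) :
  poly_mx F -> poly_mx G -> poly_mx (fun e => F e + G e).
Proof.
move=> hF hG i j; apply: (poly_fun_ext (f := fun e => F e i j + G e i j)).
  by move=> e; rewrite mxE.
exact: poly_funD.
Qed.

Lemma poly_mxZ m n f (F : K -> 'M[K]_(m, n)) :
  poly_fun f -> poly_mx F -> poly_mx (fun e => f e *: F e).
Proof.
move=> hf hF i j; apply: (poly_fun_ext (f := fun e => f e * F e i j)).
  by move=> e; rewrite mxE.
exact: poly_funM.
Qed.

Lemma poly_mx_ctmx m n (F : K -> 'M[K]_(m, n)) :
  poly_mx F -> poly_mx (fun e => ctmx (F e)).
Proof.
move=> hF i j; apply: (poly_fun_ext (f := fun e => (F e j i)^*)).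
  by move=> e; rewrite ctmxE.
exact: poly_fun_conj.
Qed.

Lemma poly_fun_det n (F : K -> 'M[K]_n) : poly_mx F -> poly_fun (fun e => \det (F e)).
Proof.
move=> hF; apply: poly_fun_sum => s; apply: poly_funM; first exact: poly_fun_const.
by apply: poly_fun_prod => i; apply: hF.
Qed.

Lemma poly_mx_adj n (F : K -> 'M[K]_n) : poly_mx F -> poly_mx (fun e => \adj (F e)).
Proof.
move=> hF i j; apply: (poly_fun_ext (f := fun e => cofactor (F e) j i)).
  by move=> e; rewrite mxE.
apply: poly_funM; first exact: poly_fun_const.
apply: poly_fun_det => a b.
by apply: (poly_fun_ext _ (hF (lift j a) (lift i b))) => e; rewrite !mxE.
Qed.

Lemma poly_fun_vnorm2 n (F : K -> 'cV[K]_n) :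
  poly_mx F -> poly_fun (fun e => vnorm2 (F e)).
Proof. by move=> hF; apply: (poly_mxM (poly_mx_ctmx hF) hF). Qed.

Lemma small_avoiding (r : seq K) (d : K) : 0 < d ->
  exists e, [/\ 0 < e, e <= d & e \notin r].
Proof.
move=> d0; pose s := [seq d / (i.+1)%:R | i <- iota 0 (size r).+1].
have us : uniq s.
  rewrite map_inj_uniq ?iota_uniq // => i j /(mulfI (lt0r_neq0 d0))/invr_inj/eqP.
  by rewrite eqr_nat => /eqP[].
have /allPn[e /mapP[i _ ->] er] : ~~ all (mem r) s.
  apply/negP => /allP h; have := uniq_leq_size us h.
  by rewrite size_map size_iota ltnn.
exists (d / i.+1%:R); split=> //; first by rewrite divr_gt0 ?ltr0n.
by rewrite ler_pdivrMr ?ltr0n // ler_peMr ?ler1n // ltW.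
Qed.

Lemma small_eq0 (y M : K) :
  (forall d, 0 < d -> exists e, [/\ 0 < e, e <= d & `|y| <= M * e]) -> y = 0.
Proof.
move=> h; apply/eqP/negPn/negP => y0; have y1 : 0 < `|y| by rewrite normr_gt0.
have M0 : 0 <= M.
  have [e [e0 _ he]] := h 1 ltr01.
  by rewrite -(pmulr_lge0 _ e0); apply: le_trans he.
have M1 : 0 < M + 1 by rewrite ltr_wpDl.
have [e [e0 ed he]] := h (`|y| / (M + 1)) (divr_gt0 y1 M1).
have := le_lt_trans he (_ : M * e < `|y|); rewrite ltxx => /(_ _)/negP; apply=> //.
apply: le_lt_trans (_ : M * (`|y| / (M + 1)) < _); first by rewrite ler_wpM2l.
by rewrite mulrA ltr_pdivrMr // mulrC ltr_pM2l // ltrDl.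
Qed.

Lemma horner_bounded (q : {poly K}) e : 0 <= e -> e <= 1 ->
  `|q.[e]| <= \sum_(i < size q) `|q`_i|.
Proof.
move=> e0 e1; rewrite horner_coef; apply: le_trans (ler_norm_sum _ _ _) _.
apply: ler_sum => i _; rewrite normrM ler_piMr // normrX ger0_norm //.
by rewrite exprn_ile1.
Qed.

(** At small good points [q.[e]] equals its norm and is within [M * e] of [q.[0]]. Hence the norm of
    [q.[0]] differs from [q.[0]] by at most [(M + M) * e], so they are equal, which gives reality
    and sign at once. *)
Lemma poly_fun_ge0 f (r : seq K) : poly_fun f ->
  (forall e, 0 < e -> e <= 1 -> e \notin r -> 0 <= f e) -> 0 <= f 0.
Proof.
move=> [q hq] h.
have [q1 eq] : exists q1, q = (q.[0])%:P + 'X * q1.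
  have /factor_theorem[q1 e] : root (q - (q.[0])%:P) 0 by rewrite /root !hornerE subrr.
  by exists q1; rewrite mulrC -[X in _ + _ * X]subr0 -polyC0 -e addrC subrK.
pose M := \sum_(i < size q1) `|q1`_i|.
rewrite hq ?real0 //; suff : `|q.[0]| - q.[0] = 0.
  by move/eqP; rewrite subr_eq0 => /eqP <-.
apply: (@small_eq0 _ (M + M)) => d d0.
have d1 : 0 < d + 1 by rewrite addr_gt0.
have [e [e0 ed er]] := small_avoiding r (divr_gt0 d0 d1).
have e1 : e <= 1.
  by apply: le_trans ed _; rewrite ler_pdivrMr // mul1r lerDl ler01.
have e2 : e <= d.
  by apply: le_trans ed _; rewrite ler_pdivrMr //; apply: ler_peMr; rewrite ?lerDr ltW.
exists e; split=> //.
have er' : e \is Num.real by rewrite gtr0_real.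
have qe : `|q.[e]| = q.[e] by rewrite ger0_norm // -hq // h.
have qd : `|q.[e] - q.[0]| <= M * e.
  rewrite {1}eq !hornerE addrAC subrr add0r normrM gtr0_norm // mulrC.
  by rewrite ler_pM2r //; apply: horner_bounded => //; apply: ltW.
have -> : `|q.[0]| - q.[0] = (`|q.[0]| - `|q.[e]|) + (q.[e] - q.[0]).
  by rewrite qe addrA subrK.
apply: le_trans (ler_normD _ _) _; rewrite mulrDl; apply: lerD => //.
by apply: le_trans (ler_dist_dist _ _) _; rewrite distrC.
Qed.

End RealPolynomialFunctions.

Section Schur.
Variable K : numClosedFieldType.

Lemma schur_entry p m (S : 'M[K]_(p, m)) i j :
  loewner_le (S *m ctmx S) 1%:M -> `|S i j| <= 1.
Proof.
move=> /(_ (delta_mx i 0)); rewrite mulmxBr mulmxBl mulmx1.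
have -> : ctmx (delta_mx i 0 : 'cV[K]_p) = delta_mx 0 i.
  by apply/matrixP => a b; rewrite ctmxE !mxE conjC_nat andbC.
rewrite mul_delta_mx -rowE -colE !mxE subr_ge0 => h.
rewrite -(expr_le1 (_ : 0 < 2)%N) //; apply: le_trans h.
rewrite (bigD1 j) //= ctmxE -normCK lerDl sumr_ge0 // => k _.
by rewrite ctmxE -normCK exprn_ge0.
Qed.

(** Boundedness on the segment to the right of [z]. The class is closed under sums and under [A],
    and for a Schur function with [z] in the closed right half plane it contains the range of
    [B]. *)
Definition resolvent_bounded n p (A : 'M[K]_n) (C : 'M[K]_(p, n)) z (u : 'cV[K]_n) :=
  exists M, forall e, 0 < e -> e <= 1 -> (z + e)%:M - A \in unitmx ->
    forall i, `|(C *m invmx ((z + e)%:M - A) *m u) i 0| <= M.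

Lemma resolvent_boundedD n p (A : 'M[K]_n) (C : 'M[K]_(p, n)) z u v :
  resolvent_bounded A C z u -> resolvent_bounded A C z v ->
  resolvent_bounded A C z (u + v).
Proof.
move=> [M hM] [N hN]; exists (M + N) => e e0 e1 ue i; rewrite mulmxDr mxE.
by apply: le_trans (ler_normD _ _) _; rewrite lerD ?hM ?hN.
Qed.

Lemma resolvent_bounded_mul n p (A : 'M[K]_n) (C : 'M[K]_(p, n)) z u :
  resolvent_bounded A C z u -> resolvent_bounded A C z (A *m u).
Proof.
move=> [M hM]; exists ((`|z| + 1) * M + \sum_i `|(C *m u) i 0|) => e e0 e1 ue i.
have -> : C *m invmx ((z + e)%:M - A) *m (A *m u) =
    (z + e) *: (C *m invmx ((z + e)%:M - A) *m u) - C *m u.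
  have eA : A = (z + e)%:M - ((z + e)%:M - A) by rewrite subKr.
  rewrite {2}eA mulmxBl mulmxBr mul_scalar_mx -scalemxAr; congr (_ - _).
  by rewrite -!mulmxA mulKmx.
have := hM e e0 e1 ue i; move: (C *m _ *m u) (C *m u) => T U h; rewrite !mxE.
apply: le_trans (ler_normB _ _) _; apply: lerD; last first.
  by rewrite (bigD1 i) //= lerDl sumr_ge0.
rewrite normrM ler_pM //.
by apply: le_trans (ler_normD _ _) _; rewrite lerD2l gtr0_norm.
Qed.

(* A right eigenvector [v] for [z] is reachable, so [C (s - A)^-1 v = (s - z)^-1 C v] stays
   bounded as [s] tends to [z] from the right. *)
Lemma schur_stable p m (R : realization K p m) : pbh_minimal R -> schur R ->
  forall z, root (char_poly (rA R)) z -> 'Re z < 0.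
Proof.
move=> [cR oR] sR z rz; rewrite real_ltNge ?real0 ?Creal_Re //; apply/negP => z0.
have /eigenvalueP[vt vA v0] : eigenvalue (rA R)^T z.
  by rewrite eigenvalue_root_char char_poly_tr.
pose v := vt^T; have Av : rA R *m v = z *: v.
  by rewrite -[rA R]trmxK -trmx_mul vA linearZ.
suff Cv : rC R *m v = 0.
  by have := oR v z Av Cv => /eqP; rewrite -trmx0 (inj_eq trmx_inj) (negbTE v0).
have bB w : resolvent_bounded (rA R) (rC R) z (rB R *m w).
  exists (\sum_i \sum_j (1 + `|rD R i j|) * `|w j 0|) => e e0 e1 ue i.
  have rs : regular R (z + e) by rewrite /regular regular_unit.
  have re : 0 < 'Re (z + e).
    by rewrite raddfD /= ltr_wpDl // (Creal_ReP _ _) ?gtr0_real.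
  rewrite mulmxA (_ : _ *m rB R = tf R (z + e) - rD R); last by rewrite /tf addrK.
  rewrite mxE; apply: le_trans (ler_norm_sum _ _ _) _.
  rewrite (bigD1 i) //= -[X in X <= _]addr0; apply: lerD; last first.
    by rewrite !sumr_ge0 // => k _; rewrite sumr_ge0 // => l _; rewrite mulr_ge0 ?addr_ge0.
  apply: ler_sum => j _; rewrite normrM ler_wpM2r // mxE [(- rD R) i j]mxE.
  apply: le_trans (ler_normB _ _) _; rewrite lerD2r.
  by have := schur_entry i j (sR _ re rs).
have bv : resolvent_bounded (rA R) (rC R) z v.
  pose X := \mxrow_(i < rdim R) (rA R ^+ i *m rB R).
  have /row_freeP[Y XY] : row_free X.
    apply: inj_row_free => y yX; apply: kalman_controllable_row cR _ => i lti.
    move: yX; rewrite mul_mxrow -[RHS]mxrow0 => /eq_mxrowP/(_ (Ordinal lti)) /=.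
    by rewrite mulmxA.
  rewrite -[v]mul1mx -XY -mulmxA -[Y *m v]submxcolK mul_mxrow_mxcol.
  apply: (big_ind (resolvent_bounded (rA R) (rC R) z)) => [|x y|i _].
  - by exists 0 => e *; rewrite mulmx0 mxE normr0.
  - exact: resolvent_boundedD.
  elim: (nat_of_ord i) => [|k IH]; first by rewrite expr0 mul1mx.
  by rewrite exprS -!mulmxA; apply: resolvent_bounded_mul; rewrite mulmxA.
have [M hM] := bv; have [rs ers] := closed_field_poly_normal (char_poly (rA R)).
apply/colP => i; rewrite [RHS]mxE; apply: (@small_eq0 _ _ M) => d d0.
have d1 : 0 < d + 1 by rewrite addr_gt0.
have [e [e0 ed er]] := small_avoiding [seq x - z | x <- rs] (divr_gt0 d0 d1).
have e1 : e <= 1.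
  by apply: le_trans ed _; rewrite ler_pdivrMr // mul1r lerDl ler01.
have e2 : e <= d.
  by apply: le_trans ed _; rewrite ler_pdivrMr //; apply: ler_peMr; rewrite ?lerDr ltW.
exists e; split=> //.
have ue : (z + e)%:M - rA R \in unitmx.
  rewrite -regular_unit ers (monicP (char_poly_monic _)) scale1r root_prod_XsubC.
  by apply: contra er => h; apply/mapP; exists (z + e); rewrite // addrC addKr.
have := hM e e0 e1 ue i.
rewrite -mulmxA (@invmx_solve _ _ _ _ (e^-1 *: v)) //; last first.
  rewrite mulmxBl mul_scalar_mx -scalemxAr Av !scalerA -scalerBl mulrDl mulfV ?gt_eqF //.
  by rewrite [e^-1 * z]mulrC addrAC subrr add0r scale1r.
by rewrite -scalemxAr mxE normrM normfV (gtr0_norm e0) mulrC ler_pdivrMr.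
Qed.

End Schur.

Section FrequencyDomain.
Variable K : numClosedFieldType.
Local Notation conjm := (map_mx (@Num.conj K)).

Lemma imag_conj (s : K) : 'Re s = 0 -> s^* = - s.
Proof.
rewrite ReE => /eqP; rewrite mulf_eq0 invr_eq0 pnatr_eq0 orbF addrC addr_eq0.
by move/eqP.
Qed.

Lemma mxB00 (X Y : 'M[K]_1) : (X - Y) 0 0 = X 0 0 - Y 0 0.
Proof. by rewrite !mxE. Qed.

Lemma mxD00 (X Y : 'M[K]_1) : (X + Y) 0 0 = X 0 0 + Y 0 0.
Proof. by rewrite !mxE. Qed.

Lemma mxN00 (X : 'M[K]_1) : (- X) 0 0 = - X 0 0.
Proof. by rewrite mxE. Qed.

(** For symmetric [S], conjugating [S S^* <= 1] gives [S^* S <= 1], the form that bounds outputs by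
    inputs. *)
Lemma symmetric_contraction p (S : 'M[K]_p) (u : 'cV[K]_p) : S^T = S ->
  loewner_le (S *m ctmx S) 1%:M -> vnorm2 (S *m u) <= vnorm2 u.
Proof.
move=> sS /(_ (conjm u)); set E := _ *m _ *m _ => E0.
have cS : conjm S = ctmx S by rewrite /ctmx conj_mx_tr sS.
have eE : conjm E = ctmx u *m u - ctmx (S *m u) *m (S *m u).
  rewrite /E !conj_mxM conj_mxK conj_mxD conj_mxN conj_mxM conj_mx1 cS.
  have -> : conjm (ctmx S) = S by rewrite -cS conj_mxK.
  have -> : conjm (ctmx (conjm u)) = ctmx u by rewrite /ctmx conj_mxK conj_mx_tr.
  by rewrite mulmxBr mulmxBl mulmx1 ctmxM !mulmxA.
have : 0 <= (conjm E) 0 0 by rewrite mxE conjC_ge0.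
by rewrite eE mxB00 subr_ge0.
Qed.

Lemma vnorm2Z n (c : K) (v : 'cV[K]_n) : vnorm2 (c *: v) = `|c| ^+ 2 * vnorm2 v.
Proof. by rewrite !vnorm2E mulr_sumr; apply: eq_bigr => i _; rewrite mxE normrM exprMn. Qed.

Lemma adj_unit n (M : 'M[K]_n) : M \in unitmx -> \adj M = \det M *: invmx M.
Proof.
move=> uM; rewrite /invmx uM scalerA divff ?scale1r //.
by rewrite -unitfE -unitmxE.
Qed.

(** Multiplied by the squared norm of [\det (M e)], the inequality at [s + e] becomes polynomial in
    [e]; it passes to [e = 0], where the determinant is nonzero. *)
Lemma schur_axis p (R : realization K p p) : schur R ->
  (forall s, regular R s -> (tf R s)^T = tf R s) ->
  forall s (u : 'cV[K]_p), 'Re s = 0 -> regular R s -> vnorm2 (tf R s *m u) <= vnorm2 u.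
Proof.
move=> sR symR s u s0 rs.
pose M e := (s + e)%:M - rA R.
pose N e := rC R *m \adj (M e) *m rB R + \det (M e) *: rD R.
have eN e : M e \in unitmx -> N e = \det (M e) *: tf R (s + e).
  by move=> ue; rewrite /N adj_unit // /tf scalerDr -scalemxAr -scalemxAl.
pose f e := \det (M e) * (\det (M e))^* * vnorm2 u - vnorm2 (N e *m u).
have ef e : M e \in unitmx ->
    f e = `|\det (M e)| ^+ 2 * (vnorm2 u - vnorm2 (tf R (s + e) *m u)).
  by move=> ue; rewrite /f eN // -scalemxAl vnorm2Z -normCK mulrBr.
have pM : poly_mx M.
  move=> i j; apply: (poly_fun_ext (f := fun e => (s + e) *+ (i == j) - rA R i j)).
    by move=> e; rewrite !mxE.
  apply: poly_funD; last exact: poly_fun_const.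
  apply: (poly_fun_ext (f := fun e => (s + e) * (i == j)%:R)).
    by move=> e; rewrite mulr_natr.
  apply: poly_funM (poly_fun_const _); apply: poly_funD (@poly_fun_id K).
  exact: poly_fun_const.
have pf : poly_fun f.
  apply: poly_funD.
    apply: poly_funM (poly_fun_const _); apply: poly_funM; first exact: poly_fun_det.
    by apply: poly_fun_conj; apply: poly_fun_det.
  apply/poly_funN/poly_fun_vnorm2/poly_mxM; last exact: poly_mx_const.
  apply: poly_mxD.
    by apply: poly_mxM (poly_mx_const _); apply: poly_mxM (poly_mx_adj pM); apply: poly_mx_const.
  by apply: poly_mxZ (poly_mx_const _); apply: poly_fun_det.
have [rt ert] := closed_field_poly_normal (char_poly (rA R)).
have := @poly_fun_ge0 _ f [seq x - s | x <- rt] pf.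
have u0 : M 0 \in unitmx by rewrite /M addr0 -regular_unit.
rewrite ef // addr0 pmulr_rge0; last first.
  by rewrite exprn_gt0 // normr_gt0 -unitfE -unitmxE.
rewrite subr_ge0; apply => e e0 _ er.
have re : regular R (s + e).
  rewrite /regular ert (monicP (char_poly_monic _)) scale1r root_prod_XsubC.
  by apply: contra er => h; apply/mapP; exists (s + e); rewrite // addrC addKr.
have ue : M e \in unitmx by rewrite /M -regular_unit.
rewrite ef // mulr_ge0 ?exprn_ge0 // subr_ge0.
apply: symmetric_contraction (symR _ re) (sR _ _ re).
by rewrite raddfD /= s0 add0r (Creal_ReP _ _) ?gtr0_real.
Qed.

(* The difference of the two sides is
   [|b^* w1 + u0|^2 - |c (w2 - x0)|^2 + |c x0|^2]. *)
Lemma hamiltonian_bound n p (a : 'M[K]_n) (b : 'M[K]_(n, p)) (c : 'M[K]_(p, n)) s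
    (w1 w2 x0 : 'cV[K]_n) (u0 : 'cV[K]_p) z1 z2 :
  s^* = - s ->
  (forall (x : 'cV[K]_n) (u : 'cV[K]_p), (s%:M - a) *m x = b *m u -> vnorm2 (c *m x) <= vnorm2 u) ->
  (s%:M + ctmx a) *m w1 + ctmx c *m c *m w2 = z1 ->
  - (b *m ctmx b) *m w1 + (s%:M - a) *m w2 = z2 ->
  (s%:M - a) *m x0 + b *m u0 = z2 ->
  (ctmx z1 *m w2 - ctmx z2 *m w1) 0 0 <=
  vnorm2 u0 + (ctmx x0 *m z1 + ctmx z1 *m x0) 0 0.
Proof.
move=> cs fdi e1 e2 e3.
pose al := ctmx b *m w1; pose g := c *m w2; pose g0 := c *m x0.
have f2 : (s%:M - a) *m w2 = z2 + b *m al.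
  by rewrite -e2 /al mulNmx addrAC !mulmxA addNr add0r.
have f3 : (s%:M - a) *m x0 = z2 - b *m u0 by rewrite -e3 addrK.
have cf1 : ctmx w1 *m (s%:M - a) = ctmx (c *m w2) *m c - ctmx z1.
  have e : ctmx (s%:M + ctmx a) = - (s%:M - a).
    by rewrite ctmxD ctmx_scalar ctmxK cs raddfN opprB addrC.
  rewrite -e1 ctmxD (ctmxM _ w1) e (ctmxM _ w2) !ctmxM ctmxK mulmxN opprD opprK !mulmxA.
  by rewrite addrCA subrr addr0.
(* The frequency inequality is applied to the state [w2 - x0], driven by the input [b^* w1 + u0]. *)
have f4 : (s%:M - a) *m (w2 - x0) = b *m (al + u0).
  by rewrite mulmxBr f2 f3 mulmxDr opprB addrC addrA subrK addrC.
have := fdi _ _ f4; rewrite -subr_ge0 => le.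
have q1 : ctmx z1 *m w2 = ctmx g *m g - ctmx w1 *m z2 - ctmx al *m al.
  rewrite /g [in RHS]ctmxM.
  have : ctmx z1 = ctmx (c *m w2) *m c - ctmx w1 *m (s%:M - a) by rewrite cf1 subKr.
  move=> ->; rewrite mulmxBl -[_ *m _ *m w2 in X in _ - X]mulmxA f2 mulmxDr opprD !addrA.
  by rewrite [ctmx al]ctmxM ctmxK ctmxM !mulmxA.
have q2 : ctmx w1 *m z2 = ctmx g *m g0 - ctmx z1 *m x0 + ctmx al *m u0.
  rewrite -e3 mulmxDr !mulmxA cf1 mulmxBl [ctmx al]ctmxM ctmxK /g /g0.
  by rewrite ?mulmxA.
have q3 : ctmx z2 *m w1 = ctmx g0 *m g - ctmx x0 *m z1 + ctmx u0 *m al.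
  have := congr1 (@ctmx K _ _) q2; rewrite !ctmxD ctmxN !ctmxM !ctmxK => ->.
  by [].
rewrite q1 q2 q3 -subr_ge0; apply: le_trans le _.
rewrite -subr_ge0; apply: le_trans (vnorm2_ge0 g0) _; rewrite le_eqVlt; apply/orP; left.
rewrite mulmxBr -/g -/g0 /vnorm2 !ctmxD ctmxN !mulmxDl !mulmxDr !mulNmx !mulmxN.
by rewrite !(mxD00, mxN00); apply/eqP; ring.
Qed.

(** First-order perturbation along the axis: at [s = l + t e], in [hamiltonian_bound], the left side
    is of first order in [e] with coefficient governed by [rho], the right side of second order.
    Dividing by [e] and passing to [e = 0] gives [0 <= 'i * sg * rho 0 0] for both signs [sg], hence
    [rho = 0]. *)
Lemma hamiltonian_neutral n p (a : 'M[K]_n) (b : 'M[K]_(n, p)) : a^T = a ->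
  (forall s, 'Re s = 0 -> forall (x : 'cV[K]_n) (u : 'cV[K]_p),
     (s%:M - a) *m x = b *m u -> vnorm2 (b^T *m x) <= vnorm2 u) ->
  (forall (y : 'rV[K]_n) l, 'Re l = 0 -> y *m a = l *: y -> y *m b = 0 -> y = 0) ->
  imaginary_neutral (hamiltonian a b b^T)^T (krein_form K n) (krein_swap K n).
Proof.
move=> sa fdi ctr m L v l iL vL vh l0; have kr := hamiltonian_krein b sa.
set H := hamiltonian a b b^T in kr iL vh; set F := krein_form K n in kr iL vL *.
set Sg := krein_swap K n in kr iL *.
set rho := conjm v *m Sg *m F *m v^T.
have cl := imag_conj l0.
pose V1 := (lsubmx v)^T; pose V2 := (rsubmx v)^T.
(* Controllability of the modes on the axis makes this block row right invertible. *)
have [R0 eR0] : exists R0, row_mx (l%:M - a) b *m R0 = 1%:M.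
  apply/row_freeP; apply: inj_row_free => y; rewrite mul_mx_row -row_mx0.
  move=> /eq_row_mx[e1 e2]; apply: (ctr y l l0) => //.
  by move/eqP: e1; rewrite mulmxBr mul_mx_scalar subr_eq0 => /eqP.
pose X := usubmx R0; pose W := dsubmx R0.
have XW : (l%:M - a) *m X + b *m W = 1%:M.
  by rewrite -mul_row_col vsubmxK.
have [rt ert] := closed_field_poly_normal (char_poly H^T).
have side sg : sg^* = sg -> sg * sg = 1 -> 0 <= 'i * sg * rho 0 0.
  move=> csg sg1; pose t e : K := 'i * sg * e.
  (* At the perturbed point [(s - a) X + b W = M e], so inverting [M e] yields [x0] and [u0] of
     first order in [e], making the right side quadratic. *)
  pose M e := 1%:M + t e *: X; pose Dt e := \det (M e).
  (* [adj] instead of the inverse keeps everything polynomial in [e]. *)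
  pose eta e := \adj (M e) *m V2.
  pose g e := vnorm2 (W *m eta e) + (ctmx (X *m eta e) *m (Dt e *: V1)
     + ctmx (Dt e *: V1) *m (X *m eta e)) 0 0.
  pose f e := e * g e + 'i * sg * rho 0 0 * (Dt e * (Dt e)^*).
  have pt : poly_fun t by apply: poly_funM (poly_fun_const _) (@poly_fun_id K).
  have pM : poly_mx M.
    by apply: poly_mxD (poly_mx_const _) _; apply: poly_mxZ pt (poly_mx_const _).
  have pD : poly_fun Dt by apply: poly_fun_det.
  have peta : poly_mx eta by apply: poly_mxM (poly_mx_adj pM) (poly_mx_const _).
  have pX : poly_mx (fun e => X *m eta e) by apply: poly_mxM (poly_mx_const _) peta.
  have pV : poly_mx (fun e => Dt e *: V1) by apply: poly_mxZ pD (poly_mx_const _).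
  have pf : poly_fun f.
    apply: poly_funD; last first.
      by apply: poly_funM (poly_fun_const _) _; apply: poly_funM pD (poly_fun_conj pD).
    apply: poly_funM (@poly_fun_id K) _; apply: poly_funD.
      by apply: poly_fun_vnorm2; apply: poly_mxM (poly_mx_const _) peta.
    by apply: (poly_mxD (poly_mxM (poly_mx_ctmx pX) pV) (poly_mxM (poly_mx_ctmx pV) pX)).
  have -> : 'i * sg * rho 0 0 = f 0.
    by rewrite /f /Dt /M /t mul0r add0r mulr0 scale0r addr0 det1 conjC1 !mulr1.
  apply: (@poly_fun_ge0 _ f [seq (x - l) / ('i * sg) | x <- rt] pf) => e e0 _ er.
  have sg0 : sg != 0 by apply: contra_eq_neq sg1 => ->; rewrite mul0r eq_sym oner_neq0.
  have isg0 : 'i * sg != 0 by rewrite mulf_neq0 ?neq0Ci.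
  have ce : e^* = e by rewrite conj_Creal // gtr0_real.
  have ct : (t e)^* = - t e by rewrite /t !rmorphM /= conjCi csg ce !mulNr.
  pose s := l + t e.
  have cs : s^* = - s by rewrite /s rmorphD /= cl ct opprD.
  have s0 : 'Re s = 0 by rewrite ReE cs subrr mul0r.
  have us : s%:M - H^T \in unitmx.
    rewrite -regular_unit ert (monicP (char_poly_monic _)) scale1r root_prod_XsubC.
    apply: contra er => h; apply/mapP; exists s => //.
    by rewrite /s addrC addKr /t mulrAC divff // mul1r.
  have [/submxP[Z eZ] LS LF] := iL.
  (* [s - H^T] is injective and preserves the row space of [L], hence maps it onto itself; the error
     of the quotient eigenvector is corrected inside [L]. *)
  have [z ez] : exists z, z *m L *m (s%:M - H^T) = v *m H^T - l *: v.
    have /submxP[y ey] := vh.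
    have /submxP[N eN] : (L <= L *m (s%:M - H^T))%MS.
      have sub : (L *m (s%:M - H^T) <= L)%MS.
        by rewrite mulmxBr mul_mx_scalar addmx_sub ?scalemx_sub // eqmx_opp eZ submxMl.
      have := mxrank_leqif_eq sub; rewrite mxrankMfree ?row_free_unit // => -[_ /esym].
      by rewrite eqxx => /eqmxP <-.
    by exists (y *m N); rewrite ey {2}eN !mulmxA.
  pose w := v + z *m L.
  have ws : w *m (s%:M - H^T) = t e *: v.
    rewrite mulmxDl ez mulmxBr mul_mx_scalar /s scalerDl.
    by rewrite addrA subrK addrC addKr.
  have wrho : conjm v *m Sg *m F *m w^T = rho.
    rewrite /w linearD /= mulmxDr trmx_mul mulmxA -/rho.
    by rewrite (conj_orth kr iL vL) mul0mx addr0.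
  pose W1 := (lsubmx w)^T; pose W2 := (rsubmx w)^T.
  have ew : (s%:M - H) *m col_mx W1 W2 = t e *: col_mx V1 V2.
    rewrite -!tr_row_mx !hsubmxK -[in LHS](trmxK (s%:M - H)) -trmx_mul.
    by rewrite linearB /= tr_scalar_mx ws linearZ.
  move: ew; rewrite /H /hamiltonian scalar_mx_block opp_block_mx add_block_mx !opprK !add0r.
  rewrite mul_block_col scale_col_mx => /eq_col_mx[ew1 ew2].
  have eE : M e *m eta e = Dt e *: V2 by rewrite mulmxA mul_mx_adj mul_scalar_mx.
  have ex0 : (s%:M - a) *m (t e *: (X *m eta e)) + b *m (t e *: (W *m eta e)) =
      t e *: (Dt e *: V2).
    rewrite -eE -!scalemxAr -scalerDr; congr (_ *: _).
    rewrite !mulmxA -!mulmxDl /M /s; congr (_ *m _ *m _).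
    by rewrite raddfD /= addrAC mulmxDl mul_scalar_mx addrAC XW.
  have swapZ (U : 'cV[K]_n) : Dt e *: (t e *: U) = t e *: (Dt e *: U).
    by rewrite !scalerA mulrC.
  have e1 : (s%:M + ctmx a) *m (Dt e *: W1) + ctmx b^T *m b^T *m (Dt e *: W2) =
      t e *: (Dt e *: V1) by rewrite -!scalemxAr -scalerDr ew1 swapZ.
  have e2 : - (b *m ctmx b) *m (Dt e *: W1) + (s%:M - a) *m (Dt e *: W2) =
      t e *: (Dt e *: V2) by rewrite -!scalemxAr -scalerDr ew2 swapZ.
  have le := hamiltonian_bound cs (fdi s s0) e1 e2 ex0.
  have eL : ctmx (t e *: (Dt e *: V1)) *m (Dt e *: W2) - ctmx (t e *: (Dt e *: V2)) *m (Dt e *: W1)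
      = (- t e * (Dt e * (Dt e)^*)) *: rho.
    rewrite -wrho !ctmxZ ct -!scalemxAl -!scalemxAr -!scalerBr !scalerA mulrA mulrAC.
    congr (_ *: _).
    rewrite -{1}[v]hsubmxK -{1}[w]hsubmxK map_row_mx /Sg /F /krein_swap /krein_form.
    rewrite !mul_row_block !(mulmx0, mulmx1, addr0, add0r) mulmxN mulmx1 tr_row_mx mul_row_col.
    by rewrite /ctmx !conj_mx_tr !trmxK mulNmx addrC.
  rewrite eL [X in X <= _]mxE vnorm2Z in le.
  have ett : - t e * t e = e ^+ 2.
    have -> : - t e * t e = - ('i ^+ 2 * (sg * sg) * e ^+ 2) by rewrite /t; ring.
    by rewrite sqrCi sg1 mulr1 mulN1r opprK.
  have eR : (ctmx (t e *: (X *m eta e)) *m (t e *: (Dt e *: V1)) +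
      ctmx (t e *: (Dt e *: V1)) *m (t e *: (X *m eta e))) =
      e ^+ 2 *: (ctmx (X *m eta e) *m (Dt e *: V1) + ctmx (Dt e *: V1) *m (X *m eta e)).
    rewrite -ett scalerDr [ctmx (t e *: (X *m _))]ctmxZ [ctmx (t e *: (Dt e *: _))]ctmxZ ct.
    by rewrite -!scalemxAl -!scalemxAr !scalerA !mulrA.
  rewrite eR [X in _ <= _ + X]mxE normCK ct mulrN -mulNr ett -mulrDr -/(g e) in le.
  rewrite -(pmulr_rge0 _ e0); rewrite -subr_ge0 in le; apply: le_trans le _.
  rewrite le_eqVlt; apply/orP; left; apply/eqP; rewrite /f.
  by move: (g e) (rho 0 0) (Dt e) => G r D; rewrite /t; ring.
have s1 := side 1 (conjC1 _) (mulr1 _).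
have s2 := side (-1) (rmorphN1 _) (etrans (mulrNN _ _) (mulr1 _)).
have : 'i * rho 0 0 = 0.
  apply/eqP; rewrite eq_le -[X in X && _]oppr_ge0.
  by move: s1 s2; rewrite mulrN1 mulNr mulr1 => -> ->.
move/eqP; rewrite mulf_eq0 (negbTE (neq0Ci _)) /= => /eqP r0.
by rewrite [rho]mx11_scalar r0 raddf0.
Qed.

End FrequencyDomain.

(** * Construction of the extension *)

Section InnerExtension.
Variable K : numClosedFieldType.
Local Notation conjm := (map_mx (@Num.conj K)).

(** The energy balance of a lossless system; [s + s^*] is twice the real part of [s], so the sign of
    [P] governs contractivity and the defect vanishes on the axis. *)
Lemma lossless_identity p (E : realization K p p) (P : 'M[K]_(rdim E)) s : ctmx P = P ->
  rA E *m P + P *m ctmx (rA E) + rB E *m ctmx (rB E) = 0 ->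
  P *m ctmx (rC E) + rB E *m ctmx (rD E) = 0 ->
  rD E *m ctmx (rD E) = 1%:M -> regular E s ->
  1%:M - tf E s *m ctmx (tf E s) =
  (s + s^*) *: ((rC E *m invmx (s%:M - rA E)) *m P *m ctmx (rC E *m invmx (s%:M - rA E))).
Proof.
move=> hP e1 e2 e3; rewrite /regular regular_unit /tf.
move: (rA E) (rB E) (rC E) (rD E) P hP e1 e2 e3 => A B C D P hP e1 e2 e3 us.
set X := invmx _.
have BD : B *m ctmx D = - (P *m ctmx C) by apply/eqP; rewrite -addr_eq0 addrC e2.
have DB : D *m ctmx B = - (C *m P).
  by have := congr1 (@ctmx K _ _) BD; rewrite ctmxN !ctmxM !ctmxK hP.
have BB : B *m ctmx B = (s%:M - A) *m P + P *m ctmx (s%:M - A) - (s + s^*) *: P.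
  move/eqP: e1; rewrite addrC addr_eq0 => /eqP ->.
  rewrite ctmxB ctmx_scalar mulmxBl mulmxBr mul_scalar_mx mul_mx_scalar scalerDl !opprD.
  move: (s *: P) (s^* *: P) (A *m P) (P *m ctmx A) => x y z t.
  by apply/matrixP => i j; rewrite !mxE; ring.
have XC : ctmx (s%:M - A) *m ctmx X = 1%:M by rewrite -ctmxM mulVmx // ctmx1.
have XY : X *m (s%:M - A) = 1%:M by rewrite mulVmx.
have CXB : C *m X *m B *m ctmx B *m ctmx X *m ctmx C =
    C *m P *m ctmx X *m ctmx C + C *m X *m P *m ctmx C
    - (s + s^*) *: (C *m X *m P *m ctmx X *m ctmx C).
  move: (s%:M - A) (ctmx X) BB XC XY => Y Xs BB XC XY.
  rewrite -(mulmxA _ B) BB mulmxBr mulmxDr !mulmxBl !mulmxDl -scalemxAr -!scalemxAl.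
  rewrite !mulmxA -(mulmxA C X Y) XY mulmx1 -(mulmxA _ (ctmx Y) Xs) XC mulmx1.
  by [].
rewrite ctmxD !ctmxM mulmxDl !mulmxDr e3.
have -> : C *m X *m B *m ctmx D = - (C *m X *m P *m ctmx C).
  by rewrite -mulmxA BD mulmxN !mulmxA.
have -> : D *m (ctmx B *m (ctmx X *m ctmx C)) = - (C *m P *m ctmx X *m ctmx C).
  by rewrite mulmxA DB mulNmx !mulmxA.
rewrite !mulmxA CXB; move: (C *m P *m _ *m _) (C *m X *m P *m ctmx C) => x y.
by rewrite -!mulmxA; move: (_ *: _) => z; apply/matrixP => i j; rewrite !mxE; ring.
Qed.

Lemma psdZ n (c : K) (M : 'M[K]_n) : 0 <= c -> psd M -> psd (c *: M).
Proof. by move=> c0 h v; rewrite -scalemxAr -scalemxAl mxE mulr_ge0. Qed.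

Lemma psd_gram m n (M : 'M[K]_(m, n)) : psd (M *m ctmx M).
Proof.
move=> v; have := vnorm2_ge0 (ctmx M *m v).
by rewrite /vnorm2 ctmxM ctmxK !mulmxA.
Qed.

Lemma lossless_inner p (E : realization K p p) (P : 'M[K]_(rdim E)) : ctmx P = P ->
  (forall l, root (char_poly (rA E)) l -> 'Re l < 0) ->
  rA E *m P + P *m ctmx (rA E) + rB E *m ctmx (rB E) = 0 ->
  P *m ctmx (rC E) + rB E *m ctmx (rD E) = 0 ->
  rD E *m ctmx (rD E) = 1%:M -> inner E.
Proof.
move=> hP st e1 e2 e3; have id s rs := lossless_identity (s := s) hP e1 e2 e3 rs.
have pP : psd P.
  apply: lyapunov_psd st hP _; move/eqP: e1; rewrite addrC addr_eq0 => /eqP <-.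
  exact: psd_gram.
split=> s s0 rs; last first.
  apply/eqP; rewrite eq_sym -subr_eq0 id //.
  by rewrite (imag_conj s0) subrr scale0r.
rewrite /loewner_le id //; apply: psdZ; last exact: psd_congr.
by have := ltW s0; rewrite ReE pmulr_lge0 // invr_gt0 ltr0n.
Qed.

(** The feedthrough is the Halmos unitary completion of [D]. The first input block is forced by the
    second block column of [P C^* + B D^* = 0], and the output matrix is the transposed input matrix
    for the sake of symmetry. *)
Definition riccati_extension n p (A : 'M[K]_n) (B : 'M[K]_(n, p)) (D Rb Rc : 'M[K]_p)
    (P : 'M[K]_n) : realization K (p + p) (p + p) :=
  let Bf := row_mx (- ((P *m ctmx B^T + B *m ctmx D) *m Rc)) B in
  Realization A Bf Bf^T (block_mx (- ctmx D) (invmx Rb) (invmx Rc) D).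

(** The Lyapunov equation is the Riccati equation expanded. In the second lossless equation one
    block holds by the choice of the input matrix; the other is where [conj P] must be the inverse
    of [P]. *)
Lemma riccati_extension_inner n p (A : 'M[K]_n) (B : 'M[K]_(n, p)) (D Rb Rc : 'M[K]_p)
    (P : 'M[K]_n) : D^T = D -> Rb^T = Rc ->
  is_inv_sqrt Rb (1%:M - ctmx D *m D) -> is_inv_sqrt Rc (1%:M - D *m ctmx D) ->
  (forall l, root (char_poly A) l -> 'Re l < 0) ->
  ctmx P = P -> conjm P *m P = 1%:M ->
  let a := A + B *m ctmx D *m (Rc *m Rc) *m B^T in
  let b := B *m Rb in
  a *m P + P *m ctmx a + P *m conjm (b *m ctmx b) *m P + b *m ctmx b = 0 ->
  inner (riccati_extension A B D Rb Rc P).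
Proof.
move=> sD tR hb hc st hP PP a b ric.
have [uRb uMb iMb eb] := inv_sqrt_unit hb; have [uRc uMc iMc ec] := inv_sqrt_unit hc.
have hRb : ctmx Rb = Rb by case: hb. have hRc : ctmx Rc = Rc by case: hc.
have [swc swb] := defect_swap hb hc.
have tRc : Rc^T = Rb by rewrite -tR trmxK.
have ctB : ctmx B^T = conjm B by rewrite /ctmx conj_mx_tr trmxK.
have cD : conjm D = ctmx D by rewrite /ctmx conj_mx_tr sD.
have cRc : conjm Rc = Rb by apply: trmx_inj; rewrite tR -[RHS]hRc.
have iRb : invmx Rb = (1%:M - ctmx D *m D) *m Rb.
  by rewrite -[LHS]mulmx1 -{1}eb -!mulmxA mulKmx.
have iRc : invmx Rc = (1%:M - D *m ctmx D) *m Rc.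
  by rewrite -[LHS]mulmx1 -{1}ec -!mulmxA mulKmx.
have iRb2 : invmx Rb *m invmx Rb = 1%:M - ctmx D *m D.
  by rewrite {1}iRb -mulmxA mulmxV // mulmx1.
have iRc2 : invmx Rc *m invmx Rc = 1%:M - D *m ctmx D.
  by rewrite {1}iRc -mulmxA mulmxV // mulmx1.
have DiR : D *m invmx Rb = invmx Rc *m D.
  by apply: (can_inj (mulmxK uRb)); rewrite mulmxKV // -mulmxA -swc mulKmx.
have DiR' : ctmx D *m invmx Rc = invmx Rb *m ctmx D.
  by apply: (can_inj (mulmxK uRc)); rewrite mulmxKV // -mulmxA -swb mulKmx.
set B1 := - ((P *m ctmx B^T + B *m ctmx D) *m Rc).
apply: (@lossless_inner _ (riccati_extension A B D Rb Rc P) P hP st) => /=; rewrite -/B1.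
- rewrite ctmx_row mul_row_col.
  have -> : B1 *m ctmx B1 = (P *m ctmx B^T + B *m ctmx D) *m (Rc *m Rc) *m
      (B^T *m P + D *m ctmx B).
    by rewrite /B1 ctmxN mulNmx mulmxN opprK !ctmxM !ctmxD !ctmxM !ctmxK hP hRc !mulmxA.
  rewrite -{}ric /a.
  have [_ <- _ _] := gram_conj (erefl (b *m ctmx b)).
  have -> : b *m ctmx b = B *m (1%:M + ctmx D *m (Rc *m Rc) *m D) *m ctmx B.
    by rewrite /b ctmxM hRb -(inv_sqrt_square hb hc) !mulmxA.
  rewrite /b trmx_mul tR ctmxD !ctmxM !hRc !ctmxK !(mulmxDl, mulmxDr) mulmx1 !mulmxA.
  move: (A *m P) (P *m ctmx A) (B *m ctmx B) => x1 x2 x3.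
  move: (P *m ctmx B^T *m Rc *m Rc *m B^T *m P) (P *m ctmx B^T *m Rc *m Rc *m D *m ctmx B) => x4 x5.
  move: (B *m ctmx D *m Rc *m Rc *m B^T *m P) (B *m ctmx D *m Rc *m Rc *m D *m ctmx B) => x6 x7.
  by apply/matrixP => i j; rewrite !mxE; ring.
- have cB1 : ctmx B1^T = - ((conjm P *m B + ctmx B^T *m D) *m Rb).
    have -> : ctmx B1^T = conjm B1 by rewrite /ctmx conj_mx_tr trmxK.
    rewrite /B1 conj_mxN !conj_mxM conj_mxD !conj_mxM cRc ctB.
    by rewrite conj_mxK -cD conj_mxK.
  rewrite tr_row_mx ctmx_col mul_mx_row ctmx_block mul_row_block add_row_mx !ctmx_inv hRb hRc.
  rewrite ctmxN ctmxK cB1 -row_mx0; congr row_mx; last first.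
    by rewrite /B1 mulNmx mulmxK // opprD addrA addrA addrN add0r addrC addrN.
  rewrite /B1 mulmxN mulmxN mulNmx opprK !mulmxDl !mulmxDr -!(mulmxA _ Rc) swc.
  rewrite !mulmxA (mulmx1C PP) mul1mx iRb mulmxBl mul1mx mulmxBr !mulmxA opprD.
  move: (B *m Rb) (P *m ctmx B^T *m D *m Rb) (B *m ctmx D *m D *m Rb) => x1 x2 x3.
  by apply/matrixP => i j; rewrite !mxE; ring.
rewrite ctmx_block mulmx_block ctmxN ctmxK !ctmx_inv hRb hRc iRb2 iRc2 mulNmx mulmxN opprK.
rewrite mulNmx mulmxN DiR DiR' !addNr scalar_mx_block addrC subrK subrK.
by [].
Qed.

End InnerExtension.

(** * Adjoining poles to the system *)

Section Augmentation.
Variable K : numClosedFieldType.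
Local Notation conjm := (map_mx (@Num.conj K)).

(** An input [u] of the loop-shifted system with output [g] corresponds to the input [u'] of [S],
    and the energy defect is preserved: [|u'|^2 - |S u'|^2 = |u|^2 - |g|^2]. *)
Lemma loop_shifted_contraction p (S : realization K p p) (Rb Rc : 'M[K]_p) s
    (x : 'cV[K]_(rdim S)) (u : 'cV[K]_p) :
  let A := rA S in let B := rB S in let C := rC S in let D := rD S in
  is_inv_sqrt Rb (1%:M - ctmx D *m D) -> is_inv_sqrt Rc (1%:M - D *m ctmx D) ->
  regular S s -> (forall v, vnorm2 (tf S s *m v) <= vnorm2 v) ->
  (s%:M - (A + B *m ctmx D *m (Rc *m Rc) *m C)) *m x = B *m Rb *m u ->
  vnorm2 (Rc *m C *m x) <= vnorm2 u.
Proof.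
move=> A B C D hb hc; rewrite /regular regular_unit => us ctr e.
have [_ _ _ eb] := inv_sqrt_unit hb; have [_ _ _ ec] := inv_sqrt_unit hc.
have hRb : ctmx Rb = Rb by case: hb. have hRc : ctmx Rc = Rc by case: hc.
have [swc swb] := defect_swap hb hc.
pose g := Rc *m C *m x; pose u' := ctmx D *m Rc *m g + Rb *m u.
have ex : (s%:M - A) *m x = B *m u'.
  rewrite /u' /g mulmxDr [B *m (Rb *m u)]mulmxA -e !mulmxA -mulmxDl.
  by congr (_ *m x); rewrite [RHS]addrC opprD addrA subrK.
have eRR : Rc *m Rc = 1%:M + D *m ctmx D *m (Rc *m Rc).
  have : (1%:M - D *m ctmx D) *m (Rc *m Rc) = 1%:M.
    by case: hc => _ [_ hc]; apply: mulmx1C.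
  by rewrite mulmxBl mul1mx => /eqP; rewrite subr_eq => /eqP.
have ey : tf S s *m u' = Rc *m g + D *m Rb *m u.
  rewrite /tf mulmxDl -/A -/B -/C -/D.
  have -> : C *m invmx (s%:M - A) *m B *m u' = C *m x.
    by rewrite -(mulmxA _ B) -ex -mulmxA mulKmx.
  rewrite /u' /g mulmxDr !mulmxA addrA; congr (_ + _).
  by rewrite eRR !mulmxDl mul1mx !mulmxA.
have := ctr u'; rewrite ey -subr_ge0 => le; rewrite -subr_ge0; apply: le_trans le _.
rewrite le_eqVlt; apply/orP; left; apply/eqP.
have -> : vnorm2 (Rc *m C *m x) = (ctmx g *m (Rc *m (1%:M - D *m ctmx D) *m Rc) *m g) 0 0.
  by rewrite ec mulmx1.
have -> : vnorm2 u = (ctmx u *m (Rb *m (1%:M - ctmx D *m D) *m Rb) *m u) 0 0.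
  by rewrite eb mulmx1.
rewrite /vnorm2 /u' !ctmxD !ctmxM !ctmxK hRb hRc !(mulmxBr, mulmxBl, mulmxDr, mulmxDl).
rewrite !mulmx1 !mulmxA !(mxD00, mxN00); ring.
Qed.

(* The direct sum of [H] and [block_mx L1 0 0 L2], with the coordinates regrouped. *)
Definition augment n k (H : 'M[K]_(n + n)) (L1 L2 : 'M[K]_k) : 'M[K]_((n + k) + (n + k)) :=
  block_mx (block_mx (ulsubmx H) 0 0 L1) (block_mx (ursubmx H) 0 0 0)
           (block_mx (dlsubmx H) 0 0 0) (block_mx (drsubmx H) 0 0 L2).

(** [T] permutes coordinates between dimensions that are equal but not convertible; so similarity is
    replaced by divisibility together with equality of degrees. *)
Lemma char_poly_augment n k (H : 'M[K]_(n + n)) (L1 L2 : 'M[K]_k) :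
  char_poly (augment H L1 L2) = char_poly H * (char_poly L1 * char_poly L2).
Proof.
pose N := block_mx H 0 0 (block_mx L1 0 0 L2).
pose T : 'M[K]_((n + n) + (k + k), (n + k) + (n + k)) :=
  block_mx (block_mx 1%:M 0 0 0) (block_mx 0 0 1%:M 0)
           (block_mx 0 1%:M 0 0) (block_mx 0 0 0 1%:M).
have fT : row_free T.
  apply/row_freeP; exists T^T; rewrite /T !tr_block_mx !trmx0 !trmx1 !mulmx_block.
  rewrite !(mulmx0, mul0mx, mulmx1, mul1mx, addr0, add0r) !add_block_mx.
  by rewrite !(addr0, add0r) !block_mx0 -!scalar_mx_block.
have eT : T *m augment H L1 L2 = N *m T.
  rewrite /N -[H in RHS]submxK /augment /T !mulmx_block.
  rewrite !(mulmx0, mul0mx, mulmx1, mul1mx, addr0, add0r) !add_block_mx.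
  by rewrite !(addr0, add0r).
have := char_poly_invariant fT eT; rewrite /N !char_poly_lblock => d.
apply/esym/eqP; rewrite -eqp_monic ?char_poly_monic //; last first.
  by rewrite !monicMl ?char_poly_monic.
rewrite -dvdp_size_eqp // size_char_poly !size_mul ?mulf_neq0 ?monic_neq0 ?char_poly_monic //.
rewrite !size_char_poly; apply/eqP; rewrite !addSn !addnS /=.
by rewrite addnACA.
Qed.

Lemma char_poly_diag k (d : 'rV[K]_k) :
  char_poly (diag_mx d) = \prod_(i < k) ('X - (d 0 i)%:P).
Proof.
rewrite char_poly_trig; first by apply: eq_bigr => i _; rewrite mxE eqxx.
by apply/is_trig_mxP => i j ij; rewrite mxE eq_sym; case: eqP ij => // ->; rewrite ltnn.
Qed.

End Augmentation.

Section Existence.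
Variable K : numClosedFieldType.
Local Notation conjm := (map_mx (@Num.conj K)).

Lemma hamiltonian_augment n p k (a : 'M[K]_n) (b : 'M[K]_(n, p)) (d : 'rV[K]_k) :
  hamiltonian (block_mx a 0 0 (diag_mx d)) (col_mx b 0) (col_mx b 0)^T =
  augment (hamiltonian a b b^T) (- ctmx (diag_mx d)) (diag_mx d).
Proof.
rewrite /augment /hamiltonian block_mxKul block_mxKur block_mxKdl block_mxKdr.
rewrite ctmx_block tr_col_mx trmx0 ctmx_row ctmx_col !ctmx0 !mul_col_row.
by rewrite !(mulmx0, mul0mx) !opp_block_mx !oppr0.
Qed.

Lemma ctmx_diag k (d : 'rV[K]_k) : - ctmx (diag_mx d) = diag_mx (- conjm d).
Proof.
rewrite /ctmx map_diag_mx tr_diag_mx; apply/matrixP => i j; rewrite !mxE.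
by rewrite mulNrn.
Qed.

Definition reflected_poles (ks : seq K) : 'rV[K]_(size ks) := \row_j - (nth 0 ks j)^*.

Lemma reflected_poles_neg (q : {poly K}) (ks : seq K) :
  (forall z, z \in ks = (0 < 'Re z) && root q z && odd (mup z q)) ->
  forall j, 'Re (reflected_poles ks 0 j) < 0.
Proof.
move=> hks j; rewrite mxE raddfN /= Re_conj oppr_lt0.
by have := hks (nth 0 ks j); rewrite mem_nth // => /esym/andP[/andP[]].
Qed.

(** The block [- L^*] contributes each [z] in [ks] once, and the reflected poles stay in the left
    half plane. Odd multiplicities thus become even and even ones do not change. *)
Lemma augmented_multiplicity n (H : 'M[K]_(n + n)) (ks : seq K) : uniq ks ->
  (forall z, z \in ks = (0 < 'Re z) && root (char_poly H) z && odd (mup z (char_poly H))) ->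
  forall z, 0 < 'Re z ->
  ~~ odd (mup z (char_poly (augment H (- ctmx (diag_mx (reflected_poles ks)))
                                    (diag_mx (reflected_poles ks))))).
Proof.
move=> uks hks z z0; rewrite char_poly_augment ctmx_diag !char_poly_diag.
have e : \prod_(i < size ks) ('X - ((- conjm (reflected_poles ks)) 0 i)%:P) =
    \prod_(x <- ks) ('X - x%:P).
  rewrite (big_nth 0) big_mkord; apply: eq_bigr => i _.
  have -> : (- conjm (reflected_poles ks)) 0 i = nth 0 ks i; last by [].
  by rewrite !mxE rmorphN /= conjCK opprK.
have r0 : ~~ root (\prod_i ('X - (reflected_poles ks 0 i)%:P)) z.
  apply/negP => /eqP; rewrite horner_prod => /eqP/prodf_eq0[i _].
  rewrite !hornerE subr_eq0 => /eqP ez; have := reflected_poles_neg hks i.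
  by rewrite -ez => /lt_trans/(_ z0); rewrite ltxx.
have n1 : \prod_(x <- ks) ('X - x%:P) != 0 by rewrite monic_neq0 ?monic_prod_XsubC.
have n2 : \prod_i ('X - (reflected_poles ks 0 i)%:P) != 0.
  by apply: contraNneq r0 => ->; rewrite root0.
rewrite e !mupM ?mulf_neq0 ?(monic_neq0 (char_poly_monic H)) // (mupNroot r0) addn0.
rewrite mu_prod_XsubC count_uniq_mem // hks z0 /= oddD.
have [rz|nz] := boolP (root (char_poly H) z); last by rewrite mupNroot.
by case: (odd _).
Qed.

Lemma diag_eigen k (d y : 'rV[K]_k) l j : y *m diag_mx d = l *: y -> y 0 j != 0 -> d 0 j = l.
Proof.
move=> /rowP/(_ j); rewrite mul_mx_diag !mxE mulrC => e y0.
exact: (mulIf y0 e).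
Qed.

Lemma augmented_riccati p (S : realization K p p) (Rb Rc : 'M[K]_p) (ks : seq K) :
  let A := rA S in let B := rB S in let D := rD S in
  let a := A + B *m ctmx D *m (Rc *m Rc) *m B^T in
  let aE := block_mx a 0 0 (diag_mx (reflected_poles ks)) in
  let bE := col_mx (B *m Rb) 0 in
  symmetric_real S -> minimal_real S -> schur S ->
  is_inv_sqrt Rb (1%:M - ctmx D *m D) -> is_inv_sqrt Rc (1%:M - D *m ctmx D) ->
  Rb^T = Rc -> a^T = a -> uniq ks ->
  (forall z, z \in ks = (0 < 'Re z) && root (char_poly (hamiltonian a (B *m Rb) (Rc *m rC S))) z
     && odd (mup z (char_poly (hamiltonian a (B *m Rb) (Rc *m rC S))))) ->
  exists P : 'M[K]_(rdim S + size ks), [/\ ctmx P = P, conjm P *m P = 1%:M &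
    aE *m P + P *m ctmx aE + P *m conjm (bE *m ctmx bE) *m P + bE *m ctmx bE = 0].
Proof.
move=> A B D a aE bE [sA [eC sD]] mS sS hb hc tR sa uks hks.
have [cS oS] := minimal_pbh mS.
have st := schur_stable (minimal_pbh mS) sS.
have [uRb _ _ _] := inv_sqrt_unit hb.
have eCR : Rc *m rC S = (B *m Rb)^T by rewrite trmx_mul tR eC.
have symS s : regular S s -> (tf S s)^T = tf S s.
  move=> rs; rewrite /tf linearD /= !trmx_mul trmx_inv linearB /= tr_scalar_mx sA sD eC.
  by rewrite trmxK mulmxA.
have d_neg := reflected_poles_neg hks.
(* Uncontrollable modes of the enlarged system live on the adjoined coordinates: a left eigenvector
   killed by [B] does not see the feedback term of [a]. *)
have aE_ctr (y : 'rV[K]_(rdim S + size ks)) l : y *m aE = l *: y -> y *m bE = 0 ->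
    lsubmx y = 0 /\ rsubmx y *m diag_mx (reflected_poles ks) = l *: rsubmx y.
  rewrite -{1}[y]hsubmxK mul_row_block !mulmx0 addr0 add0r => ya yb.
  have [e1 e2] : lsubmx y *m a = l *: lsubmx y /\
      rsubmx y *m diag_mx (reflected_poles ks) = l *: rsubmx y.
    by apply: eq_row_mx; rewrite ya -scale_row_mx hsubmxK.
  split=> //; have yB : lsubmx y *m B = 0.
    apply: (can_inj (mulmxK uRb)); rewrite mul0mx -mulmxA.
    by move: yb; rewrite -{1}[y]hsubmxK mul_row_col mulmx0 addr0.
  apply: (cS _ l) (yB); rewrite -e1 /a mulmxDr !mulmxA yB !mul0mx addr0.
  by [].
apply: symmetric_riccati.
- by rewrite tr_block_mx !trmx0 sa tr_diag_mx.
- apply: hamiltonian_neutral.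
  + by rewrite tr_block_mx !trmx0 sa tr_diag_mx.
  + move=> s s0 x u; rewrite -{1}[x]vsubmxK scalar_mx_block opp_block_mx add_block_mx.
    rewrite !oppr0 !addr0 mul_block_col !mul0mx addr0 add0r mul_col_mx mul0mx => /eq_col_mx[e _].
    rewrite tr_col_mx trmx0 -[x]vsubmxK mul_row_col mul0mx addr0 -eCR.
    have rs : regular S s.
      by apply/negP => /st; rewrite s0 ltxx.
    apply: (loop_shifted_contraction hb hc rs); first by move=> v; apply: schur_axis.
    by rewrite eC.
  + move=> y l l0 ya yb; have [y1 y2] := aE_ctr y l ya yb.
    rewrite -[y]hsubmxK y1; suff -> : rsubmx y = 0 by rewrite row_mx0.
    apply/rowP => j; rewrite [RHS]mxE; apply/eqP/negPn/negP => yj.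
    by have := d_neg j; rewrite (diag_eigen y2 yj) l0 ltxx.
- by move=> z z0; rewrite hamiltonian_augment -eCR; apply: augmented_multiplicity.
(* The reflected poles are distinct, so such an eigenvector has a single nonzero coordinate and
   cannot be isotropic. *)
move=> y l ya yb yy; have [y1 y2] := aE_ctr y l ya yb.
rewrite -[y]hsubmxK y1; suff -> : rsubmx y = 0 by rewrite row_mx0.
have {}yy : rsubmx y *m (rsubmx y)^T = 0.
  by move: yy; rewrite -{1 2}[y]hsubmxK y1 tr_row_mx mul_row_col mul0mx add0r.
move: (rsubmx y) y2 yy => t y2 yy.
apply/rowP => j; rewrite [RHS]mxE; apply/eqP/negPn/negP => yj.
have := congr1 (fun M : 'M_1 => M 0 0) yy; rewrite !mxE (bigD1 j) //= big1 => [|i ij].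
  by rewrite mxE addr0 => /eqP; rewrite mulf_eq0 (negbTE yj).
have [yi|yi] := eqVneq (t 0 i) 0; first by rewrite yi mul0r.
have := diag_eigen y2 yi; rewrite -(diag_eigen y2 yj) !mxE => /oppr_inj/(inv_inj (@conjCK K))/eqP.
by rewrite nth_uniq // => /eqP/val_inj ji; rewrite ji eqxx in ij.
Qed.

End Existence.

Theorem theorem6p6 (K : numClosedFieldType) (p : nat) (S : realization K p p)
    (Rb Rc : 'M[K]_p) (kappa_set : seq K) :
  let n := rdim S in
  let A := rA S in let B := rB S in let C := rC S in let D := rD S in
  symmetric_real S -> minimal_real S -> schur S -> strictly_contractive D ->
  is_inv_sqrt Rb (1%:M - ctmx D *m D) ->
  is_inv_sqrt Rc (1%:M - D *m ctmx D) ->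
  let Ah := A + B *m ctmx D *m invmx (1%:M - D *m ctmx D) *m C in
  let Bh := B *m Rb in
  let Ch := Rc *m C in
  let H : 'M[K]_(n + n) :=
    block_mx (- ctmx Ah) (- (ctmx Ch *m Ch)) (Bh *m ctmx Bh) Ah in
  uniq kappa_set ->
  (forall z : K, z \in kappa_set =
     (0 < 'Re z) && root (char_poly H) z && odd (mup z (char_poly H))) ->
  let kappa := size kappa_set in
  (exists E : realization K (p + p) (p + p),
      extension E S /\ symmetric_fun E /\ inner E /\ mcmillan_degree E (n + kappa)%N) /\
  (forall (E : realization K (p + p) (p + p)) (k : nat),
      extension E S -> symmetric_fun E -> inner E -> mcmillan_degree E k ->
      (n + kappa <= k)%N).
Proof.
move=> n A B C D symS mS sS _ hb hc Ah Bh Ch H uks hks kappa.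
have [sA [eC sD]] := symS.
have [_ uM iM _] := inv_sqrt_unit hc.
have c0 : \det (1%:M - D *m ctmx D) != 0 by rewrite -unitfE -unitmxE.
have lower w (E : realization K (p + p) (p + p)) : w != 0 -> sym_inner_ext_on w E S ->
    (n + kappa <= rdim E)%N.
  move=> w0 hE; apply: (degree_lower_bound (minimal_pbh mS) c0 _ _ w0 hE uks).
  - exact: (monic_neq0 (char_poly_monic H)).
  - by move=> s r1 r2; apply: det_defect.
  - by move=> z; rewrite hks => /andP[/andP[-> _] ->].
have lower_same (E E' : realization K (p + p) (p + p)) : extension E S ->
    symmetric_fun E -> inner E -> same_fun E E' -> (n + kappa <= rdim E')%N.
  move=> ext symE [_ inE] sf; apply: (lower (char_poly (rA E))); first exact: regular_generic.
  move=> s rE rE'; rewrite -(sf s rE rE'); split.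
  - exact: ext.
  - exact: symE.
  - by move=> s0; apply: inE.
split; last first.
  by move=> E k ext symE inE [[E' [sf <-]] _]; apply: (lower_same E).
have tD : (ctmx D)^T = ctmx D by rewrite -ctmx_tr sD.
(* For symmetric [D] the two defect matrices are transposes of each other; uniqueness of the inverse
   square root transfers this to [Rb] and [Rc]. *)
have tR : Rb^T = Rc.
  apply: inv_sqrt_unique hc; have := inv_sqrt_tr hb.
  by rewrite linearB /= trmx1 trmx_mul tD sD.
have [_ swb] := defect_swap hb hc.
pose a := A + B *m ctmx D *m (Rc *m Rc) *m B^T.
have eAh : Ah = a by rewrite /Ah iM /C eC.
have sa : a^T = a.
  have tRc : Rc^T = Rb by rewrite -tR trmxK.
  rewrite linearD /= !trmx_mul trmxK tD tRc sA !mulmxA; congr (_ + _).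
  by rewrite -(mulmxA _ Rb (ctmx D)) swb mulmxA -(mulmxA _ Rb (ctmx D)) swb !mulmxA.
rewrite /H eAh in hks.
have [P [hP PP ric]] := augmented_riccati symS mS sS hb hc tR sa uks hks.
pose d := reflected_poles kappa_set.
pose AE := block_mx A 0 0 (diag_mx d); pose BE := col_mx B (0 : 'M_(kappa, p)).
pose E := riccati_extension AE BE D Rb Rc P.
have st l : root (char_poly AE) l -> 'Re l < 0.
  rewrite char_poly_lblock rootM => /orP[|].
    exact: (schur_stable (minimal_pbh mS) sS).
  rewrite char_poly_diag => /eqP; rewrite horner_prod => /eqP/prodf_eq0[i _].
  rewrite !hornerE subr_eq0 => /eqP ->.
  exact: reflected_poles_neg hks i.
have inE : inner E.
  apply: riccati_extension_inner => //.
  have -> : AE + BE *m ctmx D *m (Rc *m Rc) *m BE^T = block_mx a 0 0 (diag_mx d).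
    rewrite /BE 2!mul_col_mx !mul0mx tr_col_mx trmx0 mul_col_row !mulmx0 !mul0mx.
    by rewrite /AE add_block_mx !addr0.
  by have -> : BE *m Rb = col_mx (B *m Rb) 0 by rewrite mul_col_mx mul0mx.
have ext : extension E S.
  move=> s; rewrite {1}/regular /= char_poly_lblock rootM negb_or => /andP[rA rL] rS.
  rewrite -tf_dr /tf /= block_mxKdr row_mxKr tr_row_mx col_mxKd; congr (_ + _).
  rewrite /AE scalar_mx_block opp_block_mx add_block_mx !oppr0 !addr0.
  rewrite invmx_lblock -?regular_unit // mulmx0 mul0mx oppr0.
  rewrite tr_col_mx trmx0 mul_row_block !mul0mx !mulmx0 !addr0 mul_row_col mulmx0 addr0.
  by rewrite eC.
have symE : symmetric_fun E.
  move=> s _; rewrite /tf /= linearD /= !trmx_mul trmxK trmx_inv linearB /= tr_scalar_mx.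
  rewrite mulmxA; congr (_ *m invmx (_ - _) *m _ + _).
    by rewrite tr_block_mx !trmx0 sA tr_diag_mx.
  rewrite tr_block_mx !trmx_inv linearN /= tD sD.
  by rewrite -tR trmxK tR.
(* [E] has dimension [n + kappa]; the lower bound for all realizations of the same function shows
   that none is smaller. *)
exists E; do 4!split=> //; first by exists E.
by move=> E' sf; apply: (lower_same E).
Qed.
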